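(* Let $X,Y$ be non-zero Banach spaces over $\mathbb K\in\{\mathbb R,\mathbb C\}$ and let $\alpha\in\{\varepsilon,\pi\}$. Then $$\widetilde C_{\mathrm{NJ}}(X\widehat\otimes_\alpha Y)=\begin{cases}2,&\dim X=\dim Y=\infty,\\ \widetilde C_{\mathrm{NJ}}(Y),&\dim X<\infty,\\ \widetilde C_{\mathrm{NJ}}(X),&\dim Y<\infty.\end{cases}$$ When both factors are finite-dimensional, the last two lines agree and $\widetilde C_{\mathrm{NJ}}(X)=\widetilde C_{\mathrm{NJ}}(Y)=\widetilde C_{\mathrm{NJ}}(X\widehat\otimes_\alpha Y)=1$. Consequently, $$\widetilde C_{\mathrm{NJ}}(X\widehat\otimes_\alpha Y)<2$$ if and only if $$\widetilde C_{\mathrm{NJ}}(X)<2,\qquad\widetilde C_{\mathrm{NJ}}(Y)<2,\qquad\min\{\dim X,\dim Y\}<\infty.$$ Equivalently, $X\widehat\otimes_\alpha Y$ is superreflexive if and only if both $X$ and $Y$ are superreflexive and one of them is finite-dimensional.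
   Context: For a Banach space $X$ with norm $\|\cdot\|$, the von Neumann--Jordan constant is $$C_{\mathrm{NJ}}(X)=C_{\mathrm{NJ}}(X,\|\cdot\|)=\sup\left\{\frac{\|x+y\|^{2}+\|x-y\|^{2}}{2(\|x\|^{2}+\|y\|^{2})}: x,y\in X,\ (x,y)\neq(0,0)\right\}.$$ The renorming envelope is $\widetilde C_{\mathrm{NJ}}(Z)=\inf\{C_{\mathrm{NJ}}(Z,|\!|\!|\cdot|\!|\!|): |\!|\!|\cdot|\!|\!|\text{ is an equivalent norm on }Z\}$. For Banach spaces $X,Y$ over $\mathbb K$, and $w=\sum_{j=1}^r x_j\otimes y_j$ in the algebraic tensor product $X\otimes Y$, the injective norm is $\|w\|_\varepsilon=\sup\{|\sum_{j} x^*(x_j)y^*(y_j)|: x^*\in B_{X^*},\,y^*\in B_{Y^*}\}$ and the projective norm is $\|w\|_\pi=\inf\{\sum_{j}\|x_j\|\|y_j\|: w=\sum_{j} x_j\otimes y_j\}$. For $\alpha\in\{\varepsilon,\pi\}$, $X\widehat\otimes_\alpha Y$ is the completion of $X\otimes Y$ for $\|\cdot\|_\alpha$. A Banach space $Z$ is superreflexive if every Banach space finitely representable in $Z$ is reflexive. *)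

(* Defs.v *)
From HB Require Import structures.
From mathcomp Require Import all_boot all_order all_algebra.
From mathcomp Require Import ring_quotient complex.
From mathcomp Require Import lra.
From mathcomp Require Import all_classical all_reals all_analysis.
Set Implicit Arguments.
Unset Strict Implicit.
Unset Printing Implicit Defensive.
Import Order.TTheory GRing.Theory Num.Theory.
Import numFieldNormedType.Exports.
Local Open Scope classical_set_scope.
Local Open Scope quotient_scope.
Local Open Scope ring_scope.

(** [scalars R k] is [R] or [R[i]].  The norm of a [normedModType K] is valued in
    [K], so for [K = R[i]] the norm of a vector is a nonnegative
    element of [R[i]]; [rnorm] is that norm read in [R], where suprema and
    infima are available.  The modulus of a scalar [l] is
    [rnorm (l : (scalars R k)^o)]. *)

Variant scalar_kind := RealScalars | ComplexScalars.

Definition scalars (R : realType) (k : scalar_kind) : numFieldType :=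
  match k with RealScalars => R | ComplexScalars => R[i]%C end.

Definition toR (R : realType) (k : scalar_kind) : scalars R k -> R :=
  match k with RealScalars => id | ComplexScalars => @complex.Re R end.

Definition ofR (R : realType) (k : scalar_kind) : R -> scalars R k :=
  match k with RealScalars => id | ComplexScalars => fun x => x%:C%C end.

Definition rnorm (R : realType) (k : scalar_kind)
  (V : normedModType (scalars R k)) (x : V) : R := toR `|x|.

Section ScalarTheory.
Variables (R : realType) (k : scalar_kind).
Local Notation K := (scalars R k).
Implicit Types (V : normedModType K) (a b : R).

Lemma ofRK : cancel (@ofR R k) (@toR R k).
Proof. by case: k. Qed.

Lemma toRK (z : K) : 0 <= z -> ofR k (toR z) = z.
Proof.
case: k z => //= -[x y]; rewrite lecE /= => /andP[/eqP -> _] //.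
Qed.

Lemma ofR_le a b : (ofR k a <= ofR k b) = (a <= b).
Proof. by case: k => //=; rewrite lecE /= eqxx. Qed.

Lemma ofR_lt a b : (ofR k a < ofR k b) = (a < b).
Proof. by case: k => //=; rewrite ltcE /= eqxx. Qed.

Lemma ofR0 : ofR k (0 : R) = 0.
Proof. by case: k. Qed.

Lemma ofRD a b : ofR k (a + b) = ofR k a + ofR k b.
Proof. by case: k => //=; rewrite rmorphD. Qed.

Lemma ofRM a b : ofR k (a * b) = ofR k a * ofR k b.
Proof. by case: k => //=; rewrite rmorphM. Qed.

Lemma rnormE V (x : V) : `|x| = ofR k (rnorm x).
Proof. by rewrite /rnorm toRK. Qed.

Lemma rnorm_ge0 V (x : V) : 0 <= rnorm x.
Proof. by rewrite -ofR_le -rnormE ofR0. Qed.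

Lemma rnormD V (x y : V) : rnorm (x + y) <= rnorm x + rnorm y.
Proof. by rewrite -ofR_le ofRD -!rnormE ler_normD. Qed.

Lemma rnormZ V (l : K) (x : V) : rnorm (l *: x) = rnorm (l : K^o) * rnorm x.
Proof. by apply: (can_inj ofRK); rewrite ofRM -!rnormE normrZ. Qed.

Lemma rnorm0 V : rnorm (0 : V) = 0.
Proof. by apply: (can_inj ofRK); rewrite -rnormE normr0 ofR0. Qed.

Lemma rnorm0_eq0 V (x : V) : rnorm x = 0 -> x = 0.
Proof. by move=> x0; apply: normr0_eq0; rewrite rnormE x0 ofR0. Qed.

Lemma rnormM (a b : K) :
  rnorm (a * b : K^o) = rnorm (a : K^o) * rnorm (b : K^o).
Proof. exact: (@rnormZ K^o a b). Qed.

Lemma rnormN V (x : V) : rnorm (- x) = rnorm x.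
Proof. by rewrite /rnorm normrN. Qed.

Lemma rnorm1 : rnorm (1 : K^o) = 1.
Proof. by rewrite /rnorm normr1; case: k. Qed.

Lemma rnorm_ofR a : 0 <= a -> rnorm (ofR k a : K^o) = a.
Proof.
by move=> a0; rewrite /rnorm ger0_norm ?ofRK// -ofR0 ofR_le.
Qed.

End ScalarTheory.

Section Norms.
Variables (R : realType) (k : scalar_kind).
Local Notation K := (scalars R k).

Definition is_seminorm (E : lmodType K) (N : E -> R) : Prop :=
  (forall x y, N (x + y) <= N x + N y) /\
  (forall (l : K) x, N (l *: x) = rnorm (l : K^o) * N x).

Definition is_norm (E : lmodType K) (N : E -> R) : Prop :=
  is_seminorm N /\ (forall x, N x = 0 -> x = 0).

Definition equivalent_norm (Z : normedModType K) (N : Z -> R) : Prop :=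
  is_norm N /\
  exists c C : R, [/\ 0 < c, 0 < C &
    forall z, c * rnorm z <= N z /\ N z <= C * rnorm z].

Definition CNJ (E : lmodType K) (N : E -> R) : R :=
  sup [set r | exists x y : E, (x, y) != (0, 0) /\
    r = (N (x + y) ^+ 2 + N (x - y) ^+ 2) / (2 * (N x ^+ 2 + N y ^+ 2))].

Definition CNJ_envelope (Z : normedModType K) : R :=
  inf [set c | exists N : Z -> R, equivalent_norm N /\ c = CNJ N].

End Norms.

Section Dimension.
Variables (R : realType) (k : scalar_kind) (V : lmodType (scalars R k)).
Local Notation K := (scalars R k).

Definition lin_indep (n : nat) (e : 'I_n -> V) : Prop :=
  forall c : 'I_n -> K, \sum_i c i *: e i = 0 -> forall i, c i = 0.

(* [+oo] exactly when [V] is infinite-dimensional. *)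
Definition dimension : \bar R :=
  ereal_sup [set r | exists n (e : 'I_n -> V), lin_indep e /\ r = n%:R%:E].

Definition lin_span (n : nat) (e : 'I_n -> V) : set V :=
  [set v | exists c : 'I_n -> K, v = \sum_i c i *: e i].

End Dimension.

Section Dual.
Variables (R : realType) (k : scalar_kind) (X : normedModType (scalars R k)).
Local Notation K := (scalars R k).

Definition bounded_functional (f : X -> K^o) : bool :=
  `[< (forall (l : K) x y, f (l *: x + y) = l *: f x + f y) /\
      (exists M : R, forall x, rnorm (f x) <= M * rnorm x) >].

Lemma bounded_functional_closed : submod_closed bounded_functional.
Proof.
split.
  apply/asboolP; split=> [l x y|]; first by rewrite /= scaler0 addr0.
  by exists 0 => x; rewrite rnorm0 mul0r.
move=> l f g /asboolP[fl [M fM]] /asboolP[gl [M' gM]]; apply/asboolP; split.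
  move=> a x y; rewrite !fctE fl gl !scalerDr !scalerA (mulrC l).
  by rewrite addrACA.
exists (rnorm (l : K^o) * M + M') => x; rewrite !fctE.
apply: (le_trans (rnormD _ _)); rewrite rnormZ mulrDl -mulrA.
by apply: lerD => //; apply: ler_wpM2l => //; exact: rnorm_ge0.
Qed.

HB.instance Definition _ :=
  GRing.isSubmodClosed.Build K (X -> K^o) bounded_functional
    bounded_functional_closed.

Record dual : Type := Dual {
  dual_fun :> X -> K^o;
  dualP : bounded_functional dual_fun }.

HB.instance Definition _ := [isSub for dual_fun].
HB.instance Definition _ := [Choice of dual by <:].
HB.instance Definition _ := [SubChoice_isSubLmodule of dual by <:].

Definition op_norm (f : dual) : R :=
  sup [set r | exists x : X, rnorm x <= 1 /\ r = rnorm (f x)].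

Lemma dual_linear (f : dual) (l : K) x y : f (l *: x + y) = l *: f x + f y.
Proof. by have /asboolP[fl _] := dualP f. Qed.

Lemma dual0 (f : dual) : f 0 = 0.
Proof.
by have := dual_linear f (-1) 0 0; rewrite scaler0 addr0 scaleN1r addNr.
Qed.

Lemma dualZ (f : dual) (l : K) x : f (l *: x) = l *: f x.
Proof. by rewrite -[l *: x]addr0 dual_linear dual0 addr0. Qed.

Lemma op_norm_has_sup (f : dual) :
  has_sup [set r | exists x : X, rnorm x <= 1 /\ r = rnorm (f x)].
Proof.
split; first by exists (rnorm (f 0)); exists 0; rewrite rnorm0.
have /asboolP[_ [M fM]] := dualP f.
exists `|M| => _ [x [x1 ->]]; apply: (le_trans (fM x)).
apply: (@le_trans _ _ (`|M| * rnorm x)).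
  by apply: ler_wpM2r; [exact: rnorm_ge0|exact: ler_norm].
by rewrite -[leRHS]mulr1; apply: ler_wpM2l.
Qed.

Lemma op_norm_ub (f : dual) x : rnorm x <= 1 -> rnorm (f x) <= op_norm f.
Proof.
by move=> x1; apply: (sup_upper_bound (op_norm_has_sup f)); exists x.
Qed.

Lemma op_norm_le (f : dual) (c : R) :
  (forall x, rnorm x <= 1 -> rnorm (f x) <= c) -> op_norm f <= c.
Proof.
move=> fc; apply: ge_sup; first by case: (op_norm_has_sup f).
by move=> _ [x [x1 ->]]; exact: fc.
Qed.

Lemma op_norm_ge0 (f : dual) : 0 <= op_norm f.
Proof.
by rewrite (le_trans (rnorm_ge0 (f 0)))// op_norm_ub// rnorm0.
Qed.

Lemma op_normP (f : dual) x : rnorm (f x) <= op_norm f * rnorm x.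
Proof.
have [->|x0] := eqVneq x 0; first by rewrite dual0 !rnorm0 mulr0.
have r0 : 0 < rnorm x.
  rewrite lt_neqAle rnorm_ge0 andbT eq_sym; apply: contra x0 => /eqP x0.
  by rewrite (rnorm0_eq0 x0).
set l : K := ofR k (rnorm x)^-1.
have lE : rnorm (l : K^o) = (rnorm x)^-1.
  by rewrite rnorm_ofR// invr_ge0 rnorm_ge0.
have := @op_norm_ub f (l *: x).
rewrite dualZ !rnormZ lE mulVf ?gt_eqF// => /(_ (lexx _)).
by rewrite mulrC ler_pdivrMr.
Qed.

Lemma op_normD (f g : dual) : op_norm (f + g) <= op_norm f + op_norm g.
Proof.
apply: op_norm_le => x x1.
have -> : (f + g) x = f x + g x by [].
by apply: (le_trans (rnormD _ _)); apply: lerD; exact: op_norm_ub.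
Qed.

Lemma op_normZ_le (l : K) (f : dual) :
  op_norm (l *: f) <= rnorm (l : K^o) * op_norm f.
Proof.
apply: op_norm_le => x x1.
have -> : (l *: f) x = l *: f x by [].
rewrite rnormZ; apply: ler_wpM2l; first exact: rnorm_ge0.
exact: op_norm_ub.
Qed.

Lemma op_normZ (l : K) (f : dual) :
  op_norm (l *: f) = rnorm (l : K^o) * op_norm f.
Proof.
apply/eqP; rewrite eq_le op_normZ_le /=.
have [->|l0] := eqVneq l 0; first by rewrite rnorm0 mul0r op_norm_ge0.
have := op_normZ_le l^-1 (l *: f); rewrite scalerA mulVf// scale1r => h.
apply: (le_trans (ler_wpM2l (rnorm_ge0 _) h)).
by rewrite mulrA -rnormM mulfV// rnorm1 mul1r.
Qed.

Lemma op_norm0_eq0 (f : dual) : op_norm f = 0 -> f = 0.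
Proof.
move=> f0; apply: val_inj; apply/funext => x /=.
apply: rnorm0_eq0; apply/eqP; rewrite eq_le rnorm_ge0 andbT.
by have := op_normP f x; rewrite f0 mul0r.
Qed.

Definition dual_norm (f : dual) : K := ofR k (op_norm f).

Lemma dual_normD f g : dual_norm (f + g) <= dual_norm f + dual_norm g.
Proof. by rewrite -ofRD ofR_le op_normD. Qed.

Lemma dual_normZ (l : K) f : dual_norm (l *: f) = `|l| * dual_norm f.
Proof. by rewrite /dual_norm op_normZ ofRM -(rnormE (l : K^o)). Qed.

Lemma dual_norm0_eq0 f : dual_norm f = 0 -> f = 0.
Proof.
by rewrite /dual_norm -(ofR0 R k) => /(can_inj (@ofRK R k)) /op_norm0_eq0.
Qed.

HB.instance Definition _ :=
  Lmodule_isNormed.Build K dual dual_normD dual_normZ dual_norm0_eq0.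

Lemma rnorm_dual (f : dual) : rnorm f = op_norm f.
Proof. exact: ofRK. Qed.

End Dual.

Section Superreflexivity.
Variables (R : realType) (k : scalar_kind).
Local Notation K := (scalars R k).

(* Surjectivity of the canonical map of [X] into its bidual. *)
Definition reflexive_space (X : normedModType K) : Prop :=
  forall Phi : dual (dual X), exists x : X, forall f : dual X, Phi f = f x.

Definition linear_on (W Z : lmodType K) (F : set W) (T : W -> Z) : Prop :=
  forall (l : K) x y, F x -> F y -> T (l *: x + y) = l *: T x + T y.

(* Every finite-dimensional subspace [lin_span e] of [W] is
   [(1 + d)]-isomorphic to a subspace of [Z]; only the restriction of [T] to
   [lin_span e] matters. *)
Definition finitely_representable (W Z : normedModType K) : Prop :=
  forall (n : nat) (e : 'I_n -> W) (d : R), 0 < d ->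
  exists T : W -> Z, linear_on (lin_span e) T /\
    forall w, lin_span e w ->
      (1 + d)^-1 * rnorm w <= rnorm (T w) /\
      rnorm (T w) <= (1 + d) * rnorm w.

Definition superreflexive (Z : normedModType K) : Prop :=
  forall W : completeNormedModType K,
    finitely_representable W Z -> reflexive_space W.

End Superreflexivity.

(** [X \otimes Y] is realised as the space of linear functionals on the
    bilinear forms on [X * Y] spanned by the evaluations
    [x \otimes y : b |-> b x y].  Bilinear forms are algebraic, with no
    continuity, so this is the algebraic tensor product. *)

Section Tensor.
Variables (R : realType) (k : scalar_kind).
Local Notation K := (scalars R k).
Section Algebraic.
Variables (X Y : lmodType K).

Definition is_bilinear (b : X -> Y -> K) : Prop :=
  (forall (l : K) x x' y, b (l *: x + x') y = l * b x y + b x' y) /\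
  (forall (l : K) x y y', b x (l *: y + y') = l * b x y + b x y').

Record bilinear_form := BilinearForm {
  bilin_fun :> X -> Y -> K;
  bilinP : is_bilinear bilin_fun }.

Definition tsum_fun (s : seq (X * Y)) : bilinear_form -> K^o :=
  fun b => \sum_(p <- s) b p.1 p.2.

Definition tensor_pred (phi : bilinear_form -> K^o) : bool :=
  `[< exists s, phi = tsum_fun s >].

Lemma tensor_pred_closed : submod_closed tensor_pred.
Proof.
split.
  apply/asboolP; exists [::]; apply/funext => b.
  by rewrite /tsum_fun big_nil.
move=> l f g /asboolP[s ->] /asboolP[t ->]; apply/asboolP.
exists ([seq (l *: p.1, p.2) | p <- s] ++ t); apply/funext => b.
rewrite /tsum_fun big_cat big_map /= !fctE scaler_sumr; congr (_ + _).
apply: eq_bigr => -[x y] _ /=; have [bl _] := bilinP b.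
have b0 : b 0 y = 0.
  by have := bl (-1) 0 0 y; rewrite scaler0 addr0 mulN1r addNr.
by have := bl l x 0 y; rewrite b0 !addr0.
Qed.

HB.instance Definition _ :=
  GRing.isSubmodClosed.Build K (bilinear_form -> K^o) tensor_pred
    tensor_pred_closed.

Record tensor : Type := Tensor {
  tensor_fun :> bilinear_form -> K^o;
  tensorP : tensor_pred tensor_fun }.

HB.instance Definition _ := [isSub for tensor_fun].
HB.instance Definition _ := [Choice of tensor by <:].
HB.instance Definition _ := [SubChoice_isSubLmodule of tensor by <:].

Lemma tsum_proof (s : seq (X * Y)) : tensor_pred (tsum_fun s).
Proof. by apply/asboolP; exists s. Qed.

(* [tsum [:: (x1, y1); ...; (xr, yr)]] is [\sum_j xj \otimes yj]. *)
Definition tsum (s : seq (X * Y)) : tensor := Tensor (tsum_proof s).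

Lemma tsum_surj (w : tensor) : exists s, w = tsum s.
Proof.
by have /asboolP[s ws] := tensorP w; exists s; exact: val_inj.
Qed.

Lemma tsum_cat s t : tsum (s ++ t) = tsum s + tsum t.
Proof.
by apply: val_inj; apply/funext => b; rewrite /= /tsum_fun big_cat.
Qed.

Lemma tsumZ (l : K) s : tsum [seq (l *: p.1, p.2) | p <- s] = l *: tsum s.
Proof.
apply: val_inj; apply/funext => b.
rewrite /= !fctE /tsum_fun big_map scaler_sumr.
apply: eq_bigr => -[x y] _ /=; have [bl _] := bilinP b.
have b0 : b 0 y = 0.
  by have := bl (-1) 0 0 y; rewrite scaler0 addr0 mulN1r addNr.
by have := bl l x 0 y; rewrite b0 !addr0.
Qed.

End Algebraic.

Section CrossNorms.
Variables (X Y : normedModType K).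

(* The sum depends on [w] only, not on the representation [s]. *)
Definition injective_norm (w : tensor X Y) : R :=
  sup [set r | exists s (f : dual X) (g : dual Y),
    [/\ w = tsum s, rnorm f <= 1, rnorm g <= 1 &
        r = rnorm (\sum_(p <- s) f p.1 * g p.2 : K^o)]].

Definition projective_norm (w : tensor X Y) : R :=
  inf [set r | exists s, w = tsum s /\
    r = \sum_(p <- s) rnorm p.1 * rnorm p.2].

Lemma dual_bilinear (f : dual X) (g : dual Y) :
  is_bilinear (fun x y => f x * g y).
Proof.
split=> [l x x' y|l x y y']; rewrite dual_linear.
  by rewrite mulrDl /GRing.scale /= mulrA.
by rewrite mulrDr /GRing.scale /= mulrCA.
Qed.

Lemma tensor_dualE s (f : dual X) (g : dual Y) :
  \sum_(p <- s) f p.1 * g p.2 = tsum s (BilinearForm (dual_bilinear f g)).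
Proof. by []. Qed.

Lemma inj_norm_has_sup (w : tensor X Y) : has_sup [set r | exists s (f : dual X) (g : dual Y),
    [/\ w = tsum s, rnorm f <= 1, rnorm g <= 1 &
        r = rnorm (\sum_(p <- s) f p.1 * g p.2 : K^o)]].
Proof.
have [s0 ws0] := tsum_surj w; split.
  exists (rnorm (w (BilinearForm (dual_bilinear 0 0)))).
  by exists s0, 0, 0; rewrite !rnorm0; split => //; rewrite ws0.
exists (\sum_(p <- s0) rnorm p.1 * rnorm p.2) => _ [s [f [g [ws f1 g1 ->]]]].
rewrite tensor_dualE -ws ws0 -tensor_dualE.
elim: s0 {ws0} => [|p s0 ih]; first by rewrite !big_nil rnorm0.
rewrite !big_cons; apply: (le_trans (rnormD _ _)); apply: lerD => //.
rewrite rnormM; apply: ler_pM; rewrite ?rnorm_ge0//.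
  rewrite (le_trans (op_normP f _))// -rnorm_dual -[leRHS]mul1r.
  by rewrite ler_wpM2r// rnorm_ge0.
rewrite (le_trans (op_normP g _))// -rnorm_dual -[leRHS]mul1r.
by rewrite ler_wpM2r// rnorm_ge0.
Qed.

Lemma inj_norm_ub (w : tensor X Y) (f : dual X) (g : dual Y) : rnorm f <= 1 -> rnorm g <= 1 ->
  rnorm (w (BilinearForm (dual_bilinear f g))) <= injective_norm w.
Proof.
move=> f1 g1; apply: (sup_upper_bound (inj_norm_has_sup w)).
by have [s ws] := tsum_surj w; exists s, f, g; split => //; rewrite ws.
Qed.

Lemma inj_norm_le (w : tensor X Y) (c : R) :
  (forall (f : dual X) (g : dual Y), rnorm f <= 1 -> rnorm g <= 1 ->
    rnorm (w (BilinearForm (dual_bilinear f g))) <= c) -> injective_norm w <= c.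
Proof.
move=> wc; apply: ge_sup; first by case: (inj_norm_has_sup w).
move=> _ [s [f [g [ws f1 g1 ->]]]].
by rewrite tensor_dualE -ws; exact: wc.
Qed.

Lemma seminorm_of_le (E : lmodType K) (N : E -> R) :
  (forall x, 0 <= N x) ->
  (forall x y, N (x + y) <= N x + N y) ->
  (forall (l : K) x, N (l *: x) <= rnorm (l : K^o) * N x) -> is_seminorm N.
Proof.
move=> N0 ND NZ; split => // l x; apply/eqP; rewrite eq_le NZ /=.
have [->|l0] := eqVneq l 0; first by rewrite rnorm0 mul0r N0.
have := NZ l^-1 (l *: x); rewrite scalerA mulVf// scale1r => h.
apply: (le_trans (ler_wpM2l (rnorm_ge0 _) h)).
by rewrite mulrA -rnormM mulfV// rnorm1 mul1r.
Qed.

Lemma injective_norm_seminorm : is_seminorm injective_norm.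
Proof.
apply: seminorm_of_le => [w|v w|l w].
- rewrite (le_trans (rnorm_ge0 (w (BilinearForm (dual_bilinear 0 0)))))//.
  by apply: inj_norm_ub; rewrite rnorm0.
- apply: inj_norm_le => f g f1 g1.
  apply: (le_trans (rnormD (v _) (w _))).
  by apply: lerD; exact: inj_norm_ub.
- apply: inj_norm_le => f g f1 g1.
  rewrite (rnormZ l (w _)) ler_wpM2l ?rnorm_ge0//.
  exact: inj_norm_ub.
Qed.

Lemma proj_norm_has_inf (w : tensor X Y) : has_inf [set r | exists s, w = tsum s /\
    r = \sum_(p <- s) rnorm p.1 * rnorm p.2].
Proof.
split.
  have [s ws] := tsum_surj w.
  by exists (\sum_(p <- s) rnorm p.1 * rnorm p.2); exists s.
exists 0 => _ [s [_ ->]]; apply: sumr_ge0 => p _.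
by rewrite mulr_ge0 ?rnorm_ge0.
Qed.

Lemma proj_norm_lb s :
  projective_norm (tsum s) <= \sum_(p <- s) rnorm p.1 * rnorm p.2.
Proof. by apply: (ge_inf (proj_norm_has_inf _).2); exists s. Qed.

Lemma proj_norm_adherent (w : tensor X Y) (e : R) : 0 < e ->
  exists2 s, w = tsum s &
    \sum_(p <- s) rnorm p.1 * rnorm p.2 < projective_norm w + e.
Proof.
move=> e0; have [_ [s [ws ->]] h] := inf_adherent e0 (proj_norm_has_inf w).
by exists s.
Qed.

Lemma projective_norm_seminorm : is_seminorm projective_norm.
Proof.
apply: seminorm_of_le => [w|v w|l w].
- apply: lb_le_inf; first by case: (proj_norm_has_inf w).
  move=> _ [s [_ ->]]; apply: sumr_ge0 => p _.
  by rewrite mulr_ge0 ?rnorm_ge0.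
- apply/ler_addgt0Pr => e e0.
  have e2 : 0 < e / 2 by rewrite divr_gt0.
  have [s vs hs] := proj_norm_adherent v e2.
  have [t wt ht] := proj_norm_adherent w e2.
  have := proj_norm_lb (s ++ t); rewrite tsum_cat -vs -wt big_cat /=.
  move: hs ht; set a := \sum_(p <- s) _; set b := \sum_(p <- t) _; lra.
- apply/ler_addgt0Pr => e e0; set a := rnorm (l : K^o).
  have a0 : 0 <= a by exact: rnorm_ge0.
  have a1 : 0 < a + 1 by rewrite ltr_wpDl.
  have [s ws hs] := proj_norm_adherent w (divr_gt0 e0 a1).
  have := proj_norm_lb [seq (l *: p.1, p.2) | p <- s]; rewrite tsumZ -ws.
  move=> /le_trans; apply; rewrite big_map /=.
  rewrite (eq_bigr (fun p => a * (rnorm p.1 * rnorm p.2))); last first.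
    by move=> p _; rewrite rnormZ mulrA.
  rewrite -mulr_sumr (le_trans (ler_wpM2l a0 (ltW hs)))// mulrDr lerD2l.
  by rewrite mulrCA ger_pMr// ler_pdivrMr// mul1r lerDl.
Qed.


End CrossNorms.
End Tensor.

(** Cauchy sequences modulo null sequences, with the limit norm.  For
    a norm this is the usual completion; asking only for a seminorm spares the
    proof that the injective and projective norms separate points. *)

Section Completion.
Variables (R : realType) (k : scalar_kind).
Local Notation K := (scalars R k).

Record seminorm (E : lmodType K) := Seminorm {
  seminorm_fun :> E -> R;
  seminormP : is_seminorm seminorm_fun }.

Variables (E : lmodType K) (N : seminorm E).

Lemma seminormD x y : N (x + y) <= N x + N y.
Proof. by have [] := seminormP N. Qed.

Lemma seminormZ (l : K) x : N (l *: x) = rnorm (l : K^o) * N x.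
Proof. by have [] := seminormP N. Qed.

Lemma seminorm0 : N 0 = 0.
Proof. by rewrite -(scale0r 0) seminormZ rnorm0 mul0r. Qed.

Lemma seminormN x : N (- x) = N x.
Proof. by rewrite -scaleN1r seminormZ (rnormN (1 : K^o)) rnorm1 mul1r. Qed.

Lemma seminorm_ge0 x : 0 <= N x.
Proof.
have := seminormD x (- x); rewrite subrr seminorm0 seminormN; lra.
Qed.

Lemma seminormB x y : `|N x - N y| <= N (x - y).
Proof.
have h1 := seminormD (x - y) y; have h2 := seminormD (y - x) x.
rewrite !subrK -[y - x]opprB seminormN in h1 h2.
by rewrite ler_norml; apply/andP; split; lra.
Qed.

Definition cauchy_pred (u : nat -> E) : bool :=
  `[< forall e : R, 0 < e -> exists n0 : nat,
      forall m n, (n0 <= m)%N -> (n0 <= n)%N -> N (u m - u n) < e >].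

Lemma cauchy_pred_closed : submod_closed cauchy_pred.
Proof.
split.
  by apply/asboolP => e e0; exists 0%N => m n _ _; rewrite subrr seminorm0.
move=> l u v /asboolP cu /asboolP cv; apply/asboolP => e e0.
set a := rnorm (l : K^o); have a0 : 0 <= a by exact: rnorm_ge0.
have a1 : 0 < a + 1 by rewrite ltr_wpDl.
have e2 : 0 < e / 2 by rewrite divr_gt0.
have [n1 h1] := cu _ (divr_gt0 e2 a1).
have [n2 h2] := cv _ e2.
exists (maxn n1 n2) => m n; rewrite !geq_max => /andP[m1 m2] /andP[n1' n2'].
rewrite !fctE opprD addrACA -scalerBr (le_lt_trans (seminormD _ _))//.
rewrite seminormZ -/a; have := h2 _ _ m2 n2'.
suff : a * N (u m - u n) <= e / 2 by lra.
rewrite (le_trans (ler_wpM2l a0 (ltW (h1 _ _ m1 n1'))))//.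
rewrite mulrCA ger_pMr ?divr_gt0// ler_pdivrMr// mul1r lerDl//.
Qed.

HB.instance Definition _ :=
  GRing.isSubmodClosed.Build K (nat -> E) cauchy_pred cauchy_pred_closed.

Record cauchy_seq : Type := CauchySeq {
  cauchy_fun :> nat -> E;
  cauchy_seqP : cauchy_pred cauchy_fun }.

HB.instance Definition _ := [isSub for cauchy_fun].
HB.instance Definition _ := [Choice of cauchy_seq by <:].
HB.instance Definition _ := [SubChoice_isSubLmodule of cauchy_seq by <:].

Definition null_seq (u : cauchy_seq) : bool :=
  `[< (fun n => N (u n)) @ \oo --> (0 : R) >].

Lemma null_seq_closed : zmod_closed null_seq.
Proof.
split.
  apply/asboolP; rewrite (_ : (fun _ => _) = cst 0); first exact: cvg_cst.
  by apply/funext => n; rewrite /= seminorm0.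
move=> u v /asboolP u0 /asboolP v0; apply/asboolP.
have uv0 : (fun n => N (u n) + N (v n)) @ \oo --> (0 : R).
  by rewrite -(addr0 (0 : R)); exact: cvgD.
apply: (squeeze_cvgr (f := fun=> 0) _ _ uv0); last exact: cvg_cst.
apply: nearW => n; rewrite seminorm_ge0 /= -[N (v n)]seminormN.
exact: seminormD.
Qed.

HB.instance Definition _ :=
  GRing.isZmodClosed.Build cauchy_seq null_seq null_seq_closed.

Definition null_zmod : zmodClosed cauchy_seq :=
  GRing.ZmodClosed.clone cauchy_seq null_seq _.

Definition completion : Type := Quotient.quot null_zmod.

HB.instance Definition _ := GRing.Zmodule.on completion.

Definition completion_class (u : cauchy_seq) : completion :=
  \pi_(Quotient.quot null_zmod) u.

Lemma completion_classP z : exists u, z = completion_class u.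
Proof. by exists (repr z); rewrite /completion_class reprK. Qed.

Lemma completion_class_eq u v :
  completion_class u = completion_class v <->
  (fun n => N (u n - v n)) @ \oo --> (0 : R).
Proof.
split.
  by move=> /eqP; rewrite -Quotient.idealrBE => /asboolP.
by move=> uv; apply/eqP; rewrite -Quotient.idealrBE; apply/asboolP.
Qed.

Lemma completion_classD u v :
  completion_class (u + v) = completion_class u + completion_class v.
Proof. by rewrite /completion_class !piE. Qed.

Definition completion_scale (l : K) (z : completion) : completion :=
  completion_class (l *: (repr z : cauchy_seq)).

Lemma completion_scaleE l u :
  completion_scale l (completion_class u) = completion_class (l *: u).
Proof.
apply/completion_class_eq.
have : completion_class (repr (completion_class u)) = completion_class u.
  by rewrite /completion_class reprK.
move=> /completion_class_eq h.
rewrite (_ : (fun _ => _) = (fun n => rnorm (l : K^o) *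
  N ((repr (completion_class u) : cauchy_seq) n - u n))); last first.
  by apply/funext => n; rewrite -seminormZ scalerBr.
by rewrite -(mulr0 (rnorm (l : K^o))); exact: cvgMl_tmp.
Qed.

Lemma completion_scaleA (a b : K) z :
  completion_scale a (completion_scale b z) = completion_scale (a * b) z.
Proof.
by have [u ->] := completion_classP z; rewrite !completion_scaleE scalerA.
Qed.

Lemma completion_scale1 : left_id 1 completion_scale.
Proof.
move=> z; have [u ->] := completion_classP z.
by rewrite completion_scaleE scale1r.
Qed.

Lemma completion_scaleDr : right_distributive completion_scale +%R.
Proof.
move=> l y z; have [u ->] := completion_classP y.
have [v ->] := completion_classP z.
by rewrite -completion_classD !completion_scaleE scalerDr completion_classD.
Qed.

Lemma completion_scaleDl z :
  {morph completion_scale^~ z : a b / a + b}.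
Proof.
move=> a b; have [u ->] := completion_classP z.
by rewrite !completion_scaleE scalerDl completion_classD.
Qed.

HB.instance Definition _ := GRing.Zmodule_isLmodule.Build K completion
  completion_scaleA completion_scale1 completion_scaleDr completion_scaleDl.

Lemma completion_classZ (l : K) u :
  completion_class (l *: u) = l *: completion_class u.
Proof. by rewrite -completion_scaleE. Qed.

Lemma completion_classN u : completion_class (- u) = - completion_class u.
Proof. by rewrite -scaleN1r completion_classZ scaleN1r. Qed.

Lemma cauchy_seq_cvg (u : cauchy_seq) : cvgn (fun n => N (u n)).
Proof.
apply/cauchy_cvgP/cauchyP => e e0; have /asboolP cu := cauchy_seqP u.
have [n0 h] := cu _ e0; exists (N (u n0)); exists n0 => // n /= n0n.
by rewrite /ball /= (le_lt_trans (seminormB _ _))// h.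
Qed.

Definition completion_rnorm (z : completion) : R :=
  limn (fun n => N ((repr z : cauchy_seq) n)).

Lemma completion_rnormE u :
  completion_rnorm (completion_class u) = limn (fun n => N (u n)).
Proof.
have : completion_class (repr (completion_class u)) = completion_class u.
  by rewrite /completion_class reprK.
move=> /completion_class_eq h; apply/eqP; rewrite -subr_eq0; apply/eqP.
rewrite /completion_rnorm -limB; try exact: cauchy_seq_cvg.
apply/cvg_lim => //; apply/norm_cvg0P.
apply: (squeeze_cvgr (f := fun=> 0) _ _ h); last exact: cvg_cst.
by apply: nearW => n; rewrite normr_ge0 seminormB.
Qed.

Lemma completion_rnormD y z :
  completion_rnorm (y + z) <= completion_rnorm y + completion_rnorm z.
Proof.
have [u ->] := completion_classP y; have [v ->] := completion_classP z.
rewrite -completion_classD !completion_rnormE.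
rewrite -limD; try exact: cauchy_seq_cvg.
apply: ler_lim; first exact: cauchy_seq_cvg.
  by apply: is_cvgD; exact: cauchy_seq_cvg.
by apply: nearW => n; exact: seminormD.
Qed.

Lemma completion_rnormZ (l : K) z :
  completion_rnorm (l *: z) = rnorm (l : K^o) * completion_rnorm z.
Proof.
have [u ->] := completion_classP z.
rewrite -completion_classZ !completion_rnormE.
rewrite (_ : (fun _ => _) = (fun n => rnorm (l : K^o) * N (u n))); last first.
  by apply/funext => n; rewrite -seminormZ.
by apply/cvg_lim => //; apply: cvgMl_tmp; exact: cauchy_seq_cvg.
Qed.

Lemma completion_rnorm0_eq0 z : completion_rnorm z = 0 -> z = 0.
Proof.
have [u ->] := completion_classP z; rewrite completion_rnormE => u0.
have -> : (0 : completion) = completion_class 0.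
  by have := completion_classZ 0 0; rewrite !scale0r.
apply/completion_class_eq.
rewrite (_ : (fun _ => _) = (fun n => N (u n))); last first.
  by apply/funext => n; rewrite subr0.
by rewrite -u0; exact: cauchy_seq_cvg.
Qed.

Definition completion_norm (z : completion) : K := ofR k (completion_rnorm z).

Lemma completion_normD y z :
  completion_norm (y + z) <= completion_norm y + completion_norm z.
Proof. by rewrite -ofRD ofR_le completion_rnormD. Qed.

Lemma completion_normZ (l : K) z :
  completion_norm (l *: z) = `|l| * completion_norm z.
Proof.
by rewrite /completion_norm completion_rnormZ ofRM -(rnormE (l : K^o)).
Qed.

Lemma completion_norm0_eq0 z : completion_norm z = 0 -> z = 0.
Proof.
rewrite /completion_norm -(ofR0 R k).
by move=> /(can_inj (@ofRK R k)) /completion_rnorm0_eq0.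
Qed.

HB.instance Definition _ := Lmodule_isNormed.Build K completion
  completion_normD completion_normZ completion_norm0_eq0.

Lemma rnorm_completion (z : completion) : rnorm z = completion_rnorm z.
Proof. exact: ofRK. Qed.

Lemma const_cauchy x : cauchy_pred (fun=> x).
Proof.
by apply/asboolP => e e0; exists 0%N => m n _ _; rewrite subrr seminorm0.
Qed.

Definition completion_inj (x : E) : completion :=
  completion_class (CauchySeq (const_cauchy x)).

Lemma completion_inj_linear (l : K) x y :
  completion_inj (l *: x + y) = l *: completion_inj x + completion_inj y.
Proof.
rewrite /completion_inj -completion_classZ -completion_classD.
by congr completion_class; exact: val_inj.
Qed.

Lemma completion_inj_norm x : rnorm (completion_inj x) = N x.
Proof.
rewrite rnorm_completion completion_rnormE.
by apply/cvg_lim => //; rewrite /=; exact: cvg_cst.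
Qed.

Lemma completion_approx u (e : R) : 0 < e -> exists n0, forall n, (n0 <= n)%N ->
  rnorm (completion_class u - completion_inj (u n)) <= e.
Proof.
move=> e0; have /asboolP cu := cauchy_seqP u; have [n0 h] := cu _ e0.
exists n0 => n n0n; rewrite -completion_classN -completion_classD.
rewrite rnorm_completion completion_rnormE.
apply: limr_le; first exact: cauchy_seq_cvg.
by exists n0 => // m /= n0m; apply/ltW/h.
Qed.

Lemma completion_inj_dense z (e : R) : 0 < e ->
  exists x, rnorm (z - completion_inj x) <= e.
Proof.
have [u ->] := completion_classP z => e0.
by have [n h] := completion_approx u e0; exists (u n); exact: h.
Qed.

Lemma completion_complete (F : set_system completion) :
  ProperFilter F -> cauchy F -> cvg F.
Proof.
move=> FF /cauchyP cF.
pose r n : R := n.+1%:R^-1.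
have r0 n : 0 < r n by rewrite invr_gt0 ltr0Sn.
have : forall n, exists x, F [set z | rnorm (completion_inj x - z) < 2 * r n].
  move=> n; have rK : 0 < ofR k (r n) by rewrite -(ofR0 R k) ofR_lt.
  have [z Fz] := cF _ rK; have [x zx] := completion_inj_dense z (r0 n).
  exists x; apply: filterS Fz => y; rewrite -ball_normE /= rnormE ofR_lt => zy.
  have -> : completion_inj x - y = - (z - completion_inj x) + (z - y).
    by rewrite opprB addrA subrK.
  rewrite (le_lt_trans (rnormD _ _))// rnormN; lra.
move=> /choice[x Fx].
have rlim (e : R) : 0 < e -> exists n0, forall n, (n0 <= n)%N -> r n < e.
  move=> e0; have : (fun n => r n) @ \oo --> (0 : R) by exact: cvg_harmonic.
  move=> /cvgrPdist_lt /(_ _ e0)[n0 _ h]; exists n0 => n n0n.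
  by have := h n n0n; rewrite /= sub0r normrN gtr0_norm.
have xx m n : N (x m - x n) < 2 * r m + 2 * r n.
  have [z [/= zm zn]] := filter_ex (filterI (Fx m) (Fx n)).
  rewrite -completion_inj_norm.
  have -> : completion_inj (x m - x n) =
      (completion_inj (x m) - z) - (completion_inj (x n) - z).
    rewrite addrC -scaleN1r completion_inj_linear scaleN1r.
    by rewrite opprB addrA subrK addrC.
  by rewrite (le_lt_trans (rnormD _ _))// rnormN ltrD.
have cx : cauchy_pred x.
  apply/asboolP => e e0; have e4 : 0 < e / 4 by rewrite divr_gt0.
  have [n0 h] := rlim _ e4; exists n0 => m n hm hn.
  have := xx m n; have := h _ hm; have := h _ hn; lra.
apply/cvg_ex; exists (completion_class (CauchySeq cx)).
apply/cvgrPdist_lt => e e0.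
have eE : e = ofR k (toR e) by rewrite toRK// ltW.
move: e0; rewrite eE -{1}(ofR0 R k) ofR_lt; move: (toR e) => d d0.
have d4 : 0 < d / 4 by rewrite divr_gt0.
have [n1 h1] := completion_approx (CauchySeq cx) d4.
have [n2 h2] := rlim _ d4.
pose n := maxn n1 n2.
near=> z; rewrite rnormE ofR_lt.
have -> : completion_class (CauchySeq cx) - z =
  (completion_class (CauchySeq cx) - completion_inj (x n)) +
  (completion_inj (x n) - z) by rewrite addrA subrK.
rewrite (le_lt_trans (rnormD _ _))//.
have := h1 n (leq_maxl _ _); have := h2 n (leq_maxr _ _).
have : rnorm (completion_inj (x n) - z) < 2 * r n by near: z; exact: Fx.
move=> /=; lra.
Unshelve. all: by end_near. Qed.

HB.instance Definition _ := Uniform_isComplete.Build completion completion_complete.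

End Completion.

Variant cross_norm := Injective | Projective.

Section CompletedTensor.
Variables (R : realType) (k : scalar_kind).
Local Notation K := (scalars R k).

Definition tensor_norm (alpha : cross_norm) (X Y : normedModType K) :
    seminorm (tensor X Y) :=
  match alpha with
  | Injective => Seminorm (@injective_norm_seminorm R k X Y)
  | Projective => Seminorm (@projective_norm_seminorm R k X Y)
  end.

Definition completed_tensor (alpha : cross_norm) (X Y : normedModType K) :
    completeNormedModType K :=
  completion (tensor_norm alpha X Y).

End CompletedTensor.

(* Main.v *)
From HB Require Import structures.
Require Import Defs.
From mathcomp Require Import all_boot all_order all_algebra all_fingroup.
From mathcomp Require Import complex.
From mathcomp Require Import ring lra zify.
From mathcomp Require Import all_classical all_reals all_analysis.
Set Implicit Arguments.
Unset Strict Implicit.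
Unset Printing Implicit Defensive.
Import Order.TTheory GRing.Theory Num.Theory.
Import numFieldNormedType.Exports.
Local Open Scope classical_set_scope.
Local Open Scope ring_scope.

(** Write [Z] for the completed tensor product.  The proof rests on one fact for
    each of the two cases of the dimensions.

    If a factor, say [X], is finite-dimensional, then [Z] is linearly
    homeomorphic to a finite power of [Y] ([tensor_power_of],
    [power_of_completion]).  The [l^2]-sum of the values of an equivalent norm of
    [Y] on the components is an equivalent norm of [Z] with the same von
    Neumann-Jordan constant, because the parallelogram inequality adds up, and
    conversely norms of [Z] restrict to [Y]; so the two envelopes agree
    ([CNJ_envelope_power]).  For [X] itself, a power of the scalar field, where
    the parallelogram law holds, the envelope is [1].  Superreflexivity also
    passes to and from finite powers ([superreflexive_embedding]): if [W] is
    finitely representable in a space embedded in a power of [Y], then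
    ultrafilter limits of the coordinate seminorms make the completions of [W]
    for these seminorms finitely representable in [Y], hence reflexive, and the
    reflexivity of [W] follows from that of its components
    ([reflexive_of_components]).

    If both factors are infinite-dimensional, then [Z] contains the spaces
    [l^1] of every finite dimension with a common constant
    ([completed_tensor_contains_l1]).  Every infinite-dimensional space has
    arbitrarily long systems of vectors that are weakly square-summable with an
    absolute bound, on each of which some functional of norm at most one has
    modulus at least [1 / 8]
    ([dvoretzky_rogers]).  By Cauchy-Schwarz the products of two such systems
    behave like the unit vectors of [l^oo] in the injective norm; for the
    projective norm the systems are taken in the duals, where they provide
    diagonal bilinear forms of bounded norm.  By James's theorem
    ([james_distortion]) the copies of [l^1] are almost isometric in every
    equivalent norm; so every equivalent norm has constant [2], and [l^1], which
    is not reflexive, is finitely representable in [Z]. *)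

(** * Real and imaginary parts of scalars *)

Section ScalarParts.
Variables (R : realType) (k : scalar_kind).
Local Notation K := (scalars R k).

(** Zero for real scalars, so that the decomposition [toR_imK] into parts and
    [complexify] hold for both fields. *)
Definition iK : K :=
  match k as k0 return scalars R k0 with
  | RealScalars => 0
  | ComplexScalars => (0 +i* 1)%C
  end.

Definition imK : K -> R :=
  match k as k0 return scalars R k0 -> R with
  | RealScalars => fun=> 0
  | ComplexScalars => fun z => complex.Im z
  end.

Lemma toRD (a b : K) : toR (a + b) = toR a + toR b.
Proof. by move: a b; case: k => //= -[? ?] [? ?]. Qed.

Lemma toRN (a : K) : toR (- a) = - toR a.
Proof. by move: a; case: k => //= -[? ?]. Qed.

Lemma toRM_ofR (t : R) (a : K) : toR (ofR k t * a) = t * toR a.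
Proof. by move: a; case: k => //= -[? ?] /=; rewrite mul0r subr0. Qed.

Lemma imKD (a b : K) : imK (a + b) = imK a + imK b.
Proof. by move: a b; rewrite /imK; case: k => //= [_ _|[? ?] [? ?]] //=; rewrite addr0. Qed.

Lemma imKM_ofR (t : R) (a : K) : imK (ofR k t * a) = t * imK a.
Proof.
by move: a; rewrite /imK; case: k => //= [_|[? ?]] //=;
  rewrite ?mulr0// mul0r addr0.
Qed.

Lemma imKN (a : K) : imK (- a) = - imK a.
Proof. by move: a; rewrite /imK; case: k => //= [_|[? ?]] //=; rewrite oppr0. Qed.

Lemma toR_imK (z : K) : z = ofR k (toR z) + iK * ofR k (imK z).
Proof.
move: z; rewrite /iK /imK; case: k => [z|[a b]] /=; first by rewrite mul0r addr0.
by apply/eqP; rewrite eq_complex /=; apply/andP; split; apply/eqP; lra.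
Qed.

Lemma toR_iM (z : K) : toR (- (iK * z)) = imK z.
Proof.
move: z; rewrite /iK /imK; case: k => [z|[a b]] /=; first by rewrite mul0r oppr0.
by lra.
Qed.

Lemma rnorm_sqr (z : K) : rnorm (z : K^o) ^+ 2 = toR z ^+ 2 + imK z ^+ 2.
Proof.
move: z; rewrite /rnorm /imK; case: k => [z|[a b]] /=.
  by rewrite expr0n addr0 real_normK// num_real.
by rewrite sqr_sqrtr// addr_ge0// sqr_ge0.
Qed.

Lemma toR_le_rnorm (z : K) : toR z <= rnorm (z : K^o).
Proof.
apply: (le_trans (ler_norm _)).
rewrite -(@ler_pXn2r _ 2)// ?nnegrE ?rnorm_ge0// rnorm_sqr real_normK ?num_real//.
by rewrite lerDl sqr_ge0.
Qed.

Lemma abs_toR_le (z : K) : `|toR z| <= rnorm (z : K^o).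
Proof.
by rewrite ler_norml toR_le_rnorm andbT lerNl -toRN (le_trans (toR_le_rnorm _))// rnormN.
Qed.

Lemma abs_imK_le (z : K) : `|imK z| <= rnorm (z : K^o).
Proof.
rewrite -(@ler_pXn2r _ 2)// ?nnegrE ?rnorm_ge0// rnorm_sqr real_normK ?num_real//.
by rewrite lerDr sqr_ge0.
Qed.

Lemma rnorm_le_parts (z : K) : rnorm (z : K^o) <= `|toR z| + `|imK z|.
Proof.
rewrite -(@ler_pXn2r _ 2)// ?nnegrE ?rnorm_ge0 ?addr_ge0// rnorm_sqr sqrrD.
rewrite !real_normK ?num_real//.
by have := mulr_ge0 (normr_ge0 (toR z)) (normr_ge0 (imK z)); lra.
Qed.

Lemma rnorm_inv (z : K) : rnorm (z^-1 : K^o) = (rnorm (z : K^o))^-1.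
Proof.
have [->|z0] := eqVneq z 0; first by rewrite invr0 rnorm0 invr0.
have : rnorm (z : K^o) * rnorm (z^-1 : K^o) = 1 by rewrite -rnormM mulfV// rnorm1.
have z1 : rnorm (z : K^o) != 0.
  by apply: contra z0 => /eqP/rnorm0_eq0 ->.
by move=> h; apply: (mulfI z1); rewrite h mulfV.
Qed.

Lemma phase (z : K) : exists l : K,
  rnorm (l : K^o) = 1 /\ l * z = ofR k (rnorm (z : K^o)).
Proof.
have [->|z0] := eqVneq z 0.
  by exists 1; rewrite rnorm1 mulr0 rnorm0 ofR0.
exists (ofR k (rnorm (z : K^o)) / z).
rewrite rnormM rnorm_inv rnorm_ofR ?rnorm_ge0// divfK// mulfV//.
by apply: contra z0 => /eqP/rnorm0_eq0 ->.
Qed.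

Lemma toR_ofR (t : R) : toR (ofR k t) = t.
Proof. exact: ofRK. Qed.

Lemma ofRN (t : R) : ofR k (- t) = - ofR k t.
Proof. by case: k => //=; rewrite rmorphN. Qed.

Lemma ofR1 : ofR k (1 : R) = 1.
Proof. by case: k. Qed.

Lemma toR_eq (a b : K) : (forall l : K, toR (l * a) = toR (l * b)) -> a = b.
Proof.
move=> h; rewrite (toR_imK a) (toR_imK b).
have := h 1; rewrite !mul1r => ->.
by rewrite -!toR_iM -!mulNr h.
Qed.

Lemma ofR_sum (I : Type) (r : seq I) (P : pred I) (F : I -> R) :
  ofR k (\sum_(i <- r | P i) F i) = \sum_(i <- r | P i) ofR k (F i).
Proof. by apply: big_morph; [exact: ofRD|exact: ofR0]. Qed.

Lemma ler_rnorm_sum (V : normedModType K) (I : Type) (r : seq I) (P : pred I) (F : I -> V) :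
  rnorm (\sum_(i <- r | P i) F i) <= \sum_(i <- r | P i) rnorm (F i).
Proof.
elim/big_ind2 : _ => //; first by rewrite rnorm0.
by move=> a b c d h1 h2; exact: (le_trans (rnormD _ _) (lerD h1 h2)).
Qed.

Lemma rnorm_gt0 (V : normedModType K) (x : V) : (0 < rnorm x) = (x != 0).
Proof.
rewrite lt_neqAle rnorm_ge0 andbT eq_sym; congr (~~ _).
by apply/eqP/eqP => [/rnorm0_eq0//|->]; rewrite rnorm0.
Qed.

Lemma rnorm_distC (V : normedModType K) (x y : V) : rnorm (x - y) = rnorm (y - x).
Proof. by rewrite -rnormN opprB. Qed.

Lemma ler_rnorm_dist (V : normedModType K) (x y : V) : `|rnorm x - rnorm y| <= rnorm (x - y).
Proof.
have h1 := rnormD (x - y) y; have h2 := rnormD (y - x) x.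
rewrite !subrK in h1 h2; rewrite (rnorm_distC y x) in h2.
by rewrite ler_norml; apply/andP; split; lra.
Qed.

End ScalarParts.

(** * The Hahn-Banach theorem *)

Section HahnBanach.
Variables (R : realType) (k : scalar_kind) (E : lmodType (scalars R k)).
Local Notation K := (scalars R k).
Local Notation "t *o x" := (ofR k t *: x) (at level 40).

Definition sublinear (q : E -> R) : Prop :=
  (forall x y, q (x + y) <= q x + q y) /\
  (forall (t : R) x, 0 <= t -> q (t *o x) = t * q x).

Lemma sublinear0 q : sublinear q -> q 0 = 0.
Proof. by move=> [_ h]; have := h 0 0 (lexx _); rewrite mul0r scaler0. Qed.

Lemma sublinear_ge q x : sublinear q -> - q (- x) <= q x.
Proof.
move=> hq; have [hD _] := hq; have := hD x (- x); rewrite subrr (sublinear0 hq); lra.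
Qed.

Lemma sublinear_of_le (q : E -> R) : q 0 = 0 ->
  (forall x y, q (x + y) <= q x + q y) ->
  (forall (t : R) x, 0 < t -> q (t *o x) <= t * q x) -> sublinear q.
Proof.
move=> q0 qD qZ; split=> // t x; rewrite le_eqVlt => /predU1P[<-|t0].
  by rewrite ofR0 scale0r mul0r.
apply/eqP; rewrite eq_le qZ//=.
have ti : 0 < t^-1 by rewrite invr_gt0.
have := qZ _ (t *o x) ti.
rewrite scalerA -ofRM mulVf ?gt_eqF// ofR1 scale1r => h.
rewrite -(@ler_pM2l _ t^-1)// mulrA mulVf ?gt_eqF// mul1r//.
Qed.

(** The lowering of [p] in the direction [x] from the classical proof: the tilt
    lies below [p] and takes at [- x] a value at most [- p x], which is the value
    there of any linear minorant tight at [x]. *)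
Definition tilt_set (p : E -> R) x v :=
  [set r | exists2 t : R, 0 <= t & r = p (v + t *o x) - t * p x].

Lemma tilt_set_lb (p : E -> R) x v : sublinear p -> lbound (tilt_set p x v) (- p (- v)).
Proof.
move=> [pD pZ] _ [t t0 ->]; have := pD (v + t *o x) (- v).
by rewrite addrAC subrr add0r pZ//; lra.
Qed.

Lemma tilt_has_inf (p : E -> R) x v : sublinear p -> has_inf (tilt_set p x v).
Proof.
by move=> hp; split; [exists (p (v + 0 *o x) - 0 * p x); exists 0|
  exists (- p (- v)); exact: tilt_set_lb].
Qed.

Definition tilt (p : E -> R) x v := inf (tilt_set p x v).

Lemma tilt_le (p : E -> R) x v t : sublinear p -> 0 <= t ->
  tilt p x v <= p (v + t *o x) - t * p x.
Proof. by move=> hp t0; apply: (ge_inf (tilt_has_inf x v hp).2); exists t. Qed.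

Lemma tilt_sublinear (p : E -> R) x : sublinear p -> sublinear (tilt p x).
Proof.
move=> hp; have [pD pZ] := hp; have p0 := sublinear0 hp; apply: sublinear_of_le.
- apply/eqP; rewrite eq_le; apply/andP; split.
    by have := tilt_le x 0 hp (lexx 0); rewrite ofR0 scale0r addr0 p0 mul0r subr0.
  have := lb_le_inf (tilt_has_inf x 0 hp).1 (tilt_set_lb (p := p) (x := x) (v := 0) hp).
  by rewrite oppr0 p0 oppr0.
- move=> v w; apply/ler_addgt0Pr => e e0; have e2 : 0 < e / 2 by rewrite divr_gt0.
  have [_ [t t0 ->] ht] := inf_adherent e2 (tilt_has_inf x v hp).
  have [_ [s s0 ->] hs] := inf_adherent e2 (tilt_has_inf x w hp).
  have := tilt_le x (v + w) hp (addr_ge0 t0 s0).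
  have := pD (v + t *o x) (w + s *o x).
  rewrite ofRD scalerDl addrACA; move: ht hs; rewrite -/(tilt p x v) -/(tilt p x w).
  by lra.
- move=> s v s0; rewrite -ler_pdivrMl//; apply: lb_le_inf; first exact: (tilt_has_inf x v hp).1.
  move=> _ [t t0 ->]; rewrite ler_pdivrMl//.
  have := tilt_le x (s *o v) hp (mulr_ge0 (ltW s0) t0).
  by rewrite ofRM -scalerA -scalerDr pZ ?(ltW s0)// mulrBr mulrA.
Qed.

Lemma tilt_le_self (p : E -> R) x v : sublinear p -> tilt p x v <= p v.
Proof.
by move=> hp; have := tilt_le x v hp (lexx 0); rewrite ofR0 scale0r addr0 mul0r subr0.
Qed.

Lemma tilt_opp (p : E -> R) x : sublinear p -> tilt p x (- x) <= - p x.
Proof.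
move=> hp; have := tilt_le x (- x) hp ler01.
by rewrite ofR1 scale1r addNr (sublinear0 hp) mul1r sub0r.
Qed.

(** Zorn's lemma: the pointwise infimum of a chain is sublinear, and is finite
    because [- q (- v)] bounds every member of the chain from below. *)
Lemma minimal_sublinear (q : E -> R) : sublinear q -> exists p, [/\ sublinear p,
  forall x, p x <= q x & forall p', sublinear p' -> (forall x, p' x <= p x) ->
  forall x, p x <= p' x].
Proof.
move=> hq.
pose T := {p : E -> R | sublinear p /\ forall x, p x <= q x}.
pose r (p p' : T) := `[< forall x, sval p' x <= sval p x >].
have [||//|[p [hp pq]] hm] := @ZL_preorder T (exist _ q (conj hq (fun x => lexx _))) r.
- by move=> t; apply/asboolP.
- move=> a b c /asboolP ab /asboolP bc; apply/asboolP => x.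
  exact: le_trans (bc x) (ab x).
- move=> A Atot; have [[p0 Ap0]|A0] := pselect (A !=set0); last first.
    exists (exist _ q (conj hq (fun x => lexx _))) => s As.
    by exfalso; apply: A0; exists s.
  pose S v := [set r0 | exists2 p : T, A p & r0 = sval p v].
  have Slb v : lbound (S v) (- q (- v)).
    move=> _ [[p [hp pq]] _ ->] /=; apply: le_trans (sublinear_ge v hp).
    by rewrite lerN2.
  have Sinf v : has_inf (S v).
    by split; [exists (sval p0 v); exists p0|exists (- q (- v))].
  pose m v := inf (S v).
  have mle (p : T) v : A p -> m v <= sval p v.
    by move=> Ap; apply: (ge_inf (Sinf v).2); exists p.
  have hm : sublinear m.
    apply: sublinear_of_le.
    - apply/eqP; rewrite eq_le; apply/andP; split.
        by rewrite (le_trans (mle _ 0 Ap0))// (sublinear0 (svalP p0).1).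
      by apply: (lb_le_inf (Sinf 0).1) => _ [p _ ->]; rewrite (sublinear0 (svalP p).1).
    - move=> v w; apply/ler_addgt0Pr => e e0; have e2 : 0 < e / 2 by rewrite divr_gt0.
      have [_ [a Aa ->] ha] := inf_adherent e2 (Sinf v).
      have [_ [b Ab ->] hb] := inf_adherent e2 (Sinf w).
      rewrite -/(m v) -/(m w) in ha hb.
      have [/asboolP ab|/asboolP ba] := Atot a b Aa Ab.
      + have := mle b (v + w) Ab; have := (svalP b).1.1 v w; have := ab v; lra.
      + have := mle a (v + w) Aa; have := (svalP a).1.1 v w; have := ba w; lra.
    - move=> s v s0; rewrite -ler_pdivrMl//; apply: (lb_le_inf (Sinf v).1).
      move=> _ [p Ap ->]; rewrite ler_pdivrMl//.
      by rewrite -(svalP p).1.2 ?(ltW s0)// mle.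
  have mq v : m v <= q v by rewrite (le_trans (mle _ v Ap0))// (svalP p0).2.
  exists (exist _ m (conj hm mq)) => s As; apply/asboolP => x /=; exact: mle.
exists p; split => // p' hp' p'p.
have p'q x : p' x <= q x by exact: le_trans (p'p x) (pq x).
have /asboolP := hm (exist _ p' (conj hp' p'q)) (introT (asboolP _) p'p).
by [].
Qed.

(** A minimal sublinear functional is odd, since tilting it in any direction
    cannot lower it, and an odd sublinear functional is linear. *)
Lemma hahn_banach_real (q : E -> R) (x0 : E) : sublinear q ->
  exists g : E -> R, [/\ forall x y, g (x + y) = g x + g y,
    forall (t : R) x, g (t *o x) = t * g x,
    forall x, g x <= q x & g x0 = q x0].
Proof.
move=> hq; have [p [hp pq pmin]] := minimal_sublinear (tilt_sublinear x0 hq).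
have pN x : p (- x) = - p x.
  apply/eqP; rewrite eq_le; apply/andP; split; last first.
    by have := sublinear_ge x hp; lra.
  apply: le_trans (tilt_opp x hp).
  apply: pmin; first exact: tilt_sublinear.
  by move=> v; exact: tilt_le_self.
have [pD pZ] := hp.
have pA x y : p (x + y) = p x + p y.
  apply/eqP; rewrite eq_le pD /=.
  by have := pD (- x) (- y); rewrite -opprD !pN; lra.
exists p; split => //.
- move=> t x; have [t0|t0] := leP 0 t; first exact: pZ.
  have nt : 0 <= - t by lra.
  by have := pZ _ x nt; rewrite ofRN scaleNr pN mulNr => /oppr_inj.
- by move=> x; exact: le_trans (pq x) (tilt_le_self _ _ hq).
- apply/eqP; rewrite eq_le (le_trans (pq x0) (tilt_le_self _ _ hq)) /=.
  by have := le_trans (pq (- x0)) (tilt_opp x0 hq); rewrite pN lerN2.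
Qed.

Definition linear_form (f : E -> K) : Prop :=
  forall (l : K) x y, f (l *: x + y) = l * f x + f y.

Lemma linear_formD f x y : linear_form f -> f (x + y) = f x + f y.
Proof. by move=> hf; have := hf 1 x y; rewrite scale1r mul1r. Qed.

Lemma linear_form0 f : linear_form f -> f 0 = 0.
Proof.
by move=> hf; have := hf (-1) 0 0; rewrite scaler0 addr0 mulN1r addNr.
Qed.

Lemma linear_formZ f l x : linear_form f -> f (l *: x) = l * f x.
Proof. by move=> hf; have := hf l x 0; rewrite (linear_form0 hf) !addr0. Qed.

Lemma linear_formN f x : linear_form f -> f (- x) = - f x.
Proof. by move=> hf; rewrite -scaleN1r linear_formZ// mulN1r. Qed.

Lemma linear_formB f x y : linear_form f -> f (x - y) = f x - f y.
Proof. by move=> hf; rewrite linear_formD// linear_formN. Qed.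

Lemma linear_form_sum f (I : Type) (r : seq I) (P : pred I) (F : I -> E) :
  linear_form f -> f (\sum_(i <- r | P i) F i) = \sum_(i <- r | P i) f (F i).
Proof.
by move=> hf; apply: (big_morph f) => [x y|]; [exact: linear_formD|exact: linear_form0].
Qed.

(** The Bohnenblust-Sobczyk formula [g x - i g (i x)]. *)
Lemma complexify (g : E -> R) : (forall x y, g (x + y) = g x + g y) ->
  (forall (t : R) x, g (t *o x) = t * g x) ->
  exists2 f : E -> K, linear_form f & forall x, toR (f x) = g x.
Proof.
move=> gD gZ.
have gN x : g (- x) = - g x.
  by have := gZ (-1) x; rewrite ofRN ofR1 scaleN1r mulN1r.
pose f x : K := ofR k (g x) - iK R k * ofR k (g (iK R k *: x)).
have fD x y : f (x + y) = f x + f y.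
  by rewrite /f scalerDr !gD !ofRD mulrDr opprD addrACA.
have fZ t x : f (t *o x) = ofR k t * f x.
  have iZ : iK R k *: (t *o x) = t *o (iK R k *: x) by rewrite !scalerA mulrC.
  by rewrite /f iZ !gZ !ofRM mulrBr [in RHS]mulrCA.
have fI x : f (iK R k *: x) = iK R k * f x.
  rewrite /f scalerA; rewrite /iK; move: (g) gN (gD) (gZ).
  case: k E x => E' x h hN hD hZ /=.
    by rewrite !mul0r !scale0r; have := hZ 0 0; rewrite /= scale0r !mul0r => ->; rewrite subr0.
  have -> : (0 +i* 1)%C * (0 +i* 1)%C = -1 :> R[i]%C.
    by apply/eqP; rewrite eq_complex /=; apply/andP; split; apply/eqP; lra.
  rewrite scaleN1r hN; apply/eqP; rewrite eq_complex /=.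
  by apply/andP; split; apply/eqP; lra.
exists f.
  move=> l x y; rewrite fD; congr (_ + _).
  rewrite {1}(toR_imK l) scalerDl fD fZ -scalerA fI fZ.
  by rewrite mulrA -mulrDl -toR_imK.
move=> x; rewrite /f toRD toR_ofR toRN.
suff -> : toR (iK R k * ofR k (g (iK R k *: x))) = 0 by rewrite subr0.
rewrite /iK; move: (g); case: k E x => E' x h /=; first by rewrite mul0r.
by lra.
Qed.

(** Multiplying the argument by a phase makes the value of [f] real. *)
Lemma linear_form_le_seminorm (f : E -> K) (p : E -> R) : linear_form f ->
  is_seminorm p -> (forall x, toR (f x) <= p x) -> forall x, rnorm (f x : K^o) <= p x.
Proof.
move=> fl [_ pZ] fp x; have [l [l1 lz]] := phase (f x).
by have := fp (l *: x); rewrite linear_formZ// lz toR_ofR pZ l1 mul1r.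
Qed.

Lemma seminorm_sublinear (p : E -> R) : is_seminorm p -> sublinear p.
Proof. by move=> [pD pZ]; split => // t x t0; rewrite pZ rnorm_ofR. Qed.

(** The value at [x0] is real because its modulus is at most [p x0], which is
    already its real part. *)
Theorem hahn_banach_seminorm (p : E -> R) (x0 : E) : is_seminorm p ->
  exists f : E -> K, [/\ linear_form f, forall x, rnorm (f x : K^o) <= p x &
    f x0 = ofR k (p x0)].
Proof.
move=> hp; have [g [gD gZ gp gx]] := hahn_banach_real x0 (seminorm_sublinear hp).
have [f fl fg] := complexify gD gZ.
have fp := linear_form_le_seminorm fl hp (fun x => eq_ind_r (fun z => z <= p x) (gp x) (fg x)).
exists f; split => //.
have tf : toR (f x0) = p x0 by rewrite fg.
have im0 : imK (f x0) = 0.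
  apply/eqP; rewrite -sqrf_eq0 eq_le sqr_ge0 andbT.
  have := rnorm_sqr (f x0); rewrite tf => h.
  have : rnorm (f x0 : K^o) ^+ 2 <= p x0 ^+ 2.
    by rewrite ler_pXn2r// ?nnegrE ?rnorm_ge0// (le_trans _ (fp x0))// rnorm_ge0.
  by rewrite h gerDl.
by rewrite (toR_imK (f x0)) tf im0 ofR0 mulr0 addr0.
Qed.

End HahnBanach.

(** * Limits along ultrafilters *)

Section Ultralimits.
Variables (R : realType) (k : scalar_kind) (T : Type) (F : set_system T).
Hypothesis FU : UltraFilter F.
Local Notation K := (scalars R k).

(** The limit is the supremum of the numbers that are eventually lower bounds of [h]. *)
Lemma ultralimit_real (h : T -> R) (M : R) : F [set s | `|h s| <= M] ->
  exists l : R, h @ F --> l.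
Proof.
move=> hM; pose L := [set x : R | F [set s | x <= h s]].
have supL : has_sup L.
  split.
    by exists (- M); apply: filterS hM => s /=; rewrite ler_norml => /andP[].
  exists M => x Lx; have [s [/= xs]] := filter_ex (filterI Lx hM).
  by rewrite ler_norml => /andP[_]; exact: le_trans.
exists (sup L); apply/cvgrPdist_lt => e e0.
have [x Lx lx] := sup_adherent e0 supL.
have e2 : 0 < e / 2 by rewrite divr_gt0.
have [hl|hl] := in_ultra_setVsetC [set s | sup L + e / 2 <= h s] FU.
  by have := ub_le_sup supL.2 (hl : L _); lra.
apply: filterS (filterI Lx hl) => s /= [xs /negP]; rewrite -ltNge => hs.
by rewrite ltr_norml; apply/andP; split; lra.
Qed.

Lemma ultralimit_scalar (a : T -> K) (M : R) :
  F [set s | rnorm (a s : K^o) <= M] ->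
  exists b : K, (fun s => rnorm (a s - b : K^o)) @ F --> (0 : R).
Proof.
move=> aM.
have [x hx] : exists l : R, (fun s => toR (a s)) @ F --> l.
  by apply: (@ultralimit_real _ M); apply: filterS aM => s; apply: le_trans; exact: abs_toR_le.
have [y hy] : exists l : R, (fun s => imK (a s)) @ F --> l.
  by apply: (@ultralimit_real _ M); apply: filterS aM => s; apply: le_trans; exact: abs_imK_le.
exists (ofR k x + iK R k * ofR k y).
have h0 : (fun s => `|toR (a s) - x| + `|imK (a s) - y|) @ F --> (0 : R).
  have hx0 : (fun s => `|toR (a s) - x|) @ F --> (0 : R).
    by apply/norm_cvg0P; rewrite subr_cvg0.
  have hy0 : (fun s => `|imK (a s) - y|) @ F --> (0 : R).
    by apply/norm_cvg0P; rewrite subr_cvg0.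
  by rewrite -(addr0 (0 : R)); exact: cvgD.
apply: (squeeze_cvgr (f := fun=> 0) _ _ h0); last exact: cvg_cst.
apply: nearW => s; rewrite rnorm_ge0 /=.
rewrite [in leLHS](toR_imK (a s)) opprD addrACA -mulrBr -!ofRN -!ofRD.
apply: le_trans (rnormD _ _) _; apply: lerD.
  apply: (le_trans (rnorm_le_parts _)); rewrite toR_ofR.
  have := imKM_ofR (toR (a s) - x) (1 : K); rewrite mulr1 => ->.
  suff -> : imK (1 : K) = 0 by rewrite mulr0 normr0 addr0.
  by rewrite /imK; case: k.
rewrite rnormM -[leRHS]mul1r.
apply: (le_trans _ (_ : 1 * rnorm (ofR k (imK (a s) - y) : K^o) <= _)).
  apply: ler_wpM2r; first exact: rnorm_ge0.
  rewrite -(@ler_pXn2r _ 2)// ?nnegrE ?rnorm_ge0// rnorm_sqr /iK /imK; case: k => /=; lra.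
rewrite !mul1r; apply: (le_trans (rnorm_le_parts _)); rewrite toR_ofR.
have := imKM_ofR (imK (a s) - y) (1 : K); rewrite mulr1 => ->.
suff -> : imK (1 : K) = 0 by rewrite mulr0 normr0 addr0.
by rewrite /imK; case: k.
Qed.

End Ultralimits.

Lemma ultra_oo : exists F : set_system nat, UltraFilter F /\ \oo `<=` F.
Proof. by apply: ultraFilterLemma; exact: eventually_filter. Qed.

(** * Finite-dimensional subspaces *)

Section FiniteDimension.
Variables (R : realType) (k : scalar_kind).
Local Notation K := (scalars R k).

Lemma cvg_sum_seq (T I : Type) (F : set_system T) (FF : ProperFilter F) (r : seq I)
    (f : T -> I -> R) (l : I -> R) : (forall i, (fun s => f s i) @ F --> l i) ->
  (fun s => \sum_(i <- r) f s i) @ F --> \sum_(i <- r) l i.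
Proof.
move=> h; elim: r => [|i r ih].
  rewrite big_nil (_ : (fun _ => _) = cst 0); first exact: cvg_cst.
  by apply/funext => s; rewrite big_nil.
rewrite big_cons (_ : (fun _ => _) = (fun s => f s i + \sum_(i <- r) f s i)).
  exact: cvgD.
by apply/funext => s; rewrite big_cons.
Qed.

Lemma lim_comb (T : Type) (F : set_system T) (FF : ProperFilter F) n (a : T -> 'I_n -> K)
    (b : 'I_n -> K) (w : 'I_n -> R) :
  (forall i, (fun s => rnorm (a s i - b i : K^o)) @ F --> (0 : R)) ->
  (fun s => \sum_i rnorm (a s i - b i : K^o) * w i) @ F --> (0 : R).
Proof.
move=> h; rewrite [X in _ --> X](_ : 0 = \sum_(i < n) 0 * w i); last first.
  by rewrite big1// => i _; rewrite mul0r.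
by apply: cvg_sum_seq => i; apply: cvgMr_tmp; exact: h.
Qed.

Lemma rnorm_comb_le (V : normedModType K) n (e : 'I_n -> V) (c : 'I_n -> K) :
  rnorm (\sum_i c i *: e i) <= \sum_i rnorm (c i : K^o) * rnorm (e i).
Proof.
by apply: (le_trans (ler_rnorm_sum _ _ _)); apply: ler_sum => i _; rewrite rnormZ.
Qed.

(** The coefficient vectors of [l^1]-norm one form a compact set, on which
    the norm of the combination does not vanish. *)
Lemma lin_indep_lower (V : normedModType K) n (e : 'I_n -> V) : lin_indep e ->
  exists2 c : R, 0 < c & forall a : 'I_n -> K,
    c * (\sum_i rnorm (a i : K^o)) <= rnorm (\sum_i a i *: e i).
Proof.
move=> he; apply: contrapT => hn.
have {}hn (m : nat) : exists a : 'I_n -> K,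
    \sum_i rnorm (a i : K^o) = 1 /\ rnorm (\sum_i a i *: e i) < m.+1%:R^-1.
  have m0 : 0 < (m.+1%:R^-1 : R) by rewrite invr_gt0.
  have [a ha] : exists a : 'I_n -> K,
      rnorm (\sum_i a i *: e i) < m.+1%:R^-1 * (\sum_i rnorm (a i : K^o)).
    apply: contrapT => h; apply: hn; exists (m.+1%:R^-1) => // a.
    by rewrite leNgt; apply/negP => h'; apply: h; exists a.
  set S := \sum_i rnorm _ in ha.
  have S0 : 0 < S.
    rewrite -(pmulr_rgt0 _ m0); exact: le_lt_trans (rnorm_ge0 _) ha.
  have rS : rnorm (ofR k S^-1 : K^o) = S^-1 by rewrite rnorm_ofR// invr_ge0 ltW.
  exists (fun i => ofR k S^-1 * a i); split.
    under eq_bigr do rewrite rnormM rS.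
    by rewrite -mulr_sumr mulVf// gt_eqF.
  under eq_bigr do rewrite -scalerA.
  by rewrite -scaler_sumr rnormZ rS ltr_pdivrMl// mulrC.
have [a ha] := choice hn; have [F [FU Foo]] := ultra_oo.
have /choice[b hb] : forall i, exists bi : K,
    (fun s => rnorm (a s i - bi : K^o)) @ F --> (0 : R).
  move=> i; apply: (@ultralimit_scalar R k _ F FU (fun s => a s i) 1).
  apply: filterS filterT => s _ /=; rewrite -(ha s).1 (bigD1 i)//= lerDl.
  by apply: sumr_ge0 => j _; exact: rnorm_ge0.
have PF : ProperFilter F by exact: ultra_proper.
have b0 : \sum_i b i *: e i = 0.
  apply: rnorm0_eq0; apply/eqP; rewrite eq_le rnorm_ge0 andbT.
  suff h (d : R) : 0 < d -> rnorm (\sum_i b i *: e i) <= d.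
    by apply/ler_addgt0Pr => d d0; rewrite add0r h.
  move=> d0.
  have d2 : 0 < d / 2 by rewrite divr_gt0.
  pose D m : R := \sum_i rnorm (a m i - b i : K^o) * rnorm (e i).
  have h1 : D @ F --> (0 : R) := lim_comb PF (fun i => rnorm (e i)) hb.
  have {}h1 : F [set m | `|0 - D m| < d / 2] by apply: cvgr_dist_lt h1 _ d2.
  have h2 : F [set m | m.+1%:R^-1 < d / 2].
    apply: Foo; have := @cvg_harmonic R; move=> /cvgrPdist_lt /(_ _ d2).
    by apply: filterS => m /=; rewrite sub0r normrN ger0_norm// invr_ge0.
  have [m [/= hm1 hm2]] := filter_ex (filterI h1 h2).
  have -> : \sum_i b i *: e i = \sum_i a m i *: e i - \sum_i (a m i - b i) *: e i.
    by rewrite -sumrB; apply: eq_bigr => i _; rewrite -scalerBl opprB addrC subrK.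
  apply: (le_trans (rnormD _ _)); rewrite rnormN.
  have h3 : rnorm (\sum_i (a m i - b i) *: e i) <= D m := rnorm_comb_le _ _.
  rewrite sub0r normrN in hm1.
  have h4 := lt_trans (ha m).2 hm2.
  have := ler_norm (D m); lra.
have {}b0 := he _ b0.
have h1 : (0 : R) < 1 / 2 by rewrite divr_gt0.
have h2 : F [set m | `|0 - \sum_i rnorm (a m i - b i : K^o) * 1| < 1 / 2].
  by apply: cvgr_dist_lt (lim_comb PF (fun=> 1) hb) _ h1.
have [m /=] := filter_ex h2.
rewrite sub0r normrN (eq_bigr (fun i => rnorm (a m i : K^o))).
  by rewrite (ha m).1 normr1; lra.
by move=> i _; rewrite b0 subr0 mulr1.
Qed.

Lemma lin_indep_proper n (V : lmodType K) (e : 'I_n -> V) m (le : (m <= n)%N) :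
  lin_indep e -> lin_indep (fun i : 'I_m => e (widen_ord le i)).
Proof.
move=> he c hc i.
pose c' (j : 'I_n) : K := if insub (j : nat) is Some j' then c j' else 0.
have c'w (j : 'I_m) : c' (widen_ord le j) = c j.
  by rewrite /c' /= insubT//= => h; congr c; exact: val_inj.
suff h : \sum_j c' j *: e j = 0 by rewrite -c'w (he _ h).
rewrite -[RHS]hc (bigID (fun j : 'I_n => (j < m)%N)) /= [X in _ + X]big1 ?addr0; last first.
  by move=> j jm; rewrite /c' insubF ?scale0r//; exact: negbTE.
rewrite (big_ord_narrow le) /=; apply: eq_bigr => j _; by rewrite c'w.
Qed.

Lemma dimension_ooP (V : lmodType K) : dimension V = +oo%E ->
  forall n, exists e : 'I_n -> V, lin_indep e.
Proof.
move=> hV n; have : (n%:R%:E < dimension V)%E by rewrite hV ltry.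
move=> /ereal_sup_gt[_ [m [e [he ->]]]]; rewrite lte_fin ltr_nat => nm.
by exists (fun i => e (widen_ord (ltnW nm) i)); exact: lin_indep_proper.
Qed.

Definition snoc_family (V : Type) n (e : 'I_n -> V) (v : V) (i : 'I_n.+1) : V :=
  if unlift ord_max i is Some j then e j else v.

Lemma sum_snoc_family (V : lmodType K) n (e : 'I_n -> V) v (c : 'I_n.+1 -> K) :
  \sum_i c i *: snoc_family e v i =
  \sum_i c (lift ord_max i) *: e i + c ord_max *: v.
Proof.
have wl (i : 'I_n) : widen_ord (leqnSn n) i = lift ord_max i.
  by apply: val_inj; rewrite /= /bump leqNgt ltn_ord.
rewrite big_ord_recr /= /snoc_family unlift_none; congr (_ + _).
by apply: eq_bigr => i _; rewrite wl liftK.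
Qed.

Lemma lin_indep_snoc (V : lmodType K) n (e : 'I_n -> V) v : lin_indep e ->
  ~ lin_span e v -> lin_indep (snoc_family e v).
Proof.
move=> he hv c; rewrite sum_snoc_family => h.
have cn : c ord_max = 0.
  apply/eqP; apply: contrapT => /negP cn; apply: hv.
  exists (fun i => - (c ord_max)^-1 * c (lift ord_max i)).
  have -> : v = - (c ord_max)^-1 *: - (c ord_max *: v).
    by rewrite scalerN scaleNr opprK scalerA mulVf// scale1r.
  have -> : - (c ord_max *: v) = \sum_(i < n) c (lift ord_max i) *: e i.
    by apply/eqP; rewrite eq_sym -addr_eq0; apply/eqP; exact: h.
  by rewrite scaler_sumr; apply: eq_bigr => i _; rewrite scalerA.
have {}h : \sum_(i < n) c (lift ord_max i) *: e i = 0.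
  by rewrite -[RHS]h cn scale0r addr0.
move=> i; case: (unliftP ord_max i) => [j|] ->//; exact: (he _ h).
Qed.

Lemma lin_span_linear (V : lmodType K) n (e : 'I_n -> V) (l : K) x y :
  lin_span e x -> lin_span e y -> lin_span e (l *: x + y).
Proof.
move=> [a ->] [b ->]; exists (fun i => l * a i + b i).
rewrite scaler_sumr -big_split; apply: eq_bigr => i _.
by rewrite scalerDl scalerA.
Qed.

Lemma lin_span_basis (V : lmodType K) n (e : 'I_n -> V) :
  exists m (w : 'I_m -> V), lin_indep w /\ forall x, lin_span e x -> lin_span w x.
Proof.
elim: n e => [|n ih] e; first by exists 0%N, e; split => // c _ [].
have [m [w [hw ew]]] := ih (fun i => e (lift ord_max i)).
have eE (c : 'I_n.+1 -> K) : \sum_i c i *: e i =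
    \sum_i c (lift ord_max i) *: e (lift ord_max i) + c ord_max *: e ord_max.
  rewrite -sum_snoc_family; apply: eq_bigr => i _; congr (_ *: _).
  by rewrite /snoc_family; case: unliftP => [j|] ->.
have [hl|hl] := pselect (lin_span w (e ord_max)).
  exists m, w; split => // x [c ->]; rewrite eE addrC.
  by apply: lin_span_linear => //; apply: ew; exists (fun i => c (lift ord_max i)).
exists m.+1, (snoc_family w (e ord_max)); split; first exact: lin_indep_snoc.
move=> x [c ->]; rewrite eE.
have [a ->] : lin_span w (\sum_i c (lift ord_max i) *: e (lift ord_max i)).
  by apply: ew; exists (fun i => c (lift ord_max i)).
exists (snoc_family a (c ord_max)); rewrite sum_snoc_family.
congr (_ + _ *: _); last by rewrite /snoc_family unlift_none.
by apply: eq_bigr => i _; rewrite /snoc_family liftK.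
Qed.

(** An independent family of maximal length spans. *)
Lemma dimension_finP (V : lmodType K) : (dimension V < +oo)%E ->
  exists n (e : 'I_n -> V), lin_indep e /\ forall v, lin_span e v.
Proof.
move=> hV.
pose P m := `[< exists e : 'I_m -> V, lin_indep e >].
have P0 : exists m, P m.
  by exists 0%N; apply/asboolP; exists (fun=> 0) => c _ [].
have dim0 : (0 <= dimension V)%E.
  apply: ereal_sup_ubound; exists 0%N, (fun=> 0); split => // c _ [] //.
have [N hN] : exists N : nat, (dimension V <= N%:R%:E)%E.
  have : dimension V \is a fin_num by rewrite ge0_fin_numE.
  move=> /fineK <-; exists (Num.bound (fine (dimension V))).
  by rewrite lee_fin ltW// archi_boundP// fine_ge0.
have Pb m : P m -> (m <= N)%N.
  move=> /asboolP[e he]; rewrite -(ler_nat R) -lee_fin; apply: le_trans hN.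
  by apply: ereal_sup_ubound; exists m, e.
have /asboolP[e he] : P (ex_maxn P0 Pb) by case: ex_maxnP.
have hmax m : P m -> (m <= ex_maxn P0 Pb)%N by case: ex_maxnP => i _ h /h.
move: (ex_maxn _ _) e he hmax => n e he hmax; exists n, e; split => // v.
apply: contrapT => hv.
suff : P n.+1 by move=> /hmax; rewrite ltnn.
by apply/asboolP; exists (snoc_family e v); exact: lin_indep_snoc.
Qed.

End FiniteDimension.

(** * Functionals, separation and biorthogonal systems *)

Section Functionals.
Variables (R : realType) (k : scalar_kind).
Local Notation K := (scalars R k).

Lemma dual_linear_form (X : normedModType K) (f : dual X) : linear_form (f : X -> K).
Proof. exact: dual_linear. Qed.

Lemma dual_bound (X : normedModType K) (f : dual X) x :
  rnorm (f x) <= rnorm f * rnorm x.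
Proof. by rewrite rnorm_dual; exact: op_normP. Qed.

Lemma dual_ball (X : normedModType K) (f : dual X) x :
  rnorm f <= 1 -> rnorm (f x) <= rnorm x.
Proof.
move=> f1; apply: (le_trans (dual_bound f x)).
by rewrite -[leRHS]mul1r ler_wpM2r// rnorm_ge0.
Qed.

Lemma dual_of_linear_form (X : normedModType K) (f : X -> K) (M : R) :
  linear_form f -> 0 <= M -> (forall x, rnorm (f x : K^o) <= M * rnorm x) ->
  exists g : dual X, (forall x, g x = f x) /\ rnorm g <= M.
Proof.
move=> fl M0 fM.
have fP : bounded_functional (f : X -> K^o).
  by apply/asboolP; split; [exact: fl|exists M].
exists (Dual fP); split=> //; rewrite rnorm_dual; apply: op_norm_le => x x1.
by apply: (le_trans (fM x)); rewrite -[leRHS]mulr1 ler_wpM2l.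
Qed.

Lemma rnorm_is_seminorm (X : normedModType K) : is_seminorm (@rnorm R k X).
Proof. by split; [exact: rnormD|exact: rnormZ]. Qed.

Lemma norming_functional (X : normedModType K) (x : X) :
  exists f : dual X, rnorm f <= 1 /\ f x = ofR k (rnorm x).
Proof.
have [f [fl f1 fx]] := hahn_banach_seminorm x (rnorm_is_seminorm X).
have [|g [gf g1]] := dual_of_linear_form fl ler01; first by move=> y; rewrite mul1r.
by exists g; rewrite gf.
Qed.

Lemma dual_separates (X : normedModType K) (x y : X) :
  (forall f : dual X, f x = f y) -> x = y.
Proof.
move=> h; apply/eqP; rewrite -subr_eq0; apply/eqP; apply: rnorm0_eq0.
have [f [_ fx]] := norming_functional (x - y).
have := congr1 (@toR R k) fx; rewrite toR_ofR => <-.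
by rewrite (linear_formB _ _ (dual_linear_form f)) h subrr -(ofR0 R k) toR_ofR.
Qed.

(** Hahn-Banach for the quotient seminorm of [p], which vanishes on [S] and is
    at least [c] at [x0]. *)
Lemma separate_subspace (E : lmodType K) (p : E -> R) (S : set E) (x0 : E) (c : R) :
  is_seminorm p -> S 0 -> (forall (l : K) x y, S x -> S y -> S (l *: x + y)) ->
  (forall s, S s -> c <= p (x0 - s)) ->
  exists f : E -> K, [/\ linear_form f, forall x, rnorm (f x : K^o) <= p x,
    forall s, S s -> f s = 0 & c <= toR (f x0)].
Proof.
move=> hp S0 Sl Sc; have [pD pZ] := hp.
have p0 : p 0 = 0 by have := pZ 0 0; rewrite scale0r rnorm0 mul0r.
have pN x : p (- x) = p x by rewrite -scaleN1r pZ (rnormN (1 : K^o)) rnorm1 mul1r.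
have pge0 x : 0 <= p x by have := pD x (- x); rewrite subrr p0 pN; lra.
pose A x := [set r | exists2 s, S s & r = p (x - s)].
have Ainf x : has_inf (A x).
  by split; [exists (p (x - 0)); exists 0|exists 0 => _ [s _ ->]].
pose q x := inf (A x).
have qle x s : S s -> q x <= p (x - s).
  by move=> Ss; apply: (ge_inf (Ainf x).2); exists s.
have qge x (d : R) : (forall s, S s -> d <= p (x - s)) -> d <= q x.
  by move=> h; apply: (lb_le_inf (Ainf x).1) => _ [s Ss ->]; exact: h.
have SD x y : S x -> S y -> S (x + y) by move=> Sx Sy; rewrite -[x]scale1r; exact: Sl.
have SZ (l : K) x : S x -> S (l *: x) by move=> Sx; rewrite -[_ *: _]addr0; exact: Sl.
have hq : is_seminorm q.
  apply: seminorm_of_le.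
  - by move=> x; apply: qge => s _.
  - move=> x y; apply/ler_addgt0Pr => e e0; have e2 : 0 < e / 2 by rewrite divr_gt0.
    have [_ [s Ss ->] hs] := inf_adherent e2 (Ainf x).
    have [_ [t St ->] ht] := inf_adherent e2 (Ainf y).
    have := qle (x + y) _ (SD _ _ Ss St); rewrite opprD addrACA.
    have := pD (x - s) (y - t); move: hs ht; rewrite -/(q x) -/(q y); lra.
  - move=> l x; have [->|l0] := eqVneq l 0.
      by rewrite rnorm0 mul0r scale0r (le_trans (qle 0 0 S0))// subr0 p0.
    have r0 : 0 < rnorm (l : K^o) by rewrite rnorm_gt0.
    rewrite -ler_pdivrMl//; apply: qge => s Ss; rewrite ler_pdivrMl//.
    by rewrite -pZ scalerBr qle//; exact: SZ.
have [f [fl fq fx]] := hahn_banach_seminorm x0 hq.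
exists f; split => //.
- by move=> x; rewrite (le_trans (fq x))// (le_trans (qle x 0 S0))// subr0.
- move=> s Ss; apply: (@rnorm0_eq0 R k K^o); apply/eqP; rewrite eq_le rnorm_ge0 andbT.
  by rewrite (le_trans (fq s))// (le_trans (qle s s Ss))// subrr p0.
- by rewrite fx toR_ofR; exact: qge.
Qed.

(** Each [e i] has positive distance to the span of the other vectors, by
    [lin_indep_lower]. *)
Lemma biorthogonal (X : normedModType K) n (e : 'I_n -> X) : lin_indep e ->
  exists f : 'I_n -> dual X, forall i, f i (e i) != 0 /\ forall j, j != i -> f i (e j) = 0.
Proof.
move=> he; have [c c0 hc] := lin_indep_lower he.
suff /choice[f hf] : forall i, exists f : dual X,
    f (e i) != 0 /\ forall j, j != i -> f (e j) = 0 by exists f.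
move=> i.
pose S := [set x | exists a : 'I_n -> K, a i = 0 /\ x = \sum_j a j *: e j].
have S0 : S 0.
  by exists (fun=> 0); split => //; rewrite big1// => j _; rewrite scale0r.
have Sl (l : K) x y : S x -> S y -> S (l *: x + y).
  move=> [a [ai ->]] [b [bi ->]]; exists (fun j => l * a j + b j).
  rewrite ai bi mulr0 addr0 scaler_sumr -big_split; split => //.
  by apply: eq_bigr => j _; rewrite scalerDl scalerA.
have Se j : j != i -> S (e j).
  move=> ji; exists (fun m => (m == j)%:R); rewrite eq_sym (negbTE ji); split => //.
  by rewrite (bigD1 j)//= eqxx scale1r big1 ?addr0// => m /negbTE ->; rewrite scale0r.
have Sc s : S s -> c <= rnorm (e i - s).
  move=> [a [ai ->]].
  have -> : e i - \sum_j a j *: e j = \sum_j ((j == i)%:R - a j) *: e j.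
    rewrite [RHS](eq_bigr (fun j => (j == i)%:R *: e j - a j *: e j)); last first.
      by move=> j _; rewrite scalerBl.
    rewrite sumrB; congr (_ - _); rewrite (bigD1 i)//= eqxx scale1r big1 ?addr0//.
    by move=> m /negbTE ->; rewrite scale0r.
  apply: le_trans (hc _); rewrite ler_peMr ?(ltW c0)// (bigD1 i)//= eqxx ai subr0 rnorm1.
  by rewrite lerDl; apply: sumr_ge0 => j _; exact: rnorm_ge0.
have [f [fl f1 fS fc]] := separate_subspace (rnorm_is_seminorm X) S0 Sl Sc.
have [|g [gf g1]] := dual_of_linear_form fl ler01; first by move=> y; rewrite mul1r.
exists g; rewrite gf; split.
  apply/eqP => fi; move: fc; rewrite fi -(ofR0 R k) toR_ofR; lra.
by move=> j ji; rewrite gf fS//; exact: Se.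
Qed.

Lemma dual_lin_indep (X : normedModType K) n (e : 'I_n -> X) : lin_indep e ->
  exists f : 'I_n -> dual X, lin_indep f.
Proof.
move=> he; have [f hf] := biorthogonal he; exists f => c hc i.
have [fi _] := hf i.
have : (\sum_j c j *: f j) (e i) = 0 by rewrite hc.
have -> : (\sum_j c j *: f j) (e i) = \sum_j c j * f j (e i).
  apply: (big_morph (fun g : dual X => (g (e i) : K))) => //.
rewrite (bigD1 i)//= big1 ?addr0 => [/eqP|j ji].
  by rewrite mulf_eq0 (negbTE fi) orbF => /eqP.
by rewrite (hf j).2 ?mulr0// eq_sym.
Qed.

End Functionals.

(** * Determinants and orthonormal systems *)

Section Sylvester.
Variable (F : fieldType).

(** Both sides are the determinant of the block matrix with diagonal blocks [1]
    and the other blocks [- A] and [B], reduced by rows in two ways. *)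
Lemma det_sylvester n r (A : 'M[F]_(n, r)) (B : 'M[F]_(r, n)) :
  \det (1%:M + A *m B) = \det (1%:M + B *m A).
Proof.
pose M := block_mx (1%:M : 'M[_]_n) (- A) B (1%:M : 'M[_]_r).
have h1 : (block_mx (1%:M) A 0 (1%:M) : 'M[_]_(n + r)) *m M = block_mx (1%:M + A *m B) 0 B (1%:M).
  by rewrite /M mulmx_block !mul1mx !mul0mx !mulmx1 add0r addNr add0r.
have h2 : block_mx (1%:M) 0 (- B) (1%:M) *m M = block_mx (1%:M) (- A) 0 (1%:M + B *m A).
  rewrite /M mulmx_block !mul1mx !mul0mx !mulmx1 !addr0 addNr mulNmx mulmxN opprK.
  by rewrite [_ + 1%:M]addrC.
have := congr1 (fun X : 'M[_]_(n + r) => \det X) h1.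
have := congr1 (fun X : 'M[_]_(n + r) => \det X) h2.
rewrite /= !det_mulmx det_lblock !det_ublock det_lblock !det1 !mul1r !mulr1.
by move=> -> .
Qed.

End Sylvester.

Section Orthonormal.
Variable (R : realType).

Definition sq n (a : 'rV[R]_n) : R := (a *m a^T) 0 0.

Lemma sqE n (a : 'rV[R]_n) : sq a = \sum_i a 0 i ^+ 2.
Proof. by rewrite /sq mxE; apply: eq_bigr => i _; rewrite mxE expr2. Qed.

Lemma sq_ge0 n (a : 'rV[R]_n) : 0 <= sq a.
Proof. by rewrite sqE; apply: sumr_ge0 => i _; exact: sqr_ge0. Qed.

Lemma sqZ n t (a : 'rV[R]_n) : sq (t *: a) = t ^+ 2 * sq a.
Proof. by rewrite /sq linearZ /= -scalemxAl -scalemxAr scalerA mxE expr2. Qed.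

Lemma sq_eq0 n (a : 'rV[R]_n) : sq a = 0 -> a = 0.
Proof.
rewrite sqE => /eqP; rewrite psumr_eq0 => [/allP h|i _]; last exact: sqr_ge0.
apply/rowP => i; rewrite mxE; apply/eqP; rewrite -sqrf_eq0.
by have /implyP := h i (mem_index_enum i); apply.
Qed.

Lemma sq_orthoD n (a b : 'rV[R]_n) : a *m b^T = 0 -> sq (a + b) = sq a + sq b.
Proof.
move=> ab; have ba : b *m a^T = 0 by rewrite -[b]trmxK -trmx_mul ab trmx0.
by rewrite /sq linearD /= mulmxDl !mulmxDr ab ba addr0 add0r mxE.
Qed.

Lemma mx11_scalar_sq n (a : 'rV[R]_n) : a *m a^T = (sq a)%:M.
Proof. by rewrite [LHS]mx11_scalar. Qed.

(** One step of the Gram-Schmidt process, with nothing appended when [w] already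
    lies in the row space. *)
Lemma orthonormal_extend1 n r (C : 'M[R]_(r, n)) (w : 'rV[R]_n) : C *m C^T = 1%:M ->
  exists r' (C' : 'M[R]_(r', n)), [/\ (r' <= r.+1)%N, C' *m C'^T = 1%:M &
    forall a : 'rV[R]_n, a *m C'^T = 0 -> a *m C^T = 0 /\ a *m w^T = 0].
Proof.
move=> hC; pose v := w - w *m C^T *m C.
have vC : v *m C^T = 0 by rewrite /v mulmxBl -[X in _ - X]mulmxA hC mulmx1 subrr.
have wE : w = v + w *m C^T *m C by rewrite /v subrK.
have aw (a : 'rV[R]_n) : a *m C^T = 0 -> a *m v^T = 0 -> a *m w^T = 0.
  move=> aC av; rewrite wE linearD /= mulmxDr av add0r.
  by rewrite trmx_mul mulmxA aC mul0mx.
have [v0|v0] := eqVneq (sq v) 0.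
  exists r, C; split => // a aC; split => //; apply: aw => //.
  by rewrite (sq_eq0 v0) trmx0 mulmx0.
have sv : 0 < sq v by rewrite lt_neqAle eq_sym v0 sq_ge0.
pose t : R := (Num.sqrt (sq v))^-1.
have t0 : t != 0 by rewrite invr_eq0 sqrtr_eq0 -ltNge.
have t2 : t ^+ 2 * sq v = 1 by rewrite exprVn sqr_sqrtr ?ltW// mulVf.
exists (r + 1)%N, (col_mx C (t *: v)); split; first by rewrite addn1.
  rewrite tr_col_mx mul_col_row hC mx11_scalar_sq sqZ t2.
  have vtC : (t *: v) *m C^T = 0 by rewrite -scalemxAl vC scaler0.
  rewrite vtC -[X in block_mx _ X](trmxK (C *m (t *: v)^T)) trmx_mul trmxK vtC trmx0.
  by rewrite -scalar_mx_block.
move=> a; rewrite tr_col_mx mul_mx_row => h.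
have aC : a *m C^T = 0 by have := congr1 lsubmx h; rewrite row_mxKl linear0.
have av : a *m (t *: v)^T = 0 by have := congr1 rsubmx h; rewrite row_mxKr linear0.
split => //; apply: aw => //; move: av; rewrite linearZ /= -scalemxAr => /eqP.
by rewrite scaler_eq0 (negbTE t0) => /eqP.
Qed.

Lemma orthonormal_extend n r (C : 'M[R]_(r, n)) (ws : seq 'rV[R]_n) : C *m C^T = 1%:M ->
  exists r' (C' : 'M[R]_(r', n)), [/\ (r' <= r + size ws)%N, C' *m C'^T = 1%:M &
    forall a : 'rV[R]_n, a *m C'^T = 0 ->
      a *m C^T = 0 /\ forall w, w \in ws -> a *m w^T = 0].
Proof.
move=> hC; elim: ws => [|w ws [r1 [C1 [hr1 hC1 h1]]]].
  by exists r, C; rewrite addn0; split.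
have [r2 [C2 [hr2 hC2 h2]]] := orthonormal_extend1 w hC1.
exists r2, C2; split => //; first by rewrite /= addnS (leq_trans hr2)// ltnS.
move=> a /h2[/h1[aC aws] aw]; split => // w'.
by rewrite inE => /predU1P[->|/aws].
Qed.

End Orthonormal.

(** * Inscribed ellipsoids of large volume *)

Section DvoretzkyRogers.
Variables (R : realType) (k : scalar_kind) (U : normedModType (scalars R k)).
Local Notation K := (scalars R k).

Lemma rnorm_ofR_abs (t : R) : rnorm (ofR k t : K^o) = `|t|.
Proof.
have [t0|t0] := leP 0 t; first by rewrite rnorm_ofR// ger0_norm.
rewrite -[in LHS](opprK t) ofRN rnormN rnorm_ofR ?ltr0_norm//; lra.
Qed.

Definition rcomb n (u : 'I_n -> U) (a : 'rV[R]_n) : U :=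
  \sum_i ofR k (a 0 i) *: u i.

Lemma rcombD n (u : 'I_n -> U) a b : rcomb u (a + b) = rcomb u a + rcomb u b.
Proof.
by rewrite /rcomb -big_split; apply: eq_bigr => i _; rewrite mxE ofRD scalerDl.
Qed.

Lemma rcombZ n (u : 'I_n -> U) t a : rcomb u (t *: a) = ofR k t *: rcomb u a.
Proof.
by rewrite /rcomb scaler_sumr; apply: eq_bigr => i _; rewrite mxE ofRM scalerA.
Qed.

Lemma rcomb0 n (u : 'I_n -> U) : rcomb u 0 = 0.
Proof. by rewrite -(scale0r 0) rcombZ ofR0 scale0r. Qed.

Lemma rcomb_sum n (u : 'I_n -> U) (I : Type) (r : seq I) (F : I -> 'rV[R]_n) :
  rcomb u (\sum_(i <- r) F i) = \sum_(i <- r) rcomb u (F i).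
Proof. by apply: (big_morph (rcomb u)); [exact: rcombD|exact: rcomb0]. Qed.

(** [T] is admissible when the Euclidean unit ball, mapped by [T] into the span
    of [u], lands in the unit ball of [U]: the image is an inscribed ellipsoid
    of volume proportional to [`|\det T|]. *)
Definition admissible n (u : 'I_n -> U) (T : 'M[R]_n) : Prop :=
  forall a : 'rV[R]_n, rnorm (rcomb u (a *m T)) ^+ 2 <= sq a.

(** The entries of an admissible matrix are bounded since coordinates in a
    finite-dimensional subspace are. *)
Lemma admissible_det_bound n (u : 'I_n -> U) : lin_indep u ->
  exists B : R, forall T, admissible u T -> `|\det T| <= B.
Proof.
move=> hu; have [c c0 hc] := lin_indep_lower hu.
exists (\sum_(s : {perm 'I_n}) c^-1 ^+ n) => T hT.
have Tij i j : `|T i j| <= c^-1.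
  have := hT (delta_mx 0 i); rewrite /sq trmx_delta mul_delta_mx mxE !eqxx /=.
  rewrite -rowE expr_le1 ?rnorm_ge0// => h.
  rewrite -[leRHS]mul1r ler_pdivlMr// mulrC; apply: le_trans h.
  apply: le_trans (hc _); rewrite ler_pM2l// (bigD1 j)//= rnorm_ofR_abs mxE lerDl.
  by apply: sumr_ge0 => l _; exact: rnorm_ge0.
apply: (le_trans (ler_norm_sum _ _ _)); apply: ler_sum => s _.
rewrite normrM normrX normrN1 expr1n mul1r normr_prod.
rewrite -[leRHS](_ : \prod_(i < n) c^-1 = _); last by rewrite prodr_const card_ord.
by apply: ler_prod => i _; rewrite normr_ge0 Tij.
Qed.

Lemma admissible_scalar n (u : 'I_n -> U) : exists2 t : R, 0 < t & admissible u t%:M.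
Proof.
pose S := \sum_i rnorm (u i).
have S0 : 0 <= S by apply: sumr_ge0 => i _; exact: rnorm_ge0.
have S1 : 0 < 1 + S by lra.
exists ((1 + S)^-1); first by rewrite invr_gt0.
move=> a; rewrite mul_mx_scalar rcombZ rnormZ rnorm_ofR ?invr_ge0 ?(ltW S1)//.
have aS : rnorm (rcomb u a) <= Num.sqrt (sq a) * S.
  apply: (le_trans (rnorm_comb_le _ _)); rewrite /S mulr_sumr; apply: ler_sum => i _.
  apply: ler_wpM2r; first exact: rnorm_ge0.
  rewrite rnorm_ofR_abs -sqrtr_sqr ler_wsqrtr// sqE (bigD1 i)//= lerDl.
  by apply: sumr_ge0 => j _; exact: sqr_ge0.
rewrite -[leRHS](sqr_sqrtr (sq_ge0 a)) ler_pXn2r ?nnegrE ?sqrtr_ge0//; last first.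
  by rewrite mulr_ge0 ?rnorm_ge0// invr_ge0 ltW.
rewrite ler_pdivrMl// (le_trans aS)// mulrC ler_wpM2r ?sqrtr_ge0//; lra.
Qed.

(** The volume is maximal up to the factor [2], which is the factor gained by the
    stretching in [large_vector]. *)
Lemma admissible_near_max n (u : 'I_n -> U) : lin_indep u ->
  exists T, [/\ admissible u T, 0 < `|\det T| &
    forall T', admissible u T' -> `|\det T'| < 2 * `|\det T|].
Proof.
move=> hu; have [B hB] := admissible_det_bound hu; have [t t0 ht] := admissible_scalar u.
pose A := [set r : R | exists2 T, admissible u T & r = `|\det T|].
have supA : has_sup A.
  by split; [exists `|\det (t%:M : 'M[_]_n)|; exists t%:M|exists B => _ [T /hB h ->]].
have s0 : 0 < sup A.
  apply: (@lt_le_trans _ _ `|\det (t%:M : 'M[_]_n)|).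
    by rewrite det_scalar normr_gt0 expf_neq0// gt_eqF.
  by apply: ub_le_sup; [exact: supA.2|exists t%:M].
have s2 : 0 < sup A / 2 by lra.
have [_ [T hT ->] hs] := sup_adherent s2 supA.
exists T; split => //; first lra.
move=> T' hT'; have : `|\det T'| <= sup A.
  by apply: ub_le_sup; [exact: supA.2|exists T'].
lra.
Qed.

(** If the norm were below [1/4] on the orthogonal complement of the rows of [C],
    then the ellipsoid could be stretched by [2] there and shrunk by [1/2] along
    the rows of [C], and its volume would grow. *)
Lemma large_vector n (u : 'I_n -> U) T r (C : 'M[R]_(r, n)) :
  admissible u T -> 0 < `|\det T| ->
  (forall T', admissible u T' -> `|\det T'| < 2 * `|\det T|) ->
  C *m C^T = 1%:M -> (r.*2 < n)%N ->
  exists a : 'rV[R]_n, [/\ a *m C^T = 0, sq a = 1 & 1 / 4 <= rnorm (rcomb u (a *m T))].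
Proof.
move=> hT T0 Tmax hC rn; apply: contrapT => hn.
have {}hn (a : 'rV[R]_n) : a *m C^T = 0 -> 16 * rnorm (rcomb u (a *m T)) ^+ 2 <= sq a.
  move=> aC; rewrite leNgt; apply/negP => ha; apply: hn.
  have s0 : 0 < sq a.
    rewrite lt_neqAle sq_ge0 andbT eq_sym; apply/eqP => /sq_eq0 a0.
    by move: ha; rewrite a0 mul0mx rcomb0 rnorm0 expr0n mulr0 ltNge sq_ge0.
  pose t : R := (Num.sqrt (sq a))^-1.
  have t0 : 0 < t by rewrite invr_gt0 sqrtr_gt0.
  have t2 : t ^+ 2 * sq a = 1 by rewrite exprVn sqr_sqrtr ?(ltW s0)// mulVf// gt_eqF.
  exists (t *: a); rewrite -!scalemxAl aC scaler0 sqZ t2; split => //.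
  rewrite rcombZ rnormZ rnorm_ofR ?(ltW t0)//.
  rewrite -(@ler_pXn2r _ 2)// ?nnegrE; [|by rewrite divr_ge0|]; last first.
    by rewrite mulr_ge0 ?rnorm_ge0// ltW.
  have -> : (1 / 4 : R) ^+ 2 = 1 / 16 by rewrite expr2; lra.
  by have := ler_wpM2l (sqr_ge0 t) (ltW ha); rewrite t2 mulrCA -exprMn; lra.
(* [S] halves the row space of [C] and doubles its orthogonal complement, so its
   determinant is [2 ^ (n - 2 * r)]. *)
pose S : 'M[R]_n := 2%:M - (3 / 2) *: (C^T *m C).
have hS : admissible u (S *m T).
  move=> b; pose p := b *m C^T *m C; pose v := b - p.
  have vC : v *m C^T = 0 by rewrite /v mulmxBl -[X in _ - X]mulmxA hC mulmx1 subrr.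
  have vp : v *m p^T = 0 by rewrite /p trmx_mul mulmxA vC mul0mx.
  have bE : b = v + p by rewrite /v subrK.
  have bST : b *m (S *m T) = 2 *: (v *m T) + (1 / 2) *: (p *m T).
    rewrite mulmxA /S mulmxBr mul_mx_scalar -scalemxAr [b *m (_ *m _)]mulmxA -/p.
    rewrite {1}bE scalerDr -addrA -scalerBl mulmxDl -!scalemxAl; congr (_ + _ *: _); lra.
  rewrite bST rcombD !rcombZ bE (sq_orthoD vp).
  have h1 := hn _ vC; have h2 := hT p.
  have := rnormD (ofR k (2 : R) *: rcomb u (v *m T)) (ofR k (1 / 2 : R) *: rcomb u (p *m T)).
  rewrite !rnormZ !rnorm_ofR//.
  move: (rnorm_ge0 (ofR k (2 : R) *: rcomb u (v *m T) + ofR k (1 / 2 : R) *: rcomb u (p *m T))).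
  move: (sq_ge0 v) (sq_ge0 p) h1 h2 (rnorm_ge0 (rcomb u (v *m T))) (rnorm_ge0 (rcomb u (p *m T))).
  move: (rnorm (_ + _)) (rnorm (rcomb u (v *m T))) (rnorm (rcomb u (p *m T))) (sq v) (sq p).
  move=> z x y s t s0 t0 xs yt x0 y0 z0 zxy.
  have : z ^+ 2 <= (2 * x + 1 / 2 * y) ^+ 2 by rewrite ler_pXn2r ?nnegrE//; lra.
  by have := sqr_ge0 (2 * x - 1 / 2 * y); nra.
have := Tmax _ hS; rewrite det_mulmx normrM ltr_pM2r//.
have -> : \det S = 2 ^+ n * 4^-1 ^+ r.
  have -> : S = 2 *: (1%:M + (- (3 / 4) *: C^T) *m C).
    rewrite scalerDr scale_scalar_mx mulr1 -scalemxAl scalerA /S -scaleNr.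
    by congr (_ + _ *: _); lra.
  rewrite detZ det_sylvester -scalemxAr hC scale_scalar_mx mulr1 -raddfD /= det_scalar.
  by congr (_ * _ ^+ _); lra.
have -> : (4 : R)^-1 = 2^-1 ^+ 2 by rewrite exprVn; congr (_^-1); rewrite expr2; lra.
rewrite -exprM mul2n exprVn -expfB// ger0_norm ?exprn_ge0// ltNge => /negP; apply.
by rewrite -[leLHS]expr1 ler_weXn2l ?subn_gt0//; lra.
Qed.

End DvoretzkyRogers.

(** * The Dvoretzky-Rogers lemma *)

Section DvoretzkyRogersSystem.
Variables (R : realType) (k : scalar_kind) (U : normedModType (scalars R k)).
Local Notation K := (scalars R k).

(** Covers both the dual unit ball acting on [X] and the unit ball of [X] acting
    on its dual.  The factor [1 / 2] is there because the norm of a functional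
    need not be attained; the real part suffices because both sets are invariant
    under unimodular scalars. *)
Definition norming (D : set (U -> K)) : Prop :=
  (forall f, D f -> linear_form f /\ forall u, rnorm (f u : K^o) <= rnorm u) /\
  (forall u, exists2 f, D f & rnorm u / 2 <= toR (f u)).

(** Turns a real-linear condition on [rcomb u (a *m T)] into orthogonality of
    [a] to one row vector. *)
Definition coef_row n (u : 'I_n -> U) T (g : U -> R) : 'rV[R]_n :=
  \row_j g (rcomb u (delta_mx 0 j *m T)).

Lemma coef_rowE n (u : 'I_n -> U) T (g : U -> R) :
  (forall x y, g (x + y) = g x + g y) -> (forall t x, g (ofR k t *: x) = t * g x) ->
  forall a : 'rV[R]_n, (a *m (coef_row u T g)^T) 0 0 = g (rcomb u (a *m T)).
Proof.
move=> gD gZ a; rewrite {2}(row_sum_delta a) mulmx_suml rcomb_sum.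
have g0 : g 0 = 0 by have := gZ 0 0; rewrite ofR0 scale0r mul0r.
rewrite (big_morph g gD g0) mxE; apply: eq_bigr => j _.
by rewrite -scalemxAl rcombZ gZ !mxE.
Qed.

(** The vectors are chosen one after another; each new vector is taken
    orthogonal to the earlier ones and in the kernel of the functionals chosen
    for them, which costs three real linear conditions per step. *)
Lemma greedy_system (D : set (U -> K)) n (u : 'I_n -> U) T :
  norming D -> admissible u T -> 0 < `|\det T| ->
  (forall T', admissible u T' -> `|\det T'| < 2 * `|\det T|) ->
  forall m, (6 * m <= n)%N ->
  exists (a : nat -> 'rV[R]_n) (b : nat -> U -> K) r (C : 'M[R]_(r, n)),
  [/\ (r <= 3 * m)%N, C *m C^T = 1%:M,
      forall c : 'rV[R]_n, c *m C^T = 0 -> forall i, (i < m)%N ->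
        c *m (a i)^T = 0 /\ b i (rcomb u (c *m T)) = 0,
      forall i j, (i < m)%N -> (j < m)%N -> a j *m (a i)^T = (i == j)%:R%:M &
      forall i, (i < m)%N -> [/\ D (b i), 1 / 8 <= toR (b i (rcomb u (a i *m T))) &
        forall j, (i < j < m)%N -> b i (rcomb u (a j *m T)) = 0]].
Proof.
move=> [Dlin Dnorm] hT T0 Tmax; elim=> [_|m ih hm].
  exists (fun=> 0), (fun _ _ => 0), 0%N, 0; split => //.
  by apply/matrixP => -[].
have [|a [b [r [C [hr hC hker horth hb]]]]] := ih; first by rewrite (leq_trans _ hm)// leq_mul2l leqnSn.
have rn : (r.*2 < n)%N.
  by apply: leq_trans hm; rewrite -muln2 mulnS; move: hr; lia.
have [v [vC v1 vT]] := large_vector hT T0 Tmax hC rn.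
set x := rcomb u (v *m T) in vT.
have [f Df fx] := Dnorm x; have [fl fle] := Dlin f Df.
have gDr y z : toR (f (y + z)) = toR (f y) + toR (f z) by rewrite linear_formD// toRD.
have gZr t y : toR (f (ofR k t *: y)) = t * toR (f y) by rewrite linear_formZ// toRM_ofR.
have gDi y z : imK (f (y + z)) = imK (f y) + imK (f z) by rewrite linear_formD// imKD.
have gZi t y : imK (f (ofR k t *: y)) = t * imK (f y) by rewrite linear_formZ// imKM_ofR.
pose ws := [:: v; coef_row u T (fun y => toR (f y)); coef_row u T (fun y => imK (f y))].
have [r' [C' [hr' hC' h']]] := orthonormal_extend ws hC.
have fker (c : 'rV[R]_n) : c *m C'^T = 0 -> f (rcomb u (c *m T)) = 0.
  move=> /h'[_ hw]; rewrite (toR_imK (f _)).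
  rewrite -(coef_rowE u T gDr gZr) -(coef_rowE u T gDi gZi).
  by rewrite !hw ?mxE ?ofR0 ?mulr0 ?addr0// !inE eqxx ?orbT.
exists (fun i => if (i < m)%N then a i else v), (fun i => if (i < m)%N then b i else f).
exists r', C'; split => //.
- by rewrite (leq_trans hr')//= mulnS addnC leq_add2l.
- move=> c cC i; rewrite ltnS leq_eqVlt => /predU1P[->|im].
    rewrite ltnn; split; last exact: fker.
    by have [_ hw] := h' _ cC; apply: hw; rewrite inE eqxx.
  by rewrite im; apply: hker => //; have [] := h' _ cC.
- have vv : v *m v^T = 1%:M by rewrite mx11_scalar_sq v1.
  have va i : (i < m)%N -> v *m (a i)^T = 0 by move=> im; have [] := hker _ vC _ im.
  have av i : (i < m)%N -> a i *m v^T = 0.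
    by move=> im; rewrite -[a i]trmxK -trmx_mul va// trmx0.
  move=> i j; rewrite ltnS leq_eqVlt => /predU1P[->|im]; rewrite ltnS leq_eqVlt => /predU1P[->|jm].
  + by rewrite ltnn eqxx.
  + by rewrite ltnn jm gtn_eqF// av// raddf0.
  + by rewrite ltnn im ltn_eqF// va// raddf0.
  + by rewrite im jm horth.
- move=> i; rewrite ltnS leq_eqVlt => /predU1P[->|im].
    rewrite ltnn; split => //; first by rewrite -/x; lra.
    by move=> j /andP[mj]; rewrite ltnS leqNgt mj.
  rewrite im; have [Db b8 bz] := hb i im; split => // j /andP[ij].
  rewrite ltnS leq_eqVlt => /predU1P[->|jm].
    by rewrite ltnn; have [] := hker _ vC _ im.
  by rewrite jm bz// ij.
Qed.

(** The weak-[l^2] bound holds with [2] instead of [1] because it is obtained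
    with real coefficients, on real and imaginary parts separately. *)
Theorem dvoretzky_rogers (D : set (U -> K)) m :
  (forall n, exists u : 'I_n -> U, lin_indep u) -> norming D ->
  exists (x : nat -> U) (b : nat -> U -> K),
  [/\ forall f, D f -> \sum_(i < m) rnorm (f (x i) : K^o) ^+ 2 <= 2,
      forall i, (i < m)%N -> D (b i),
      forall i, (i < m)%N -> 1 / 8 <= rnorm (b i (x i) : K^o) &
      forall i j, (i < j < m)%N -> b i (x j) = 0].
Proof.
move=> hU hD; (* Each step adds three rows to [C], and [large_vector] asks for [2 * r < n]. *)
have [u hu] := hU (6 * m)%N.
have [T [hT T0 Tmax]] := admissible_near_max hu.
have [a [b [r [C [_ _ _ horth hb]]]]] := greedy_system hD hT T0 Tmax (leqnn _).
exists (fun i => rcomb u (a i *m T)), b; split.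
- have up (c : 'I_m -> R) :
      rnorm (\sum_i ofR k (c i) *: rcomb u (a i *m T)) ^+ 2 <= \sum_i c i ^+ 2.
    have -> : \sum_i ofR k (c i) *: rcomb u (a i *m T) =
        rcomb u ((\sum_(i < m) c i *: a i) *m T).
      rewrite mulmx_suml rcomb_sum; apply: eq_bigr => i _.
      by rewrite -scalemxAl rcombZ.
    apply: (le_trans (hT _)); rewrite /sq linear_sum /= mulmx_suml summxE.
    apply: ler_sum => i _; rewrite -scalemxAl mulmx_sumr (bigD1 i)//= big1 ?addr0.
      by rewrite linearZ /= -scalemxAr horth// eqxx scalerA !mxE mulr1 expr2.
    by move=> j ji; rewrite linearZ /= -scalemxAr horth// (inj_eq val_inj) (negbTE ji) raddf0 scaler0.
  move=> f Df; have [fl fle] := hD.1 f Df.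
  have key (g : K -> R) : (forall z w, g (z + w) = g z + g w) ->
      (forall t z, g (ofR k t * z) = t * g z) -> (forall z, `|g z| <= rnorm (z : K^o)) ->
      \sum_(i < m) g (f (rcomb u (a i *m T))) ^+ 2 <= 1.
    move=> gD gZ gle; set c := fun i : 'I_m => g (f (rcomb u (a i *m T))).
    have := up c; set y := \sum_i _ => hy.
    have g0 : g 0 = 0 by have := gZ 0 0; rewrite ofR0 !mul0r.
    have fy : g (f y) = \sum_i c i ^+ 2.
      rewrite /y linear_form_sum// (big_morph g gD g0); apply: eq_bigr => i _.
      by rewrite linear_formZ// gZ expr2.
    set s := \sum_i c i ^+ 2 in hy fy *.
    have s0 : 0 <= s by apply: sumr_ge0 => i _; exact: sqr_ge0.
    have sy : s <= rnorm y.
      by rewrite -(ger0_norm s0) -fy (le_trans (gle _)).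
    rewrite leNgt; apply/negP => s1.
    have : s ^+ 2 <= s by apply: le_trans hy; rewrite ler_pXn2r ?nnegrE ?rnorm_ge0.
    by rewrite expr2 => h; have := ltr_pM2l (lt_trans ltr01 s1) 1 s; rewrite s1 mulr1 ltNge h.
  under eq_bigr do rewrite rnorm_sqr.
  rewrite big_split /=.
  have h1 := key _ (@toRD R k) (@toRM_ofR R k) (@abs_toR_le R k).
  have h2 := key _ (@imKD R k) (@imKM_ofR R k) (@abs_imK_le R k).
  have := lerD h1 h2; rewrite (_ : 1 + 1 = 2 :> R)//; lra.
- by move=> i im; have [] := hb i im.
- move=> i im; have [_ h _] := hb i im; exact: le_trans h (toR_le_rnorm _).
- move=> i j /andP[ij jm]; have [_ _ h] := hb i (ltn_trans ij jm).
  by apply: h; rewrite ij.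
Qed.

End DvoretzkyRogersSystem.

(** * Submatrices with small entries off the diagonal *)

Section SparseSubmatrix.
Variables (R : realType).

(** A row of [l^1]-norm at most [2] has few entries above [d]; removing the
    columns of these entries, from the last row on, leaves a large square
    submatrix with small entries off the diagonal. *)
Lemma sparse_submatrix (A : nat -> nat -> R) (m q : nat) (d : R) :
  (forall i j, (i < m)%N -> (j < m)%N -> 0 <= A i j) -> 0 <= d -> 2 < d * q%:R ->
  (forall i, (i < m)%N -> \sum_(j < m) A i j <= 2) ->
  (forall i j, (i < j < m)%N -> A i j = 0) ->
  forall M (s : seq nat), sorted gtn s -> (forall i, i \in s -> (i < m)%N) ->
  (M * q.+1 <= size s)%N ->
  exists t : seq nat, [/\ size t = M, uniq t, {subset t <= s} &
    forall i j, i \in t -> j \in t -> i != j -> A i j <= d].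
Proof.
move=> A0 d0 dq A2 Az; elim=> [|M ih] s ss sm hs; first by exists [::].
case: s ss sm hs => [|i s] ss sm hs; first by move: hs; rewrite mulSn.
have im : (i < m)%N by apply: sm; rewrite inE eqxx.
have iall j : j \in s -> (j < i)%N.
  move=> js; have := ss; rewrite /= (path_sortedE (rev_trans ltn_trans)).
  by move=> /andP[/allP/(_ j js)].
pose s' := [seq j <- s | A i j <= d].
have ss' : sorted gtn s' by apply: (sorted_filter (rev_trans ltn_trans)); exact: (path_sorted ss).
have sub' j : j \in s' -> j \in s by rewrite mem_filter => /andP[].
have us : uniq s.
  by apply: (sorted_uniq (rev_trans ltn_trans) (fun x => ltnn x)); exact: (path_sorted ss).
have small : (size [seq j <- s | ~~ (A i j <= d)%R] <= q)%N.
  set b := [seq _ <- _ | _]; rewrite leqNgt; apply/negP => qb.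
  have bm j : j \in b -> (j < m)%N.
    by rewrite mem_filter => /andP[_ js]; rewrite (ltn_trans (iall _ js) im).
  have h1 : \sum_(j <- b) A i j <= \sum_(j < m) A i j.
    have -> : \sum_(j < m) A i j = \sum_(j <- iota 0 m) A i j.
      by rewrite -[in RHS](subn0 m) -/(index_iota 0 m) big_mkord.
    have ub : uniq b by rewrite filter_uniq.
    have pb : perm_eq (iota 0 m) (b ++ [seq j <- iota 0 m | j \notin b]).
      have h := perm_filterC (mem b) (iota 0 m).
      rewrite -h perm_cat2r; apply: uniq_perm => //; first by rewrite filter_uniq// iota_uniq.
      move=> j; rewrite mem_filter mem_iota add0n /=; apply/andP/idP => [[]//|jb].
      by rewrite jb bm.
    rewrite (perm_big _ pb) big_cat /= lerDl big_seq; apply: sumr_ge0 => j.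
    by rewrite mem_filter mem_iota add0n => /andP[_ jm]; exact: A0.
  have h2 : \sum_(j <- b) d <= \sum_(j <- b) A i j.
    rewrite big_seq [leRHS]big_seq; apply: ler_sum => j.
    by rewrite mem_filter -ltNge => /andP[/ltW].
  have : d * q%:R <= \sum_(j <- b) d.
    have -> : \sum_(j <- b) d = d * (size b)%:R.
      by rewrite big_const_seq count_predT iter_addr addr0 mulr_natr.
    by rewrite ler_wpM2l// ler_nat ltnW.
  by have := A2 i im; lra.
have hs' : (M * q.+1 <= size s')%N.
  have := count_predC (fun j => A i j <= d) s; rewrite -!size_filter -/s'.
  by move: small hs; rewrite /= mulSn; set y := size _; lia.
have sm' j : j \in s' -> (j < m)%N by move=> /sub' js; apply: sm; rewrite inE js orbT.
have [t [tM ut ts ht]] := ih s' ss' sm' hs'.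
exists (i :: t); split.
- by rewrite /= tM.
- by rewrite /= ut andbT; apply/negP => /ts/sub'/iall; rewrite ltnn.
- move=> j; rewrite !inE => /predU1P[->|/ts/sub' ->]; [by rewrite eqxx|by rewrite orbT].
move=> j l; rewrite !inE => /predU1P[->|jt] /predU1P[->|lt].
- by rewrite eqxx.
- by move=> _; have := ts _ lt; rewrite mem_filter => /andP[].
- move=> _; rewrite Az// im andbT; exact/iall/sub'/ts.
- exact: ht.
Qed.

End SparseSubmatrix.

(** * Finite-dimensional [l^1] spaces and James's distortion theorem *)

Section ContainsL1.
Variables (R : realType) (k : scalar_kind) (E : lmodType (scalars R k)).
Local Notation K := (scalars R k).

Definition contains_l1 (N : E -> R) (c : R) : Prop :=
  forall I : finType, exists z : I -> E, (forall i, N (z i) <= 1) /\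
    forall a : I -> K, c * (\sum_i rnorm (a i : K^o)) <= N (\sum_i a i *: z i).

(** Either one of the [I] blocks of an [I * I]-indexed system already has the
    better constant, or each block has a normalised vector of norm below
    [Num.sqrt c], and rescaling these vectors gives the better constant. *)
Lemma james_sqrt (N : E -> R) (c : R) : is_seminorm N -> 0 < c ->
  contains_l1 N c -> contains_l1 N (Num.sqrt c).
Proof.
move=> [ND NZ] c0 hN I; set s := Num.sqrt c.
have s0 : 0 < s by rewrite sqrtr_gt0.
have ss : s * s = c by rewrite -expr2 sqr_sqrtr// ltW.
have [z [z1 hz]] := hN (I * I)%type.
have [[i hi]|hn] := pselect (exists i, forall a : I -> K,
  s * (\sum_j rnorm (a j : K^o)) <= N (\sum_j a j *: z (i, j))).
  by exists (fun j => z (i, j)); split.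
have /choice[a ha] : forall i, exists a : I -> K,
    N (\sum_j a j *: z (i, j)) < s * (\sum_j rnorm (a j : K^o)).
  move=> i; apply: contrapT => h; apply: hn; exists i => a.
  by rewrite leNgt; apply/negP => h'; apply: h; exists a.
pose S i := \sum_j rnorm (a i j : K^o).
have S0' i : 0 <= S i by apply: sumr_ge0 => j _; exact: rnorm_ge0.
have N00 : N 0 = 0 by have := NZ 0 0; rewrite scale0r rnorm0 mul0r.
have S0 i : 0 < S i.
  rewrite lt_neqAle S0' andbT; apply/eqP => Si; have := ha i; rewrite -/(S i) -Si mulr0.
  suff -> : \sum_j a i j *: z (i, j) = 0 by rewrite N00 ltxx.
  apply: big1 => j _; suff -> : a i j = 0 by rewrite scale0r.
  apply: (@rnorm0_eq0 R k K^o); apply/eqP; rewrite eq_le rnorm_ge0 andbT.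
  by rewrite Si /S (bigD1 j)//= lerDl; apply: sumr_ge0 => l _; exact: rnorm_ge0.
pose t i := (s * S i)^-1.
have t0 i : 0 < t i by rewrite invr_gt0 mulr_gt0.
exists (fun i => ofR k (t i) *: \sum_j a i j *: z (i, j)); split.
  by move=> i; rewrite NZ rnorm_ofR ?(ltW (t0 _))// /t ler_pdivrMl ?mulr_gt0// mulr1 ltW.
move=> b.
have := hz (fun p => b p.1 * ofR k (t p.1) * a p.1 p.2).
rewrite -(pair_bigA _ (fun i j => rnorm (b i * ofR k (t i) * a i j : K^o))) /=.
rewrite [X in N X](_ : _ = \sum_i \sum_j (b i * ofR k (t i) * a i j) *: z (i, j)); last first.
  by rewrite pair_bigA; apply: eq_bigr => -[i j] _.
have -> : \sum_i \sum_j rnorm (b i * ofR k (t i) * a i j : K^o) =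
    s^-1 * \sum_i rnorm (b i : K^o).
  rewrite mulr_sumr; apply: eq_bigr => i _; under eq_bigr do rewrite !rnormM rnorm_ofR ?(ltW (t0 _))//.
  have tS : t i * S i = s^-1 by rewrite /t invfM mulfVK// gt_eqF.
  by rewrite -mulr_sumr -/(S i) -mulrA tS mulrC.
rewrite mulrA (_ : c / s = s); last by rewrite -ss mulfK// gt_eqF.
congr (_ <= N _); apply: eq_bigr => i _; rewrite scalerA scaler_sumr.
by apply: eq_bigr => j _; rewrite scalerA.
Qed.

Lemma contains_l1_le (N : E -> R) (c c' : R) : c' <= c ->
  contains_l1 N c -> contains_l1 N c'.
Proof.
move=> cc h I; have [z [z1 hz]] := h I; exists z; split => // a.
apply: le_trans (hz a); apply: ler_wpM2r => //.
by apply: sumr_ge0 => i _; exact: rnorm_ge0.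
Qed.

(** The square root of a constant of containment is another one, by [james_sqrt],
    so the supremum of these constants is [1]. *)
Theorem james_distortion (N : E -> R) (c c' : R) : is_seminorm N -> 0 < c ->
  contains_l1 N c -> c' < 1 -> contains_l1 N c'.
Proof.
move=> hN c0 hc c'1.
pose C := [set d : R | contains_l1 N d].
have C1 : ubound C 1.
  move=> d /(_ 'I_1)[z [z1 /(_ (fun=> 1))]].
  rewrite !big_ord1 scale1r rnorm1 mulr1 => h.
  exact: le_trans h (z1 _).
have supC : has_sup C by split; [exists c|exists 1].
have cs : c <= sup C by apply: ub_le_sup => //; exists 1.
have s1 : 1 <= sup C.
  rewrite leNgt; apply/negP => s1.
  have e0 : 0 < sup C - sup C ^+ 2.
    by rewrite subr_gt0 expr2 gtr_pMr// (lt_le_trans c0).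
  have [d Cd hd] := sup_adherent e0 supC.
  have d2 : sup C ^+ 2 < d by lra.
  have d0 : 0 < d by apply: le_lt_trans d2; exact: sqr_ge0.
  have := ub_le_sup supC.2 (james_sqrt hN d0 Cd : C _).
  rewrite leNgt => /negP; apply.
  rewrite -(@ltr_pXn2r _ 2)// ?nnegrE ?sqrtr_ge0 ?(le_trans (ltW c0))//.
  by rewrite sqr_sqrtr// ltW.
have e0 : 0 < sup C - c' by lra.
have [d Cd hd] := sup_adherent e0 supC.
by apply: contains_l1_le Cd; lra.
Qed.

End ContainsL1.

(** * Pairs of Dvoretzky-Rogers systems *)

Section ProductSystem.
Variables (R : realType) (k : scalar_kind) (U V : normedModType (scalars R k)).
Local Notation K := (scalars R k).

(** The matrix of the products [f i (x j) * g i (y j)] has rows of [l^1]-norm at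
    most [2], by the inequality between arithmetic and geometric means, so that
    [sparse_submatrix] applies to a long enough pair of systems. *)
Lemma product_system (D : set (U -> K)) (D' : set (V -> K)) (I : finType) :
  (forall n, exists u : 'I_n -> U, lin_indep u) ->
  (forall n, exists v : 'I_n -> V, lin_indep v) -> norming D -> norming D' ->
  exists (x : I -> U) (y : I -> V) (f : I -> U -> K) (g : I -> V -> K),
  [/\ forall f g, D f -> D' g -> \sum_i rnorm (f (x i) * g (y i) : K^o) <= 2,
      forall i, D (f i) /\ D' (g i),
      forall i, 1 / 64 <= rnorm (f i (x i) * g i (y i) : K^o) &
      forall i, \sum_(j | j != i) rnorm (f i (x j) * g i (y j) : K^o) <= 1 / 128].
Proof.
move=> hU hV hD hD'.
(* With this [d] the entries off the diagonal of a row sum to at most half of the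
   lower bound [1 / 64] for the diagonal, and a row of [l^1]-norm [2] has fewer
   than [q] entries above [d]. *)
pose M := #|I|.
have M0 : 0 < (128 * M.+1%:R : R) by rewrite mulr_gt0// ltr0Sn.
pose d : R := (128 * M.+1%:R)^-1.
have d0 : 0 < d by rewrite invr_gt0.
pose q := (256 * M.+1).+1.
have dq : 2 < d * q%:R.
  have -> : q%:R = 256 * M.+1%:R + 1 :> R by rewrite /q -natr1 natrM.
  rewrite /d ltr_pdivlMl//; move: (M.+1%:R : R) => z; lra.
pose m := (M * q.+1)%N.
have [x [b [xb bD b8 bz]]] := dvoretzky_rogers m hU hD.
have [y [e [ye eD e8 ez]]] := dvoretzky_rogers m hV hD'.
pose A i j : R := rnorm (b i (x j) * e i (y j) : K^o).
have row f g : D f -> D' g -> \sum_(i < m) rnorm (f (x i) * g (y i) : K^o) <= 2.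
  move=> /xb h1 /ye h2.
  apply: (@le_trans _ _ (\sum_(i < m) ((rnorm (f (x i) : K^o) ^+ 2 + rnorm (g (y i) : K^o) ^+ 2) / 2))).
    apply: ler_sum => i _; rewrite rnormM.
    have := sqr_ge0 (rnorm (f (x i) : K^o) - rnorm (g (y i) : K^o)); rewrite sqrrB; lra.
  by rewrite -mulr_suml big_split /=; lra.
have [||||||t [tM ut ts ht]] := @sparse_submatrix R A m q d _ (ltW d0) dq _ _ M (rev (iota 0 m)).
- by move=> *; exact: rnorm_ge0.
- by move=> i im; apply: row; [exact: bD|exact: eD].
- by move=> i j ij; rewrite /A bz// mul0r rnorm0.
- by rewrite rev_sorted; exact: iota_ltn_sorted.
- by move=> i; rewrite mem_rev mem_iota.
- by rewrite size_rev size_iota.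
have tm i : i \in t -> (i < m)%N by move=> /ts; rewrite mem_rev mem_iota.
pose h (i : I) := nth 0%N t (enum_rank i).
have ht' i : h i \in t by rewrite mem_nth// tM ltn_ord.
have hinj i j : (h i == h j) = (i == j).
  by rewrite nth_uniq ?tM ?ltn_ord// (inj_eq val_inj) (inj_eq enum_rank_inj).
exists (fun i => x (h i)), (fun i => y (h i)), (fun i => b (h i)), (fun i => e (h i)); split.
- move=> f g Df Dg; apply: le_trans (row f g Df Dg).
  pose h' (i : I) : 'I_m := Ordinal (tm _ (ht' i)).
  have h'inj : injective h' by move=> i j /(congr1 val)/eqP; rewrite /= hinj => /eqP.
  rewrite -(big_map h' xpredT (fun j : 'I_m => rnorm (f (x j) * g (y j) : K^o))).
  have um : uniq (map h' (index_enum I)) by rewrite map_inj_uniq// index_enum_uniq.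
  rewrite [leRHS](bigID (fun j => j \in map h' (index_enum I))) /=.
  rewrite big_uniq//= lerDl; apply: sumr_ge0 => j _; exact: rnorm_ge0.
- by move=> i; split; [apply: bD|apply: eD]; exact: tm.
- move=> i; rewrite rnormM; have i8 := b8 _ (tm _ (ht' i)); have j8 := e8 _ (tm _ (ht' i)).
  have -> : 1 / 64 = 1 / 8 * (1 / 8) :> R by lra.
  by apply: ler_pM => //; rewrite divr_ge0.
- move=> i; apply: (@le_trans _ _ (\sum_(j | j != i) d)).
    by apply: ler_sum => j ji; apply: ht => //; rewrite hinj eq_sym.
  apply: (@le_trans _ _ (\sum_(j : I) d)).
    by rewrite [leRHS](bigID (fun j => j != i)) /= lerDl; apply: sumr_ge0 => j _; exact: ltW.
  have -> : \sum_(j : I) d = d * M%:R by rewrite sumr_const mulr_natr.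
  have M1 : M.+1%:R = M%:R + 1 :> R by rewrite natr1.
  by rewrite /d ler_pdivrMl// M1; have := ler0n R M; move: (M%:R : R) => z; lra.
Qed.

End ProductSystem.

Section NormingSets.
Variables (R : realType) (k : scalar_kind) (X : normedModType (scalars R k)).
Local Notation K := (scalars R k).

Definition dual_unit_ball : set (X -> K) :=
  [set f | exists2 g : dual X, rnorm g <= 1 & f = (g : X -> K)].

Lemma norming_dual_unit_ball : norming dual_unit_ball.
Proof.
split.
  move=> _ [g g1 ->]; split; first exact: dual_linear_form.
  by move=> u; exact: dual_ball.
move=> u; have [g [g1 gu]] := norming_functional u.
exists g; first by exists g.
by rewrite gu toR_ofR; have := rnorm_ge0 u; lra.
Qed.

Definition evaluations : set (dual X -> K) :=
  [set f : dual X -> K | exists2 x : X, rnorm x <= 1 & f = (fun g : dual X => g x : K)].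

(** A point where the functional is nearly as large as its norm, multiplied by a
    phase that makes the value real. *)
Lemma norming_evaluations : norming evaluations.
Proof.
split.
  move=> _ [x x1 ->]; split; first by [].
  move=> g; apply: (le_trans (dual_bound g x)).
  by rewrite -[leRHS]mulr1 ler_wpM2l// rnorm_ge0.
move=> g; have [->|g0] := eqVneq g 0.
  exists (fun g : dual X => g 0 : K); first by exists 0; rewrite ?rnorm0.
  by rewrite dual0 rnorm0 -(ofR0 R k) toR_ofR mul0r.
have g0' : 0 < rnorm g by rewrite rnorm_gt0.
have g2 : 0 < rnorm g / 2 by lra.
have := sup_adherent g2 (op_norm_has_sup g); rewrite -/(op_norm g) -rnorm_dual.
move=> [_ [x [x1 ->]] hx]; have [l [l1 lz]] := phase (g x).
exists (fun g : dual X => g (l *: x) : K).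
  by exists (l *: x) => //; rewrite rnormZ l1 mul1r.
have -> : g (l *: x) = ofR k (rnorm (g x)) by rewrite dualZ -lz.
by rewrite toR_ofR; lra.
Qed.

End NormingSets.

(** * Elementary tensors and the two cross norms *)

Section ElementaryTensors.
Variables (R : realType) (k : scalar_kind) (X Y : normedModType (scalars R k)).
Local Notation K := (scalars R k).

Definition etensor (x : X) (y : Y) : tensor X Y := tsum [:: (x, y)].

Lemma tensor_sumE (I : Type) (r : seq I) (F : I -> tensor X Y) b :
  (\sum_(i <- r) F i) b = \sum_(i <- r) (F i b : K).
Proof. by apply: (big_morph (fun w : tensor X Y => (w b : K))). Qed.

Lemma etensorE x y b : etensor x y b = b x y.
Proof. by rewrite /etensor /= /tsum_fun big_seq1. Qed.

Lemma tensor_combE (I : Type) (r : seq I) (a : I -> K) (x : I -> X) (y : I -> Y) b :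
  (\sum_(i <- r) a i *: etensor (x i) (y i)) b = \sum_(i <- r) a i * b (x i) (y i).
Proof.
rewrite tensor_sumE; apply: eq_bigr => i _.
by rewrite -[RHS](congr1 (fun z => a i * z) (etensorE _ _ _)).
Qed.

Lemma projective_norm_etensor x y : projective_norm (etensor x y) <= rnorm x * rnorm y.
Proof. by apply: (le_trans (proj_norm_lb _)); rewrite big_seq1. Qed.

Lemma injective_norm_etensor x y : injective_norm (etensor x y) <= rnorm x * rnorm y.
Proof.
apply: inj_norm_le => f g f1 g1; rewrite etensorE /= rnormM.
by apply: ler_pM; rewrite ?rnorm_ge0// dual_ball.
Qed.

Lemma tensor_norm_etensor alpha x y : tensor_norm alpha X Y (etensor x y) <= rnorm x * rnorm y.
Proof. by case: alpha; [exact: injective_norm_etensor|exact: projective_norm_etensor]. Qed.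

Lemma bounded_form_projective (b : bilinear_form X Y) (C : R) (w : tensor X Y) : 0 <= C ->
  (forall x y, rnorm (b x y : K^o) <= C * (rnorm x * rnorm y)) ->
  rnorm (w b) <= C * projective_norm w.
Proof.
move=> C0 hb; have [/eqP C1|C1] := boolP (C == 0).
  have [s ->] := tsum_surj w; rewrite C1 mul0r /= /tsum_fun.
  apply: (le_trans (ler_rnorm_sum _ _ _)); rewrite big1// => p _.
  by apply/eqP; rewrite eq_le rnorm_ge0 andbT (le_trans (hb _ _))// C1 mul0r.
have C2 : 0 < C by rewrite lt_neqAle eq_sym C1.
rewrite -ler_pdivrMl//; apply/ler_addgt0Pr => e e0.
have [s ws hs] := proj_norm_adherent w e0; apply: le_trans (ltW hs).
rewrite ler_pdivrMl// ws /= /tsum_fun mulr_sumr.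
by apply: (le_trans (ler_rnorm_sum _ _ _)); apply: ler_sum.
Qed.

Lemma functional_le_tensor_norm alpha (f : dual X) (g : dual Y) (w : tensor X Y) :
  rnorm f <= 1 -> rnorm g <= 1 ->
  rnorm (w (BilinearForm (dual_bilinear f g))) <= tensor_norm alpha X Y w.
Proof.
move=> f1 g1; case: alpha => /=; first exact: inj_norm_ub.
rewrite -[leRHS]mul1r; apply: bounded_form_projective => // x y.
by rewrite mul1r /= rnormM; apply: ler_pM; rewrite ?rnorm_ge0// dual_ball.
Qed.

End ElementaryTensors.

(** * Tensor products of infinite-dimensional spaces *)

Section InfiniteTensors.
Variables (R : realType) (k : scalar_kind) (X Y : normedModType (scalars R k)).
Local Notation K := (scalars R k).
Hypotheses (hX : dimension X = +oo%E) (hY : dimension Y = +oo%E).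

Lemma rnorm_sign (I : finType) (s : {ffun I -> bool}) i :
  rnorm ((-1) ^+ s i : K^o) = 1.
Proof. by case: (s i); rewrite ?expr1 ?expr0 ?rnormN rnorm1. Qed.

(** Used with [g] the real or the imaginary part: the signs are those of [g (a i)]. *)
Lemma sign_vector (g : K -> R) (I : finType) (a : I -> K) :
  (forall z w, g (z + w) = g z + g w) -> (forall z, g (- z) = - g z) ->
  (forall z, `|g z| <= rnorm (z : K^o)) ->
  exists s : {ffun I -> bool}, \sum_i `|g (a i)| <= rnorm (\sum_i (-1) ^+ s i * a i : K^o).
Proof.
move=> gD gN gle; exists [ffun i => g (a i) < 0].
apply: (le_trans _ (gle _)); apply: (le_trans _ (ler_norm _)).
have g0 : g 0 = 0 by have := gN 0; rewrite oppr0; lra.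
rewrite (big_morph g gD g0); apply: ler_sum => i _; rewrite ffunE.
have [h|h] := ltP (g (a i)) 0.
  by rewrite expr1 mulN1r gN ltr0_norm.
by rewrite expr0 mul1r ger0_norm.
Qed.

(** In the injective norm the products [x i * y i] span copies of the finite
    [l^oo] spaces; indexing them by sign patterns, the Rademacher vectors span
    copies of the finite [l^1] spaces. *)
Lemma injective_contains_l1 : contains_l1 (tensor_norm Injective X Y) (1 / 512).
Proof.
move=> I; pose J := {ffun I -> bool}.
have [x [y [f [g [hup hD hdiag hoff]]]]] := product_system J
  (dimension_ooP hX) (dimension_ooP hY) (@norming_dual_unit_ball R k X) (@norming_dual_unit_ball R k Y).
pose W i : tensor X Y := ofR k (1 / 2) *: \sum_(s : J) (-1) ^+ s i *: etensor (x s) (y s).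
have h2 : rnorm (ofR k (1 / 2) : K^o) = 1 / 2 by rewrite rnorm_ofR.
exists W; split.
  move=> i; rewrite seminormZ h2; apply: (@le_trans _ _ (1 / 2 * 2)); last by lra.
  apply: ler_wpM2l; first by lra.
  apply: inj_norm_le => p q p1 q1; rewrite tensor_combE.
  apply: le_trans (hup p q _ _); [|by exists p|by exists q].
  apply: (le_trans (ler_rnorm_sum _ _ _)); apply: ler_sum => s _.
  by rewrite /= rnormM rnorm_sign mul1r.
move=> a; pose c (s : J) : K := \sum_i (-1) ^+ s i * a i.
have -> : \sum_i a i *: W i = ofR k (1 / 2) *: \sum_(s : J) c s *: etensor (x s) (y s).
  rewrite /W (eq_bigr (fun i => ofR k (1 / 2) *: \sum_(s : J) (a i * (-1) ^+ s i) *: etensor (x s) (y s))); last first.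
    move=> i _; rewrite scalerA mulrC -scalerA scaler_sumr; congr (_ *: _).
    by apply: eq_bigr => s _; rewrite scalerA.
  rewrite -scaler_sumr exchange_big /=; congr (_ *: _); apply: eq_bigr => s _.
  by rewrite /c scaler_suml; apply: eq_bigr => i _; rewrite mulrC.
rewrite seminormZ h2.
have [s1 hs1] := sign_vector a (@toRD R k) (@toRN R k) (@abs_toR_le R k).
have [s2 hs2] := sign_vector a (@imKD R k) (@imKN R k) (@abs_imK_le R k).
(* The largest coefficient [c t] is tested by the functionals of index [t]; it is
   at least half of the [l^1]-norm of [a], by one of the sign patterns [s1], [s2]. *)
have [t ht] : exists t : J, forall s, rnorm (c s : K^o) <= rnorm (c t : K^o).
  have [t _ ht] := @Order.TotalTheory.arg_maxP _ _ _ s1 xpredT (fun s => rnorm (c s : K^o)) isT.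
  by exists t => s; apply: ht.
have hc : \sum_i rnorm (a i : K^o) <= 2 * rnorm (c t : K^o).
  apply: (@le_trans _ _ (\sum_i (`|toR (a i)| + `|imK (a i)|))).
    by apply: ler_sum => i _; exact: rnorm_le_parts.
  by rewrite big_split /=; have := ht s1; have := ht s2; rewrite /c; lra.
have [[p p1 fE] [q q1 gE]] := hD t.
have := inj_norm_ub (\sum_(s : J) c s *: etensor (x s) (y s)) p1 q1.
rewrite tensor_combE (bigD1 t)//= => hw.
have hd := hdiag t; rewrite fE gE in hd.
have ho : rnorm (\sum_(s | s != t) c s * (p (x s) * q (y s)) : K^o) <= rnorm (c t : K^o) / 128.
  apply: (le_trans (ler_rnorm_sum _ _ _)).
  apply: (@le_trans _ _ (\sum_(s | s != t) rnorm (c t : K^o) * rnorm (p (x s) * q (y s) : K^o))).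
    by apply: ler_sum => s _; rewrite rnormM ler_wpM2r ?rnorm_ge0.
  rewrite -mulr_sumr ler_wpM2l ?rnorm_ge0//; have := hoff t; rewrite fE gE; lra.
have hdt : rnorm (c t : K^o) / 64 <= rnorm (c t * (p (x t) * q (y t)) : K^o).
  by rewrite rnormM ler_wpM2l ?rnorm_ge0//; lra.
have := rnormD (c t * (p (x t) * q (y t)) + \sum_(s | s != t) c s * (p (x s) * q (y s)) : K^o)
  (- \sum_(s | s != t) c s * (p (x s) * q (y s)) : K^o).
rewrite addrK rnormN => htri.
have hwR : rnorm (c t : K^o) / 128 <= injective_norm (\sum_(s : J) c s *: etensor (x s) (y s)).
  apply: le_trans hw; move: htri ho hdt.
  move: (c t * (p (x t) * q (y t)) : K) (\sum_(s | s != t) c s * (p (x s) * q (y s)) : K) => u v.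
  by rewrite /=; lra.
by move: hwR hc => /=; lra.
Qed.

Lemma form_sum_bilinear (I : finType) (c : I -> K) (f : I -> dual X) (g : I -> dual Y) :
  is_bilinear (fun x y => \sum_i c i * (f i x * g i y)).
Proof.
split=> [l x x' y|l x y y']; rewrite mulr_sumr -big_split; apply: eq_bigr => i _ /=;
  rewrite dual_linear /GRing.scale /=; ring.
Qed.

(** In the projective norm the elementary tensors [p i * q i] themselves span
    copies of the finite [l^1] spaces: the diagonal forms, with systems now taken
    in the duals, bound their combinations from below. *)
Lemma projective_contains_l1 : contains_l1 (tensor_norm Projective X Y) (1 / 512).
Proof.
move=> I.
have hX' n : exists f : 'I_n -> dual X, lin_indep f.
  by have [e he] := dimension_ooP hX n; exact: dual_lin_indep he.
have hY' n : exists f : 'I_n -> dual Y, lin_indep f.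
  by have [e he] := dimension_ooP hY n; exact: dual_lin_indep he.
have [x [y [f [g [hup hD hdiag hoff]]]]] := product_system I
  hX' hY' (@norming_evaluations R k X) (@norming_evaluations R k Y).
have /choice[p hp] i : exists p : X, rnorm p <= 1 /\ f i = (fun h : dual X => h p : K).
  by have [[p p1 fE] _] := hD i; exists p.
have /choice[q hq] i : exists q : Y, rnorm q <= 1 /\ g i = (fun h : dual Y => h q : K).
  by have [_ [q q1 gE]] := hD i; exists q.
exists (fun i => etensor (p i) (q i)); split.
  move=> i; apply: (le_trans (projective_norm_etensor _ _)).
  rewrite -[leRHS](mulr1 1); apply: ler_pM; rewrite ?rnorm_ge0//.
    by have [] := hp i.
  by have [] := hq i.
move=> a; pose A i j : K := x j (p i) * y j (q i).
have Ad i : 1 / 64 <= rnorm (A i i : K^o).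
  by have := hdiag i; rewrite (hp i).2 (hq i).2.
have Ao i : \sum_(j | j != i) rnorm (A i j : K^o) <= 1 / 128.
  by have := hoff i; rewrite (hp i).2 (hq i).2.
have /choice[c hc] i : exists l : K, rnorm (l : K^o) = 1 /\
    l * (a i * A i i) = ofR k (rnorm (a i * A i i : K^o)) by exact: phase.
pose B := BilinearForm (form_sum_bilinear c x y).
have hB : rnorm ((\sum_i a i *: etensor (p i) (q i)) B) <=
    2 * projective_norm (\sum_i a i *: etensor (p i) (q i)).
  apply: bounded_form_projective => // u v.
  have unitball (Z : normedModType K) (z : Z) : exists (t : R) (z' : Z),
      [/\ 0 <= t, t = rnorm z, rnorm z' <= 1 & z = ofR k t *: z'].
    have [->|z0] := eqVneq z 0; first by exists 0, 0; rewrite !rnorm0 scaler0.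
    have r0 : 0 < rnorm z by rewrite rnorm_gt0.
    exists (rnorm z), (ofR k (rnorm z)^-1 *: z); split => //; first exact: ltW.
      by rewrite rnormZ rnorm_ofR ?invr_ge0 ?(ltW r0)// mulVf// gt_eqF.
    by rewrite scalerA -ofRM mulfV ?gt_eqF// ofR1 scale1r.
  have [t [u' [t0 tE u1 uE]]] := unitball X u; have [s [v' [s0 sE v1 vE]]] := unitball Y v.
  have Du : evaluations (X := X) (fun h : dual X => h u' : K) by exists u'.
  have Dv : evaluations (X := Y) (fun h : dual Y => h v' : K) by exists v'.
  have := hup _ _ Du Dv => hs.
  rewrite -tE -sE mulrC /=.
  apply: (@le_trans _ _ (t * s * \sum_i rnorm (x i u' * y i v' : K^o))); last first.
    by rewrite ler_wpM2l// mulr_ge0.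
  apply: (le_trans (ler_rnorm_sum _ _ _)); rewrite mulr_sumr; apply: ler_sum => i _.
  rewrite uE vE !dualZ !rnormM (hc i).1 mul1r ?rnormZ !rnorm_ofR//.
  by rewrite le_eqVlt; apply/orP; left; apply/eqP; ring.
have hE : (\sum_i a i *: etensor (p i) (q i)) B = \sum_i a i * \sum_j c j * A i j.
  by rewrite tensor_combE.
have hlow : \sum_i rnorm (a i : K^o) / 128 <= rnorm (\sum_i a i * (\sum_j c j * A i j) : K^o).
  have -> : \sum_i a i * (\sum_j c j * A i j) =
      \sum_i ofR k (rnorm (a i * A i i : K^o)) + \sum_i a i * (\sum_(j | j != i) c j * A i j).
    rewrite -big_split; apply: eq_bigr => i _ /=; rewrite (bigD1 i)//= mulrDr; congr (_ + _).
    by rewrite mulrCA (hc i).2.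
  set z1 := \sum_i ofR k _; set z2 := (X in rnorm (z1 + X)%R).
  have h1 : \sum_i rnorm (a i : K^o) / 64 <= rnorm (z1 : K^o).
    apply: (le_trans _ (toR_le_rnorm _)); rewrite /z1 -ofR_sum toR_ofR; apply: ler_sum => i _.
    by rewrite rnormM ler_wpM2l ?rnorm_ge0//; have := Ad i; lra.
  have h2 : rnorm (z2 : K^o) <= \sum_i rnorm (a i : K^o) / 128.
    apply: (le_trans (ler_rnorm_sum _ _ _)); apply: ler_sum => i _.
    rewrite rnormM ler_wpM2l ?rnorm_ge0//; apply: (le_trans (ler_rnorm_sum _ _ _)).
    apply: (@le_trans _ _ (\sum_(j | j != i) rnorm (A i j : K^o))).
      by apply: ler_sum => j _; rewrite rnormM (hc j).1 mul1r.
    by have := Ao i; lra.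
  have := rnormD (z1 + z2 : K^o) (- z2 : K^o); rewrite addrK rnormN.
  by move: h1 h2; rewrite -!mulr_suml; set S := \sum_i _; lra.
move: hB hlow; rewrite hE -mulr_suml /=; set S := \sum_i rnorm _.
have S0 : 0 <= S by apply: sumr_ge0 => i _; exact: rnorm_ge0.
by move=> *; lra.
Qed.

Theorem completed_tensor_contains_l1 alpha :
  contains_l1 (@rnorm R k (completed_tensor alpha X Y)) (1 / 512).
Proof.
have h : contains_l1 (tensor_norm alpha X Y) (1 / 512).
  by case: alpha; [exact: injective_contains_l1|exact: projective_contains_l1].
move=> I; have [z [z1 hz]] := h I.
pose j := @completion_inj R k _ (tensor_norm alpha X Y).
exists (fun i => j (z i)); split; first by move=> i; rewrite /j completion_inj_norm.
move=> a; apply: (le_trans (hz a)).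
have j0 : j 0 = 0.
  by have := completion_inj_linear (tensor_norm alpha X Y) (-1) 0 0;
    rewrite scaler0 addr0 scaleN1r addNr.
have jZ l w : j (l *: w) = l *: j w.
  by have := completion_inj_linear (tensor_norm alpha X Y) l w 0; rewrite !addr0 -/j j0 addr0.
have jD v w : j (v + w) = j v + j w.
  by have := completion_inj_linear (tensor_norm alpha X Y) 1 v w; rewrite !scale1r.
rewrite -(completion_inj_norm (tensor_norm alpha X Y)) -/j (big_morph j jD j0).
by under eq_bigr do rewrite jZ.
Qed.

End InfiniteTensors.

(** * Extension of functionals and finite representability of completions *)

Section LinearMaps.
Variables (R : realType) (k : scalar_kind).
Local Notation K := (scalars R k).

Definition linear_map (E F : lmodType K) (T : E -> F) : Prop :=
  forall (l : K) x y, T (l *: x + y) = l *: T x + T y.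

Section Basics.
Variables (E F : lmodType K) (T : E -> F) (hT : linear_map T).

Lemma linear_map0 : T 0 = 0.
Proof. by have := hT (-1) 0 0; rewrite scaler0 addr0 scaleN1r addNr. Qed.

Lemma linear_mapD x y : T (x + y) = T x + T y.
Proof. by have := hT 1 x y; rewrite !scale1r. Qed.

Lemma linear_mapZ l x : T (l *: x) = l *: T x.
Proof. by have := hT l x 0; rewrite linear_map0 !addr0. Qed.

Lemma linear_mapN x : T (- x) = - T x.
Proof. by rewrite -scaleN1r linear_mapZ scaleN1r. Qed.

Lemma linear_mapB x y : T (x - y) = T x - T y.
Proof. by rewrite linear_mapD linear_mapN. Qed.

Lemma linear_map_sum (I : Type) (r : seq I) (P : pred I) (G : I -> E) :
  T (\sum_(i <- r | P i) G i) = \sum_(i <- r | P i) T (G i).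
Proof. exact: (big_morph T linear_mapD linear_map0). Qed.

Lemma linear_map_comb (I : Type) (r : seq I) (a : I -> K) (G : I -> E) :
  T (\sum_(i <- r) a i *: G i) = \sum_(i <- r) a i *: T (G i).
Proof. by rewrite linear_map_sum; apply: eq_bigr => i _; rewrite linear_mapZ. Qed.

End Basics.

Lemma completion_inj_linear_map (E : lmodType K) (N : seminorm E) :
  linear_map (completion_inj N).
Proof. exact: completion_inj_linear. Qed.

Lemma linear_on0 (E F : lmodType K) (S : set E) (T : E -> F) :
  S 0 -> linear_on S T -> T 0 = 0.
Proof.
by move=> S0 hT; have := hT (-1) 0 0 S0 S0; rewrite scaler0 addr0 scaleN1r addNr.
Qed.

Lemma lin_span0 (V : lmodType K) n (e : 'I_n -> V) : lin_span e 0.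
Proof. by exists (fun=> 0); rewrite big1// => i _; rewrite scale0r. Qed.

(** A functional on [E] dominated by a seminorm of [E'] pulled back along [j]
    extends along [j]: the infimum of [p (z - j x) + toR (f x)] over [x] is
    sublinear, and a linear functional below it restricts to [f]. *)
Lemma extend_functional (E E' : lmodType K) (j : E -> E') (p : E' -> R) (f : E -> K) :
  linear_map j -> is_seminorm p -> linear_form f ->
  (forall x, rnorm (f x : K^o) <= p (j x)) ->
  exists F : E' -> K, [/\ linear_form F, forall z, rnorm (F z : K^o) <= p z &
    forall x, F (j x) = f x].
Proof.
move=> hj hp fl fp; have [pD pZ] := hp.
have pN z : p (- z) = p z by rewrite -scaleN1r pZ (rnormN (1 : K^o)) rnorm1 mul1r.
pose A z := [set r | exists x, r = p (z - j x) + toR (f x)].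
have Alb z : lbound (A z) (- p z).
  move=> _ [x ->]; have := pD (j x - z) z; rewrite subrK.
  have := fp (- x); rewrite (linear_mapN hj) pN.
  have := toR_le_rnorm (f (- x)); rewrite linear_formN// toRN.
  by rewrite -(pN (z - j x)) opprB; lra.
have Ainf z : has_inf (A z).
  by split; [exists (p (z - j 0) + toR (f 0)); exists 0|exists (- p z)].
pose q z := inf (A z).
have qle z x : q z <= p (z - j x) + toR (f x).
  by apply: (ge_inf (Ainf z).2); exists x.
have p0 : p 0 = 0 by have := pZ 0 0; rewrite scale0r rnorm0 mul0r.
have hq : sublinear q.
  apply: sublinear_of_le.
  - apply/eqP; rewrite eq_le; apply/andP; split.
      by have := qle 0 0; rewrite (linear_map0 hj) linear_form0// subr0 p0 -(ofR0 R k) toR_ofR addr0.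
    by apply: (lb_le_inf (Ainf 0).1); have := Alb 0; rewrite p0 oppr0.
  - move=> x y; apply/ler_addgt0Pr => e e0; have e2 : 0 < e / 2 by rewrite divr_gt0.
    have [_ [s ->] hs] := inf_adherent e2 (Ainf x).
    have [_ [t ->] ht] := inf_adherent e2 (Ainf y).
    have := qle (x + y) (s + t); rewrite (linear_mapD hj) opprD addrACA linear_formD// toRD.
    have := pD (x - j s) (y - j t); move: hs ht; rewrite -/(q x) -/(q y); lra.
  - move=> t x t0; rewrite -ler_pdivrMl//; apply: (lb_le_inf (Ainf x).1) => _ [s ->].
    rewrite ler_pdivrMl//; have := qle (ofR k t *: x) (ofR k t *: s).
    by rewrite (linear_mapZ hj) -scalerBr pZ rnorm_ofR ?(ltW t0)// linear_formZ// toRM_ofR mulrDr.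
have [g [gD gZ gq _]] := hahn_banach_real 0 hq.
have [F Fl Fg] := complexify gD gZ.
have Fp : forall z, rnorm (F z : K^o) <= p z.
  apply: linear_form_le_seminorm => // z; rewrite Fg (le_trans (gq z))//.
  have := qle z 0; rewrite (linear_map0 hj) linear_form0// subr0.
  by rewrite -(ofR0 R k) toR_ofR addr0.
have gle x : g (j x) <= toR (f x).
  by rewrite (le_trans (gq _))// (le_trans (qle _ x))// subrr p0 add0r.
have gN z : g (- z) = - g z.
  by have := gZ (-1) z; rewrite ofRN ofR1 scaleN1r mulN1r.
have gf x : g (j x) = toR (f x).
  apply/eqP; rewrite eq_le gle /=; have := gle (- x).
  by rewrite (linear_mapN hj) gN linear_formN// toRN lerN2.
exists F; split => // x; apply: toR_eq => l.
by rewrite -!linear_formZ// Fg -(linear_mapZ hj) gf.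
Qed.

Lemma extend_to_completion (E : lmodType K) (N : seminorm E) (f : E -> K) (M : R) :
  0 <= M -> linear_form f -> (forall x, rnorm (f x : K^o) <= M * N x) ->
  exists F : dual (completion N), rnorm F <= M /\ forall x, F (completion_inj N x) = f x.
Proof.
move=> M0 fl fM; pose p (z : completion N) := M * rnorm z.
have hp : is_seminorm p.
  split=> [x y|l x]; last by rewrite /p rnormZ mulrCA.
  by rewrite /p -mulrDr ler_wpM2l// rnormD.
have [F [Fl Fp Fj]] := extend_functional (@completion_inj_linear_map E N) hp fl
  (fun x => eq_ind_r (fun t => _ <= M * t) (fM x) (completion_inj_norm N x)).
have [G [GF G1]] := dual_of_linear_form Fl M0 Fp.
by exists G; split => // x; rewrite GF.
Qed.

(** A basis of a finite-dimensional subspace of the completion is approximated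
    by elements of [E], and coordinates with respect to it are controlled by the norm. *)
Lemma completion_finitely_representable (E : lmodType K) (N : seminorm E) (Z : normedModType K) :
  (forall n (e : 'I_n -> E) (d : R), 0 < d -> exists T : E -> Z,
    linear_on (lin_span e) T /\ forall c : 'I_n -> K,
    `|rnorm (T (\sum_i c i *: e i)) - N (\sum_i c i *: e i)| <= d * \sum_i rnorm (c i : K^o)) ->
  finitely_representable (completion N) Z.
Proof.
move=> hT n v d d0; have [m [w [hw vw]]] := lin_span_basis v.
have [q q0 hq] := lin_indep_lower hw.
have d1 : 0 < 1 + d by lra.
pose h := q * (d / (1 + d)) / 2.
have h0 : 0 < h by rewrite divr_gt0// mulr_gt0// divr_gt0.
have /choice[e he] i : exists e, rnorm (w i - completion_inj N e) <= h.
  exact: completion_inj_dense.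
have [T [Tl hTe]] := hT m e h h0.
have /choice[c hc] x : exists c : 'I_m -> K, lin_span w x -> x = \sum_i c i *: w i.
  have [[c ->]|hx] := pselect (lin_span w x); first by exists c.
  by exists (fun=> 0).
pose S (x : completion N) := \sum_i c x i *: e i.
exists (fun x => T (S x)); split.
  move=> l x y /vw sx /vw sy.
  have clin i : c (l *: x + y) i = l * c x i + c y i.
    apply/eqP; rewrite -subr_eq0; apply/eqP.
    apply: (hw (fun i => c (l *: x + y) i - (l * c x i + c y i))).
    under eq_bigr do rewrite scalerBl scalerDl -scalerA.
    rewrite sumrB big_split /= -scaler_sumr -!hc ?subrr//.
    exact: lin_span_linear.
  rewrite -Tl; [congr T|by exists (c x)|by exists (c y)].
  rewrite /S scaler_sumr -big_split; apply: eq_bigr => i _.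
  by rewrite clin scalerDl scalerA.
move=> x /vw sx; have xE := hc _ sx.
set s := \sum_i rnorm (c x i : K^o).
have hs : q * s <= rnorm x by rewrite {1}xE; exact: hq.
have h1 := hTe (c x); rewrite -/(S x) -/s in h1.
have h2 : `|rnorm x - N (S x)| <= h * s.
  rewrite -(completion_inj_norm N) (le_trans (ler_rnorm_dist _ _))//.
  rewrite {1}xE /S (linear_map_comb (@completion_inj_linear_map E N)) -sumrB.
  rewrite /s mulr_sumr; apply: (le_trans (ler_rnorm_sum _ _ _)); apply: ler_sum => i _.
  by rewrite -scalerBr rnormZ mulrC ler_wpM2r ?rnorm_ge0.
have h3 : `|rnorm (T (S x)) - rnorm x| <= d / (1 + d) * rnorm x.
  have : 2 * (h * s) <= d / (1 + d) * rnorm x.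
    have -> : 2 * (h * s) = d / (1 + d) * (q * s) by rewrite /h; field; rewrite gt_eqF.
    by rewrite ler_wpM2l// divr_ge0 ?(ltW d0) ?(ltW d1).
  move: h1 h2; rewrite !ler_norml => /andP[? ?] /andP[? ?] ?.
  by apply/andP; split; lra.
have r0 := rnorm_ge0 x.
have dE : d / (1 + d) = 1 - (1 + d)^-1 by field; rewrite gt_eqF.
have dd : d / (1 + d) <= d by rewrite ler_pdivrMr// mulrDr mulr1 lerDl mulr_ge0 ?ltW.
move: h3; rewrite ler_norml => /andP[h3 h4]; split.
  by rewrite dE in h3; lra.
have := ler_wpM2r r0 dd; lra.
Qed.

End LinearMaps.

(** * The space [l^1] is not reflexive *)

Section L1Space.
Variables (R : realType) (k : scalar_kind).
Local Notation K := (scalars R k).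

(** The space [l^1] is the completion of the finitely supported sequences, here
    the polynomials. *)
Definition l1_norm (p : {poly K}) : R := \sum_(i < size p) rnorm (p`_i : K^o).

Lemma l1_normE (p : {poly K}) m : (size p <= m)%N ->
  l1_norm p = \sum_(i < m) rnorm (p`_i : K^o).
Proof.
move=> pm; rewrite /l1_norm (big_ord_widen m (fun i => rnorm (p`_i : K^o)) pm).
rewrite big_mkcond; apply: eq_bigr => i _; case: ltnP => // h.
by rewrite nth_default// rnorm0.
Qed.

Lemma l1_norm_seminorm : is_seminorm l1_norm.
Proof.
split=> [p q|l p].
  set m := maxn (size p) (size q).
  rewrite (@l1_normE (p + q) m) ?size_polyD// (@l1_normE p m) ?leq_maxl//.
  rewrite (@l1_normE q m) ?leq_maxr// -big_split; apply: ler_sum => i _.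
  by rewrite coefD rnormD.
rewrite (@l1_normE (l *: p) (size p)) ?size_scale_leq// mulr_sumr.
by apply: eq_bigr => i _; rewrite coefZ rnormM.
Qed.

Definition l1_seminorm := Seminorm l1_norm_seminorm.
Definition l1_space : completeNormedModType K := completion l1_seminorm.

Definition partial_sum m (p : {poly K}) : K := \sum_(i < m) p`_i.
Definition coef_sum (p : {poly K}) : K := partial_sum (size p) p.

Lemma partial_sum_linear m : linear_form (partial_sum m).
Proof.
move=> l p q; rewrite /partial_sum mulr_sumr -big_split; apply: eq_bigr => i _.
by rewrite coefD coefZ.
Qed.

Lemma coef_sumE (p : {poly K}) m : (size p <= m)%N -> coef_sum p = partial_sum m p.
Proof.
move=> pm; rewrite /coef_sum /partial_sum (big_ord_widen m (fun i => p`_i) pm).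
by rewrite big_mkcond; apply: eq_bigr => i _; case: ltnP => // h; rewrite nth_default.
Qed.

Lemma coef_sum_linear : linear_form coef_sum.
Proof.
move=> l p q; set m := maxn (size p) (size q).
rewrite (@coef_sumE _ m); last first.
  apply: (leq_trans (size_polyD _ _)); rewrite geq_max.
  by rewrite (leq_trans (size_scale_leq _ _)) ?leq_maxl// leq_maxr.
by rewrite (@coef_sumE p m) ?leq_maxl// (@coef_sumE q m) ?leq_maxr// partial_sum_linear.
Qed.

Lemma partial_sum_le m (p : {poly K}) : rnorm (partial_sum m p : K^o) <= l1_norm p.
Proof.
rewrite (@l1_normE p (maxn m (size p))) ?leq_maxr//.
rewrite /partial_sum (big_ord_widen _ (fun i => p`_i) (leq_maxl m (size p))).
apply: (le_trans (ler_rnorm_sum _ _ _)); rewrite big_mkcond; apply: ler_sum => i _.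
by case: ifP => _ //; exact: rnorm_ge0.
Qed.

(** An ultrafilter limit of the evaluations at the unit vectors is a bidual
    element which vanishes on all partial sums but is [1] on the total sum. *)
Theorem l1_space_nonreflexive : ~ reflexive_space l1_space.
Proof.
move=> hrefl; have [F [FU Foo]] := ultra_oo.
have PF : ProperFilter F by exact: ultra_proper.
pose x (n : nat) : l1_space := completion_inj l1_seminorm 'X^n.
have x1 n : rnorm (x n) = 1.
  rewrite /x completion_inj_norm /= (@l1_normE _ n.+1) ?size_polyXn// big_ord_recr /=.
  by rewrite big1 ?add0r ?coefXn ?eqxx ?rnorm1// => i _; rewrite coefXn ltn_eqF// rnorm0.
have /choice[g hg] (f : dual l1_space) : exists l : R, (fun n => toR (f (x n))) @ F --> l.
  apply: (@ultralimit_real R _ F FU _ (rnorm f)); apply: filterS filterT => n _ /=.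
  by rewrite (le_trans (abs_toR_le _))// (le_trans (dual_bound _ _))// x1 mulr1.
have gD (f f' : dual l1_space) : g (f + f') = g f + g f'.
  apply: (@cvg_unique _ _ ((fun n => toR ((f + f') (x n))) @ F)) => //; first exact: hg.
  rewrite (_ : (fun n => _) = (fun n => toR (f (x n)) + toR (f' (x n)))).
    by apply: cvgD; exact: hg.
  by apply/funext => n; rewrite -toRD.
have gZ (t : R) (f : dual l1_space) : g (ofR k t *: f) = t * g f.
  apply: (@cvg_unique _ _ ((fun n => toR ((ofR k t *: f) (x n))) @ F)) => //; first exact: hg.
  rewrite (_ : (fun n => _) = (fun n => t * toR (f (x n)))).
    by apply: cvgMl_tmp; exact: hg.
  by apply/funext => n; rewrite -toRM_ofR.
have [P Pl Pg] := complexify gD gZ.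
have gle (f : dual l1_space) : g f <= rnorm f.
  rewrite leNgt; apply/negP => h; have e0 : 0 < g f - rnorm f by lra.
  have h1 : F [set n | `|g f - toR (f (x n))| < g f - rnorm f].
    by apply: cvgr_dist_lt (hg f) _ e0.
  have [n /= hn] := filter_ex h1.
  have := dual_bound f (x n); rewrite x1 mulr1; have := toR_le_rnorm (f (x n)).
  by move: hn; rewrite ltr_norml => /andP[_ ?]; lra.
have Ple := linear_form_le_seminorm Pl (@rnorm_is_seminorm R k (dual l1_space))
  (fun f => eq_ind_r (fun z => z <= _) (gle f) (Pg f)).
have [|Phi [PhiP _]] := dual_of_linear_form Pl ler01; first by move=> f; rewrite mul1r.
have [z hz] := hrefl Phi.
have bnd (f : {poly K} -> K) : (forall p, rnorm (f p : K^o) <= l1_norm p) ->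
    forall p, rnorm (f p : K^o) <= 1 * l1_seminorm p by move=> h p; rewrite mul1r.
have sle p : rnorm (coef_sum p : K^o) <= l1_norm p by exact: partial_sum_le.
have [s [s1 sE]] := extend_to_completion ler01 coef_sum_linear (bnd _ sle).
have /choice[t ht] m : exists t : dual l1_space, rnorm t <= 1 /\
    forall p, t (completion_inj l1_seminorm p) = partial_sum m p.
  exact: (extend_to_completion ler01 (@partial_sum_linear m) (bnd _ (@partial_sum_le m))).
have limE (f : dual l1_space) (l : R) : F [set n | toR (f (x n)) = l] -> toR (f z) = l.
  move=> h; rewrite -hz PhiP Pg.
  apply: (@cvg_unique _ _ ((fun n => toR (f (x n))) @ F)) => //; first exact: hg.
  apply: (cvg_trans (near_eq_cvg _) (cvg_cst l)); first exact: (filterS _ h).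
have s_z : toR (s z) = 1.
  apply: limE; apply: filterS filterT => n _ /=; rewrite /x sE.
  rewrite (@coef_sumE _ n.+1) ?size_polyXn// /partial_sum big_ord_recr /= big1 ?add0r.
    by rewrite coefXn eqxx -(ofR1 R k) toR_ofR.
  by move=> i _; rewrite coefXn ltn_eqF.
have t_z m : toR (t m z) = 0.
  apply: limE; apply: Foo; exists m => // n /= mn; rewrite /x (ht m).2.
  rewrite /partial_sum big1 => [|i _]; first by rewrite -(ofR0 R k) toR_ofR.
  by rewrite coefXn ltn_eqF// (leq_trans (ltn_ord i)).
have q0 : 0 < (1 / 4 : R) by lra.
have [p hp] := completion_inj_dense z q0.
have h1 := dual_ball (z - completion_inj l1_seminorm p) s1.
have h2 := dual_ball (z - completion_inj l1_seminorm p) (ht (size p)).1.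
have := abs_toR_le (s (z - completion_inj l1_seminorm p)).
have := abs_toR_le (t (size p) (z - completion_inj l1_seminorm p)).
rewrite !(linear_formB _ _ (dual_linear_form _)) !toRD !toRN s_z t_z (ht (size p)).2 sE.
rewrite -/(coef_sum p) !ler_norml => /andP[? ?] /andP[? ?].
rewrite !(linear_formB _ _ (dual_linear_form _)) (ht (size p)).2 sE in h1 h2.
by rewrite /coef_sum in h1 *; lra.
Qed.

(** A finite family of polynomials has bounded degree, so it lives in a
    finite-dimensional [l^1], and by James's theorem [Z] contains almost isometric
    copies of that space. *)
Lemma l1_space_finitely_representable (Z : normedModType K) (c : R) :
  0 < c -> contains_l1 (@rnorm R k Z) c -> finitely_representable l1_space Z.
Proof.
move=> c0 hZ; apply: completion_finitely_representable => n e d d0.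
pose m := \max_i size (e i).
pose M := 1 + \sum_i l1_norm (e i).
have Ne0 p : 0 <= l1_norm p by apply: sumr_ge0 => i _; exact: rnorm_ge0.
have M0 : 0 < M.
  by rewrite /M; apply: ltr_pwDl => //; apply: sumr_ge0 => i _; exact: Ne0.
have dM : 0 < d / M by rewrite divr_gt0.
have dM1 : 1 - d / M < 1 by lra.
have [z [z1 hz]] := james_distortion (@rnorm_is_seminorm R k Z) c0 hZ dM1 'I_m.
exists (fun p : {poly K} => \sum_(i < m) p`_i *: z i); split.
  move=> l p q _ _; rewrite scaler_sumr -big_split; apply: eq_bigr => i _.
  by rewrite coefD coefZ scalerDl scalerA.
move=> a; set p : {poly K} := \sum_i a i *: e i.
have pm : (size p <= m)%N.
  apply: (big_ind (fun q : {poly K} => size q <= m)%N).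
  - by rewrite size_poly0.
  - by move=> q r hq hr; rewrite (leq_trans (size_polyD _ _))// geq_max hq hr.
  - by move=> i _; rewrite (leq_trans (size_scale_leq _ _))// /m (leq_bigmax i).
have pE : l1_norm p = \sum_(i < m) rnorm (p`_i : K^o) by exact: l1_normE.
have up : rnorm (\sum_(i < m) p`_i *: z i) <= l1_norm p.
  apply: (le_trans (rnorm_comb_le _ _)); rewrite pE; apply: ler_sum => i _.
  by rewrite -[leRHS]mulr1 ler_wpM2l ?rnorm_ge0.
have low := hz (fun i => p`_i); rewrite -pE in low.
have pM : l1_norm p <= M * \sum_i rnorm (a i : K^o).
  have -> : l1_norm p = l1_seminorm p by [].
  have sumle (r : seq 'I_n) : l1_seminorm (\sum_(i <- r) a i *: e i) <=
      \sum_(i <- r) rnorm (a i : K^o) * l1_norm (e i).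
    elim: r => [|i r ih]; first by rewrite !big_nil seminorm0.
    rewrite !big_cons (le_trans (seminormD _ _ _))// seminormZ; exact: lerD.
  apply: (le_trans (sumle _)); rewrite mulr_sumr; apply: ler_sum => i _.
  rewrite mulrC ler_wpM2r ?rnorm_ge0// /M (bigD1 i)//= addrCA lerDl addr_ge0//.
  by apply: sumr_ge0 => j _.
have : d / M * l1_norm p <= d * \sum_i rnorm (a i : K^o).
  by rewrite mulrAC -mulrA ler_pM2l// ler_pdivrMr// mulrC.
by move: up low; rewrite /= ler_norml => ? ? ?; apply/andP; split; lra.
Qed.

Theorem superreflexive_no_l1 (Z : normedModType K) (c : R) :
  0 < c -> contains_l1 (@rnorm R k Z) c -> ~ superreflexive Z.
Proof.
move=> c0 hZ hs; apply: l1_space_nonreflexive; apply: hs.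
exact: l1_space_finitely_representable hZ.
Qed.

End L1Space.

(** * Reflexivity from finitely many components *)

Section ReflexiveComponents.
Variables (R : realType) (k : scalar_kind).
Local Notation K := (scalars R k).

Lemma harmonic_lt (e : R) : 0 < e ->
  exists n0 : nat, forall m, (n0 <= m)%N -> (m.+1%:R^-1 : R) < e.
Proof.
move=> e0; have [n0 _ h] : \forall m \near \oo, `|0 - (m.+1%:R^-1 : R)| < e.
  by apply: cvgr_dist_lt (@cvg_harmonic R) _ e0.
exists n0 => m nm; have := h m nm.
by rewrite /= sub0r normrN gtr0_norm// invr_gt0.
Qed.

Lemma complete_rnorm (W : completeNormedModType K) (u : nat -> W) :
  (forall e : R, 0 < e -> exists n0 : nat, forall m n, (n0 <= m)%N -> (n0 <= n)%N ->
    rnorm (u m - u n) < e) ->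
  exists w, forall e : R, 0 < e -> exists n0 : nat, forall n, (n0 <= n)%N ->
    rnorm (w - u n) < e.
Proof.
move=> hu.
have : cvg (u @ \oo).
  apply/cauchy_cvgP/cauchyP => e e0.
  have eE : e = ofR k (toR e) by rewrite toRK// ltW.
  have e0' : 0 < toR e by move: e0; rewrite eE -{1}(ofR0 R k) ofR_lt -eE.
  have [n0 h] := hu _ e0'; exists (u n0); exists n0 => // n /= n0n.
  by rewrite -ball_normE /= rnormE eE ofR_lt h.
move=> /cvg_ex[w uw]; exists w => e e0.
have e0' : 0 < ofR k e by rewrite -(ofR0 R k) ofR_lt.
have [n0 _ h] : \forall n \near \oo, `|w - u n| < ofR k e by apply: cvgr_dist_lt uw _ e0'.
by exists n0 => n n0n; have := h n n0n; rewrite /= rnormE ofR_lt.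
Qed.

Section Components.
Variables (W : completeNormedModType K) (n : nat) (N : 'I_n -> seminorm W) (C : R).
Hypotheses (C0 : 0 <= C) (NC : forall l w, N l w <= C * rnorm w).
Hypothesis (CN : forall w, rnorm w <= C * \sum_l N l w).
Hypothesis (Nrefl : forall l, reflexive_space (completion (N l))).

Local Notation E := ('I_n -> W).
Let j l := completion_inj (N l).
Let diag (w : W) : E := fun=> w.
Let unit_at l (w : W) : E := fun l' => if l' == l then w else 0.
Let p (e : E) : R := \sum_l N l (e l).

Let p_seminorm : is_seminorm p.
Proof.
split=> [x y|a x]; first by rewrite /p -big_split; apply: ler_sum => l _; exact: seminormD.
by rewrite /p mulr_sumr; apply: eq_bigr => l _; exact: seminormZ.
Qed.

Let unit_at_linear l : linear_map (unit_at l).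
Proof.
move=> a x y; apply/funext => i; rewrite /unit_at !fctE; case: eqP => // _.
by rewrite scaler0 addr0.
Qed.

Let p_unit_at l w : p (unit_at l w) = N l w.
Proof.
rewrite /p (bigD1 l)//= /unit_at eqxx big1 ?addr0// => i /negbTE ->.
exact: seminorm0.
Qed.

Let sum_unit_at (e : E) : e = \sum_l unit_at l (e l).
Proof.
apply/funext => i; rewrite fct_sumE (bigD1 i)//= /unit_at eqxx big1 ?addr0//.
by move=> l li; rewrite eq_sym (negbTE li).
Qed.

Let split_functional (F : E -> K) (M : R) : 0 <= M -> linear_form F ->
  (forall e, rnorm (F e : K^o) <= M * p e) ->
  exists h : forall l, dual (completion (N l)),
    (forall l, rnorm (h l) <= M) /\ forall e, F e = \sum_l h l (j l (e l)).
Proof.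
move=> M0 Fl FM.
have ex l : exists h : dual (completion (N l)), rnorm h <= M /\
    forall w, h (j l w) = F (unit_at l w).
  apply: extend_to_completion => //.
    by move=> a x y; rewrite unit_at_linear Fl.
  by move=> w; rewrite -p_unit_at.
exists (fun l => sval (cid (ex l))); split.
  by move=> l; case: (cid (ex l)) => h /= [].
move=> e; rewrite [in LHS](sum_unit_at e) linear_form_sum//; apply: eq_bigr => l _.
by case: (cid (ex l)) => h /= [_ ->].
Qed.

Let pull_back : exists pb : forall l, dual (completion (N l)) -> dual W,
  forall l g w, pb l g w = g (j l w).
Proof.
have ex l (g : dual (completion (N l))) : exists f : dual W, forall w, f w = g (j l w).
  have [|||f [hf _]] := @dual_of_linear_form R k W (fun w => g (j l w) : K) (rnorm g * C).
  - by move=> a x y; rewrite /j completion_inj_linear dual_linear.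
  - by rewrite mulr_ge0// rnorm_ge0.
  - move=> w; apply: (le_trans (dual_bound _ _)); rewrite -mulrA ler_wpM2l ?rnorm_ge0//.
    by rewrite completion_inj_norm.
  by exists f.
by exists (fun l g => sval (cid (ex l g))) => l g w; case: (cid (ex l g)).
Qed.

Lemma dual_sum_eval (X : normedModType K) (I : Type) (r : seq I) (f : I -> dual X) x :
  (\sum_(i <- r) f i) x = \sum_(i <- r) (f i x : K).
Proof. exact: (big_morph (fun g : dual X => (g x : K))). Qed.

Lemma dual_ext (X : normedModType K) (f g : dual X) : (forall x, f x = g x) -> f = g.
Proof. by move=> h; apply: val_inj; apply/funext. Qed.

(** A bidual element of [W] induces one on each component, hence a point of each
    component.  By Hahn-Banach these points are simultaneously approximated by
    one vector of [W], and completeness gives the vector representing it. *)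
Lemma reflexive_of_components : reflexive_space W.
Proof.
move=> Phi; have [pb pbE] := pull_back.
have pb_lin l : linear_map (pb l).
  by move=> a x y; apply: dual_ext => w; rewrite pbE /= !fctE !pbE.
have ex l : exists v, forall g : dual (completion (N l)), g v = Phi (pb l g).
  have [|||Phil [hPhil _]] := @dual_of_linear_form R k (dual (completion (N l)))
    (fun g => Phi (pb l g) : K) (rnorm Phi * C).
  - by move=> a x y; rewrite pb_lin dual_linear.
  - by rewrite mulr_ge0// rnorm_ge0.
  - move=> g; apply: (le_trans (dual_bound _ _)); rewrite -mulrA ler_wpM2l ?rnorm_ge0//.
    rewrite (rnorm_dual (pb l g)); apply: op_norm_le => w w1; rewrite pbE.
    apply: (le_trans (dual_bound _ _)); rewrite mulrC ler_wpM2r ?rnorm_ge0//.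
    rewrite completion_inj_norm (le_trans (NC _ _))// -[leRHS]mulr1.
    by rewrite ler_wpM2l.
  by have [v hv] := Nrefl Phil; exists v => g; rewrite -hPhil hv.
pose v l := sval (cid (ex l)).
have vE l (g : dual (completion (N l))) : g (v l) = Phi (pb l g).
  by rewrite /v; case: (cid (ex l)).
have PhiSum (h : forall l, dual (completion (N l))) :
    \sum_l (h l (v l) : K) = Phi (\sum_l pb l (h l)).
  rewrite (linear_form_sum _ _ _ (dual_linear_form Phi)).
  by apply: eq_bigr => l _; rewrite vE.
have approx (e : R) : 0 < e -> exists w, \sum_l rnorm (v l - j l w) < e.
  move=> e0; apply: contrapT => hn.
  have {}hn w : e <= \sum_l rnorm (v l - j l w).
    by rewrite leNgt; apply/negP => h; apply: hn; exists w.
  pose d := e / (4 * n.+1%:R).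
  have d0 : 0 < d by rewrite divr_gt0// mulr_gt0// ltr0Sn.
  have nd : \sum_(l < n) d <= e / 4.
    have -> : \sum_(l < n) d = d * n%:R by rewrite sumr_const card_ord mulr_natr.
    apply: (@le_trans _ _ (d * n.+1%:R)); first by rewrite ler_pM2l// ler_nat.
    by rewrite /d invfM mulrA mulfVK// pnatr_eq0.
  have /choice[a ha] l : exists a, rnorm (v l - j l a) <= d by exact: completion_inj_dense.
  have hav : \sum_l rnorm (v l - j l (a l)) <= e / 4.
    by apply: le_trans nd; apply: ler_sum.
  pose S := [set x : E | exists w, x = diag w].
  have S0 : S 0 by exists 0.
  have Sl (l : K) x y : S x -> S y -> S (l *: x + y).
    by move=> [w ->] [w' ->]; exists (l *: w + w').
  have Sc s : S s -> 3 / 4 * e <= p (a - s).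
    move=> [w ->]; have : e <= p (a - diag w) + \sum_l rnorm (v l - j l (a l)).
      apply: (le_trans (hn w)); rewrite /p -big_split; apply: ler_sum => l _ /=.
      have -> : N l ((a - diag w) l) = rnorm (j l (a l) - j l w).
        by rewrite /j -(linear_mapB (@completion_inj_linear_map _ _ _ _)) completion_inj_norm.
      rewrite addrC; apply: le_trans (rnormD _ _).
      by rewrite addrA subrK.
    by lra.
  have [f [fl fp fS fa]] := separate_subspace p_seminorm S0 Sl Sc.
  have [|h [h1 hf]] := split_functional ler01 fl; first by move=> x; rewrite mul1r.
  have h0 : \sum_l (h l (v l) : K) = 0.
    rewrite PhiSum (_ : \sum_l pb l (h l) = 0) ?dual0//.
    apply: dual_ext => w; rewrite dual_sum_eval; under eq_bigr do rewrite pbE.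
    by rewrite -(hf (diag w)) fS//; exists w.
  have : toR (f a) <= e / 4.
    have -> : f a = \sum_l (h l (j l (a l)) - h l (v l) : K).
      by rewrite sumrB h0 subr0 hf.
    apply: (le_trans (toR_le_rnorm _)); apply: le_trans hav.
    apply: (le_trans (ler_rnorm_sum _ _ _)); apply: ler_sum => l _.
    rewrite -(linear_formB _ _ (dual_linear_form (h l))) rnorm_distC.
    exact: dual_ball.
  by lra.
have r0 (m : nat) : 0 < (m.+1%:R^-1 : R) by rewrite invr_gt0.
have /choice[u hu] (m : nat) : exists w, \sum_l rnorm (v l - j l w) < m.+1%:R^-1.
  exact: approx.
have Ndist l x y : N l (x - y) <= rnorm (v l - j l x) + rnorm (v l - j l y).
  rewrite -(completion_inj_norm (N l)) (linear_mapB (@completion_inj_linear_map _ _ _ _)).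
  rewrite (rnorm_distC (v l) (j l x)); apply: le_trans (rnormD _ _).
  by rewrite addrA subrK.
have C1 : 0 < 2 * (C + 1) by rewrite mulr_gt0// ltr_wpDl.
(* The approximants [u m] are Cauchy because the components control the norm. *)
have [w hw] : exists w, forall e : R, 0 < e -> exists n0 : nat, forall m, (n0 <= m)%N ->
    rnorm (w - u m) < e.
  apply: complete_rnorm => e e0; have [n0 hn0] := harmonic_lt (divr_gt0 e0 C1).
  exists n0 => m m' hm hm'.
  have a1 := lt_trans (hu m) (hn0 _ hm); have a2 := lt_trans (hu m') (hn0 _ hm').
  have a3 : \sum_l N l (u m - u m') <=
      \sum_l rnorm (v l - j l (u m)) + \sum_l rnorm (v l - j l (u m')).
    by rewrite -big_split; apply: ler_sum => l _; exact: Ndist.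
  apply: (le_lt_trans (CN _)); apply: (@le_lt_trans _ _ (C * (2 * (e / (2 * (C + 1)))))).
    by apply: ler_wpM2l => //; lra.
  rewrite (_ : C * _ = e * (C / (C + 1))); last by field; rewrite gt_eqF// ltr_wpDl.
  by rewrite gtr_pMr// ltr_pdivrMr ?ltr_wpDl// mul1r ltrDl.
have vw l : v l = j l w.
  apply/eqP; rewrite -subr_eq0; apply/eqP; apply: rnorm0_eq0; apply/eqP.
  rewrite eq_le rnorm_ge0 andbT; suff h (e : R) : 0 < e -> rnorm (v l - j l w) <= e.
    by apply/ler_addgt0Pr => e e0; rewrite add0r h.
  move=> e0; have e2 : 0 < e / 2 by rewrite divr_gt0.
  have [n0 hn0] := harmonic_lt e2.
  have C1' : 0 < C + 1 by rewrite ltr_wpDl.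
  have [n1 hn1] := hw _ (divr_gt0 e2 C1').
  set m := maxn n0 n1.
  have b1 : rnorm (v l - j l (u m)) <= e / 2.
    apply: ltW; apply: le_lt_trans (lt_trans (hu m) (hn0 _ (leq_maxl _ _))).
    by rewrite (bigD1 l)//= lerDl; apply: sumr_ge0 => i _; exact: rnorm_ge0.
  have b2 : rnorm (j l (u m) - j l w) <= e / 2.
    rewrite -(linear_mapB (@completion_inj_linear_map _ _ _ _)) completion_inj_norm.
    apply: (le_trans (NC _ _)); rewrite rnorm_distC.
    apply: (le_trans (ler_wpM2l C0 (ltW (hn1 m (leq_maxr _ _))))).
    by rewrite mulrCA ger_pMr// ler_pdivrMr// mul1r lerDl.
  have := rnormD (v l - j l (u m)) (j l (u m) - j l w); rewrite addrA subrK; lra.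
exists w => f.
have [F [Fl Fp Fj]] : exists F : E -> K, [/\ linear_form F,
    forall z, rnorm (F z : K^o) <= rnorm f * C * p z & forall x, F (diag x) = f x].
  apply: extend_functional => //; [|exact: dual_linear_form|].
    split=> [x y|a x]; last by rewrite p_seminorm.2 mulrCA.
    by rewrite -mulrDr ler_wpM2l ?mulr_ge0 ?rnorm_ge0// p_seminorm.1.
  move=> x; apply: (le_trans (dual_bound _ _)); rewrite -[leRHS]mulrA.
  by apply: ler_wpM2l; [exact: rnorm_ge0|exact: CN].
have [|h [_ hF]] := split_functional _ Fl Fp; first by rewrite mulr_ge0// rnorm_ge0.
have -> : f = \sum_l pb l (h l).
  apply: dual_ext => x; rewrite dual_sum_eval -Fj hF.
  by apply: eq_bigr => l _; rewrite pbE.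
rewrite -PhiSum dual_sum_eval; apply: eq_bigr => l _.
by rewrite pbE vw.
Qed.

End Components.

End ReflexiveComponents.

(** * Superreflexivity of subspaces of finite powers *)

Section SuperreflexiveEmbedding.
Variables (R : realType) (k : scalar_kind).
Local Notation K := (scalars R k).

Lemma lin_span_mem (V : lmodType K) (s : seq V) x : x \in s ->
  lin_span (fun i : 'I_(size s) => s`_i) x.
Proof.
move=> xs; have h : (index x s < size s)%N by rewrite index_mem.
exists (fun i => (i == Ordinal h)%:R).
rewrite (bigD1 (Ordinal h))//= eqxx scale1r nth_index// big1 ?addr0//.
by move=> i /negbTE ->; rewrite scale0r.
Qed.

Lemma lin_span_comb (V : lmodType K) n (e : 'I_n -> V) m (c : 'I_m -> K) (w : 'I_m -> V) :
  (forall i, lin_span e (w i)) -> lin_span e (\sum_i c i *: w i).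
Proof.
move=> h; elim/big_ind : _ => [|x y hx hy|i _]; first exact: lin_span0.
  by rewrite -[x]scale1r; exact: lin_span_linear.
by rewrite -[_ *: _]addr0; apply: lin_span_linear => //; exact: lin_span0.
Qed.

(** Finite subsets are encoded by sequences, ordered by inclusion. *)
Lemma ultra_finite_subsets (W : choiceType) : exists F : set_system (seq W),
  UltraFilter F /\ forall w : W, F [set s : seq W | w \in s].
Proof.
pose B (t : seq W) := [set s : seq W | {subset t <= s}].
have FB : ProperFilter (filter_from setT B).
  apply: filter_from_proper; last by move=> t _; exists t.
  apply: filter_from_filter; first by exists [::].
  move=> s t _ _; exists (s ++ t) => // u h; split=> x xs; apply: h;
    by rewrite mem_cat xs ?orbT.
have [F [FU BF]] := ultraFilterLemma FB; exists F; split => // w.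
by apply: BF; exists [:: w] => // s; apply; rewrite inE.
Qed.

(** The maps of finite parts of [W] into [V], composed with the coordinate maps
    [P l], give seminorms of [W] in the limit along finite subsets; the completions
    for these seminorms are finitely representable in [Y], and together the
    seminorms control the norm of [W]. *)
Theorem superreflexive_embedding (V Y : normedModType K) n (P : 'I_n -> V -> Y) (C : R) :
  0 <= C -> (forall l, linear_map (P l)) -> (forall l v, rnorm (P l v) <= C * rnorm v) ->
  (forall v, rnorm v <= C * \sum_l rnorm (P l v)) ->
  superreflexive Y -> superreflexive V.
Proof.
move=> C0 Pl PC CP hY W hW.
have [F [FU Fin]] := ultra_finite_subsets W.
have PF : ProperFilter F by exact: ultra_proper.
have /choice[T hT] (s : seq W) : exists T : W -> V,
    linear_on (lin_span (fun i : 'I_(size s) => s`_i)) T /\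
    forall w, lin_span (fun i : 'I_(size s) => s`_i) w ->
      rnorm w <= 2 * rnorm (T w) /\ rnorm (T w) <= 2 * rnorm w.
  have [T [Tl h]] := hW _ (fun i : 'I_(size s) => s`_i) 1 ltr01.
  exists T; split => // w /h; rewrite (_ : 1 + 1 = 2 :> R); last by lra.
  by move=> [h1 h2]; split => //; lra.
have Tlin s (l : K) x y : x \in s -> y \in s -> T s (l *: x + y) = l *: T s x + T s y.
  by move=> xs ys; rewrite (hT s).1//; exact: lin_span_mem.
have PT l s x : lin_span (fun i : 'I_(size s) => s`_i) x ->
    rnorm (P l (T s x)) <= 2 * C * rnorm x.
  move=> /(hT s).2[_ h]; apply: (le_trans (PC _ _)).
  by have := ler_wpM2l C0 h; lra.
have ex l w : exists r : R, (fun s => rnorm (P l (T s w))) @ F --> r.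
  apply: (@ultralimit_real R _ F FU _ (2 * C * rnorm w)).
  apply: filterS (Fin w) => s /= ws; rewrite ger0_norm ?rnorm_ge0//.
  exact/PT/lin_span_mem.
pose N l w := sval (cid (ex l w)).
have NE l w : (fun s => rnorm (P l (T s w))) @ F --> N l w.
  by rewrite /N; case: (cid (ex l w)).
have lim_le (a b : seq W -> R) (x y : R) : a @ F --> x -> b @ F --> y ->
    F [set s | a s <= b s] -> x <= y.
  move=> ax bY ab; rewrite leNgt; apply/negP => yx.
  have e0 : 0 < (x - y) / 2 by lra.
  have Fa : F [set s | `|x - a s| < (x - y) / 2] by apply: cvgr_dist_lt ax _ e0.
  have Fb : F [set s | `|y - b s| < (x - y) / 2] by apply: cvgr_dist_lt bY _ e0.
  have [s [/= [hs ht]]] := filter_ex (filterI (filterI Fa Fb) ab).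
  by move: hs ht; rewrite !ltr_norml => /andP[? ?] /andP[? ?] ?; lra.
have T0 s : T s 0 = 0.
  by apply: linear_on0 (hT s).1; exact: lin_span0.
have Nsem l : is_seminorm (N l).
  apply: seminorm_of_le.
  - move=> x; apply: lim_le (NE l x) _; first exact: (cvg_cst (0 : R)).
    by apply: filterS filterT => s _ /=; exact: rnorm_ge0.
  - move=> x y; apply: lim_le (NE l (x + y)) (cvgD (NE l x) (NE l y)) _.
    apply: filterS (filterI (Fin x) (Fin y)) => s /= [xs ys].
    have := Tlin s 1 x y xs ys; rewrite !scale1r => ->.
    by rewrite (linear_mapD (Pl l)) rnormD.
  - move=> a x.
    have h : (fun s => rnorm (a : K^o) * rnorm (P l (T s x))) @ F --> rnorm (a : K^o) * N l x.
      by apply: cvgMl_tmp; exact: NE.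
    apply: lim_le (NE l (a *: x)) h _.
    apply: filterS (filterI (Fin x) (Fin 0)) => s /= [xs os].
    have := Tlin s a x 0 xs os; rewrite T0 !addr0 => ->.
    by rewrite (linear_mapZ (Pl l)) rnormZ.
have NC l w : N l w <= 2 * C * rnorm w.
  apply: lim_le (NE l w) (cvg_cst _) _; apply: filterS (Fin w) => s /= ws.
  exact/PT/lin_span_mem.
have CN w : rnorm w <= 2 * C * \sum_l N l w.
  have h : (fun s => 2 * C * \sum_l rnorm (P l (T s w))) @ F --> 2 * C * \sum_l N l w.
    by apply: cvgMl_tmp; apply: cvg_sum_seq => l; exact: NE.
  apply: lim_le (cvg_cst _) h _; apply: filterS (Fin w) => s /= ws.
  have [h1 _] := (hT s).2 _ (lin_span_mem ws); apply: (le_trans h1).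
  by rewrite -mulrA ler_wpM2l.
apply: (@reflexive_of_components R k W n (fun l => Seminorm (Nsem l)) (2 * C)) => //.
  by rewrite mulr_ge0.
move=> l; apply: hY; apply: completion_finitely_representable => m e d d0.
(* If no finite subset gave the required accuracy, then bad coefficient vectors of
   [l^1]-norm one would have an ultralimit [b], and convergence would fail at the
   combination with coefficients [b]. *)
apply: contrapT => hn.
have /choice[c hc] (s : seq W) : exists c : 'I_m -> K, (forall i, e i \in s) ->
    \sum_i rnorm (c i : K^o) = 1 /\
    d < `|rnorm (P l (T s (\sum_i c i *: e i))) - N l (\sum_i c i *: e i)|.
  have [es|es] := pselect (forall i, e i \in s); last by exists (fun=> 0).
  have span_s x : lin_span e x -> lin_span (fun i : 'I_(size s) => s`_i) x.
    by move=> [c ->]; apply: lin_span_comb => i; exact: lin_span_mem.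
  have [c hc] : exists c : 'I_m -> K, d * \sum_i rnorm (c i : K^o) <
      `|rnorm (P l (T s (\sum_i c i *: e i))) - N l (\sum_i c i *: e i)|.
    apply: contrapT => h; apply: hn; exists (fun x => P l (T s x)); split.
      by move=> a x y /span_s xs /span_s ys; rewrite (hT s).1// (Pl l).
    by move=> c; rewrite leNgt; apply/negP => h'; apply: h; exists c.
  set S := \sum_i rnorm (c i : K^o) in hc.
  have S0' : 0 <= S by apply: sumr_ge0 => i _; exact: rnorm_ge0.
  have S0 : 0 < S.
    rewrite lt_neqAle S0' andbT; apply/eqP => S0.
    have c0 i : c i = 0.
      apply: (@rnorm0_eq0 R k K^o); apply/eqP; rewrite eq_le rnorm_ge0 andbT S0.
      by rewrite /S (bigD1 i)//= lerDl; apply: sumr_ge0 => i' _; exact: rnorm_ge0.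
    move: hc; rewrite big1 => [|i _]; last by rewrite c0 scale0r.
    rewrite T0 (linear_map0 (Pl l)) rnorm0 -S0 mulr0.
    have -> : N l 0 = 0 := seminorm0 (Seminorm (Nsem l)).
    by rewrite subr0 normr0 ltxx.
  have rS : rnorm (ofR k S^-1 : K^o) = S^-1 by rewrite rnorm_ofR// invr_ge0 ltW.
  exists (fun i => ofR k S^-1 * c i) => _; split.
    under eq_bigr do rewrite rnormM rS.
    by rewrite -mulr_sumr mulVf// gt_eqF.
  under eq_bigr do rewrite -scalerA.
  rewrite -scaler_sumr; set x := \sum_i c i *: e i.
  have xs : lin_span (fun i : 'I_(size s) => s`_i) x by apply: span_s; exists c.
  have -> : T s (ofR k S^-1 *: x) = ofR k S^-1 *: T s x.
    have := (hT s).1 (ofR k S^-1) x 0 xs (lin_span0 _).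
    by rewrite T0 !addr0.
  rewrite (linear_mapZ (Pl l)) rnormZ (Nsem l).2 rS -mulrBr normrM gtr0_norm ?invr_gt0//.
  by rewrite ltr_pdivlMl// mulrC.
have Fe : F [set s : seq W | forall i, e i \in s].
  by apply: filter_forall => i; exact: Fin.
have /choice[b hb] i : exists bi : K,
    (fun s => rnorm (c s i - bi : K^o)) @ F --> (0 : R).
  apply: (@ultralimit_scalar R k _ F FU (fun s => c s i) 1).
  apply: filterS Fe => s /= /(hc s)[c1 _]; rewrite -c1 (bigD1 i)//= lerDl.
  by apply: sumr_ge0 => i' _; exact: rnorm_ge0.
pose D s : R := \sum_i rnorm (c s i - b i : K^o) * rnorm (e i).
have hD : D @ F --> (0 : R) := lim_comb PF (fun i => rnorm (e i)) hb.
pose x := \sum_i b i *: e i.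
have C1 : 0 < 8 * (C + 1) by rewrite mulr_gt0// ltr_wpDl.
have F1 : F [set s | `|0 - D s| < d / (8 * (C + 1))].
  by apply: cvgr_dist_lt hD _ (divr_gt0 d0 C1).
have d4 : 0 < d / 4 by rewrite divr_gt0.
have F2 : F [set s | `|N l x - rnorm (P l (T s x))| < d / 4].
  by apply: cvgr_dist_lt (NE l x) _ d4.
have [s [/= [hs1 hs2] es]] := filter_ex (filterI (filterI F1 F2) Fe).
have [_ hd] := hc s es; set y := \sum_i _ in hd.
have yx : rnorm (y - x) <= D s.
  rewrite /y /x -sumrB; under eq_bigr do rewrite -scalerBl.
  exact: rnorm_comb_le.
have D0 : 0 <= D s by apply: sumr_ge0 => i _; rewrite mulr_ge0// rnorm_ge0.
rewrite sub0r normrN ger0_norm// ltr_pdivlMr// in hs1.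
have k1 : 2 * C * rnorm (y - x) <= d / 4.
  have := ler_wpM2l C0 yx; lra.
have span_comb (a : 'I_m -> K) : lin_span (fun i : 'I_(size s) => s`_i) (\sum_i a i *: e i).
  by apply: lin_span_comb => i; exact: lin_span_mem.
have k2 : `|rnorm (P l (T s y)) - rnorm (P l (T s x))| <= d / 4.
  apply: (le_trans (ler_rnorm_dist _ _)); rewrite -(linear_mapB (Pl l)).
  have -> : T s y - T s x = T s (y - x).
    have := (hT s).1 (-1) x y (span_comb b) (span_comb (c s)).
    by rewrite !scaleN1r addrC [RHS]addrC => ->.
  apply: le_trans (PT _ _ _ _) k1.
  rewrite addrC -scaleN1r; apply: lin_span_linear; exact: span_comb.
have k3 : `|N l y - N l x| <= d / 4.
  exact: le_trans (seminormB (Seminorm (Nsem l)) _ _) (le_trans (NC _ _) k1).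
move: hd k2 k3 hs2; rewrite ltNge => /negP hd; rewrite !ler_norml ltr_norml.
move=> /andP[? ?] /andP[? ?] /andP[? ?]; apply: hd.
by rewrite ler_norml; apply/andP; split; lra.
Qed.

End SuperreflexiveEmbedding.

(** * The von Neumann-Jordan constant and its envelope *)

Section VonNeumannJordan.
Variables (R : realType) (k : scalar_kind).
Local Notation K := (scalars R k).

Section Constant.
Variables (E : lmodType K) (N : E -> R).
Hypothesis hN : is_norm N.

Let NS : is_seminorm N. Proof. by case: hN. Qed.
Let N0 : N 0 = 0. Proof. exact: (seminorm0 (Seminorm NS)). Qed.
Let Nge0 x : 0 <= N x. Proof. exact: (seminorm_ge0 (Seminorm NS)). Qed.
Let Ngt0 x : x != 0 -> 0 < N x.
Proof.
move=> x0; rewrite lt_neqAle Nge0 andbT eq_sym; apply: contra x0 => /eqP h.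
by rewrite (hN.2 x h).
Qed.

Let denominator_gt0 (x y : E) : (x, y) != (0, 0) -> 0 < 2 * (N x ^+ 2 + N y ^+ 2).
Proof.
rewrite xpair_eqE negb_and => /orP[h|h]; have h0 := Ngt0 h.
  by have := sqr_ge0 (N y); have := exprn_gt0 2 h0; lra.
by have := sqr_ge0 (N x); have := exprn_gt0 2 h0; lra.
Qed.

Lemma parallelogram_le2 x y :
  N (x + y) ^+ 2 + N (x - y) ^+ 2 <= 2 * (2 * (N x ^+ 2 + N y ^+ 2)).
Proof.
have h1 : N (x + y) ^+ 2 <= (N x + N y) ^+ 2.
  by rewrite ler_pXn2r ?nnegrE ?addr_ge0//; exact: NS.1.
have h2 : N (x - y) ^+ 2 <= (N x + N y) ^+ 2.
  rewrite ler_pXn2r ?nnegrE ?addr_ge0// -[N y](seminormN (Seminorm NS)); exact: NS.1.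
by have := sqr_ge0 (N x - N y); rewrite sqrrB; rewrite sqrrD in h1 h2; lra.
Qed.

Lemma CNJ_le (z : E) (c : R) : z != 0 ->
  (forall x y, N (x + y) ^+ 2 + N (x - y) ^+ 2 <= c * (2 * (N x ^+ 2 + N y ^+ 2))) ->
  CNJ N <= c.
Proof.
move=> z0 h; apply: ge_sup.
  exists ((N (z + 0) ^+ 2 + N (z - 0) ^+ 2) / (2 * (N z ^+ 2 + N 0 ^+ 2))), z, 0.
  by rewrite xpair_eqE (negbTE z0).
by move=> _ [x [y [/denominator_gt0 d0 ->]]]; rewrite ler_pdivrMr.
Qed.

Lemma CNJ_spec x y :
  N (x + y) ^+ 2 + N (x - y) ^+ 2 <= CNJ N * (2 * (N x ^+ 2 + N y ^+ 2)).
Proof.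
have [/eqP[-> ->]|xy] := boolP ((x, y) == (0, 0)).
  by rewrite subr0 addr0 N0 expr0n /=; lra.
rewrite -ler_pdivrMr ?denominator_gt0//; apply: ub_le_sup; last by exists x, y.
exists 2 => _ [x' [y' [/denominator_gt0 d0 ->]]]; rewrite ler_pdivrMr//.
exact: parallelogram_le2.
Qed.

Lemma CNJ_ge1 (z : E) : z != 0 -> 1 <= CNJ N.
Proof.
move=> /Ngt0 z0; have := CNJ_spec z 0; rewrite addr0 subr0 N0 expr0n addr0 => h.
rewrite -(@ler_pM2r _ (2 * N z ^+ 2)) ?mulr_gt0 ?exprn_gt0//; lra.
Qed.

Lemma CNJ_le2 (z : E) : z != 0 -> CNJ N <= 2.
Proof. by move=> z0; apply: (CNJ_le z0); exact: parallelogram_le2. Qed.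

(** For vectors [x], [y] spanning a nearly isometric two-dimensional [l^1], both
    [x + y] and [x - y] have norm nearly [2]. *)
Lemma CNJ_contains_l1 (c : R) : 0 < c -> contains_l1 N c -> CNJ N = 2.
Proof.
move=> c0 hc.
have l1 (d : R) : 0 < d < 1 -> 2 * d ^+ 2 <= CNJ N.
  move=> /andP[d0 d1]; have [z [z1 hz]] := james_distortion NS c0 hc d1 bool.
  have h1 := hz (fun=> 1); have h2 := hz (fun b => if b then 1 else -1).
  rewrite !big_bool /= !scale1r rnorm1 in h1.
  rewrite !big_bool /= scale1r scaleN1r rnormN rnorm1 in h2.
  have d2 : d * (1 + 1) = 2 * d by lra.
  rewrite d2 in h1 h2.
  have hs : 2 * ((2 * d) ^+ 2) <= N (z true + z false) ^+ 2 + N (z true - z false) ^+ 2.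
    have dd : 0 <= 2 * d by lra.
    have s1 : (2 * d) ^+ 2 <= N (z true + z false) ^+ 2 by rewrite ler_pXn2r ?nnegrE.
    have s2 : (2 * d) ^+ 2 <= N (z true - z false) ^+ 2 by rewrite ler_pXn2r ?nnegrE.
    by lra.
  have hsp := CNJ_spec (z true) (z false).
  have sq1 b : N (z b) ^+ 2 <= 1 by rewrite expr_le1.
  have q1 := sq1 true; have q2 := sq1 false.
  have C0 : 0 <= CNJ N.
    rewrite leNgt; apply/negP => Cn.
    have := sqr_ge0 (N (z true)); have := sqr_ge0 (N (z false)) => p1 p2.
    have : CNJ N * (2 * (N (z true) ^+ 2 + N (z false) ^+ 2)) <= 0.
      by rewrite nmulr_rle0//; lra.
    have : 0 < (2 * d) ^+ 2 by rewrite exprn_gt0//; lra.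
    by lra.
  have : CNJ N * (2 * (N (z true) ^+ 2 + N (z false) ^+ 2)) <= CNJ N * 4.
    by rewrite ler_wpM2l//; lra.
  by rewrite exprMn in hs; lra.
have [z z0] : exists z : E, z != 0.
  have [z [z1 hz]] := hc 'I_1; exists (z ord0); apply/eqP => z0.
  by have := hz (fun=> 1); rewrite !big_ord1 scale1r z0 N0 rnorm1; lra.
apply/eqP; rewrite eq_le (CNJ_le2 z0) /= leNgt; apply/negP => h.
have C1 := CNJ_ge1 z0.
(* The number [(1 + t) / 2] lies between [t] and [1], and its square exceeds [t]. *)
pose t := CNJ N / 2.
have t1 : 1 / 2 <= t < 1 by rewrite /t; apply/andP; split; lra.
have := l1 ((1 + t) / 2); have -> : 0 < (1 + t) / 2 < 1 by apply/andP; split; lra.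
move=> /(_ isT); have -> : CNJ N = 2 * t by rewrite /t; lra.
by have := sqr_ge0 (1 - t); nra.
Qed.

End Constant.

Lemma rnorm_is_norm (Z : normedModType K) : is_norm (@rnorm R k Z).
Proof. by split; [exact: rnorm_is_seminorm|exact: rnorm0_eq0]. Qed.

Lemma rnorm_equivalent (Z : normedModType K) : equivalent_norm (@rnorm R k Z).
Proof.
split; first exact: rnorm_is_norm.
by exists 1, 1; split => // z; rewrite mul1r.
Qed.

Lemma CNJ_envelope_le (Z : normedModType K) (z : Z) (N : Z -> R) : z != 0 ->
  equivalent_norm N -> CNJ_envelope Z <= CNJ N.
Proof.
move=> z0 hN; apply: ge_inf; last by exists N.
by exists 1 => _ [N' [[hN' _] ->]]; exact: (CNJ_ge1 hN' z0).
Qed.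

Lemma CNJ_envelope_ge (Z : normedModType K) (c : R) :
  (forall N : Z -> R, equivalent_norm N -> c <= CNJ N) -> c <= CNJ_envelope Z.
Proof.
move=> h; apply: lb_le_inf; last by move=> _ [N [hN ->]]; exact: h.
by exists (CNJ (@rnorm R k Z)), (@rnorm R k Z); split => //; exact: rnorm_equivalent.
Qed.

Lemma equivalent_norm_contains_l1 (Z : normedModType K) (N : Z -> R) (c : R) :
  equivalent_norm N -> 0 < c -> contains_l1 (@rnorm R k Z) c ->
  exists2 d : R, 0 < d & contains_l1 N d.
Proof.
move=> [[[ND NZ] _] [a [b [a0 b0 hab]]]] c0 hc; exists (b^-1 * (a * c)).
  by rewrite mulr_gt0 ?invr_gt0// mulr_gt0.
move=> I; have [z [z1 hz]] := hc I.
have b1 : rnorm (ofR k b^-1 : K^o) = b^-1 by rewrite rnorm_ofR// invr_ge0 ltW.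
exists (fun i => ofR k b^-1 *: z i); split.
  move=> i; rewrite NZ b1 ler_pdivrMl// mulr1 (le_trans (hab _).2)//.
  by rewrite -[leRHS]mulr1 ler_pM2l.
move=> s; under [X in N X]eq_bigr do rewrite scalerA mulrC -scalerA.
rewrite -scaler_sumr NZ b1 -mulrA ler_pM2l ?invr_gt0//.
by rewrite (le_trans _ (hab _).1)// -mulrA ler_pM2l.
Qed.

Lemma CNJ_envelope_contains_l1 (Z : normedModType K) (c : R) :
  0 < c -> contains_l1 (@rnorm R k Z) c -> CNJ_envelope Z = 2.
Proof.
move=> c0 hc.
have eq2 (N : Z -> R) : equivalent_norm N -> CNJ N = 2.
  move=> hN; have [d d0 hd] := equivalent_norm_contains_l1 hN c0 hc.
  exact: (CNJ_contains_l1 hN.1 d0 hd).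
have [z z0] : exists z : Z, z != 0.
  have [z [z1 hz]] := hc 'I_1; exists (z ord0); apply/eqP => z0.
  by have := hz (fun=> 1); rewrite !big_ord1 scale1r z0 rnorm0 rnorm1; lra.
apply/eqP; rewrite eq_le -{1}(eq2 _ (rnorm_equivalent Z)).
rewrite (CNJ_envelope_le z0 (rnorm_equivalent Z)) /=.
by apply: CNJ_envelope_ge => N /eq2 ->.
Qed.

Lemma CNJ_envelope_ge1 (Z : normedModType K) (z : Z) : z != 0 -> 1 <= CNJ_envelope Z.
Proof. by move=> z0; apply: CNJ_envelope_ge => N [hN _]; exact: (CNJ_ge1 hN z0). Qed.

Lemma CNJ_envelope_scalars : CNJ_envelope (K^o : normedModType K) = 1.
Proof.
have z0 : (1 : K^o) != 0 by exact: oner_neq0.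
apply/eqP; rewrite eq_le (CNJ_envelope_ge1 z0) andbT.
apply: (le_trans (CNJ_envelope_le z0 (rnorm_equivalent _))).
apply: (CNJ_le (rnorm_is_norm _) z0) => x y; rewrite mul1r.
by rewrite !rnorm_sqr !toRD !imKD toRN imKN; lra.
Qed.

End VonNeumannJordan.

(** * Minkowski's inequality for finite sums *)

Section L2Sum.
Variables (R : realType).

(** The triangle inequality for the norm built in [CNJ_envelope_power_le]. *)
Lemma sqrt_sum_sqr_le n (a b c : 'I_n -> R) :
  (forall i, 0 <= a i) -> (forall i, 0 <= b i) -> (forall i, 0 <= c i <= a i + b i) ->
  Num.sqrt (\sum_i c i ^+ 2) <=
  Num.sqrt (\sum_i a i ^+ 2) + Num.sqrt (\sum_i b i ^+ 2).
Proof.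
move=> a0 b0 cab; set A := \sum_i a i ^+ 2; set B := \sum_i b i ^+ 2.
have A0 : 0 <= A by apply: sumr_ge0 => i _; exact: sqr_ge0.
have B0 : 0 <= B by apply: sumr_ge0 => i _; exact: sqr_ge0.
pose s : R := Num.sqrt A; pose t : R := Num.sqrt B; rewrite -/s -/t.
have s0 : 0 <= s by exact: sqrtr_ge0.
have t0 : 0 <= t by exact: sqrtr_ge0.
have sA : s ^+ 2 = A by rewrite sqr_sqrtr.
have tB : t ^+ 2 = B by rewrite sqr_sqrtr.
pose D := \sum_i a i * b i.
have D0 : 0 <= D by apply: sumr_ge0 => i _; exact: mulr_ge0.
have cauchy : D <= s * t.
  have h : 0 <= \sum_i (t * a i - s * b i) ^+ 2 by apply: sumr_ge0 => i _; exact: sqr_ge0.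
  have hE : \sum_i (t * a i - s * b i) ^+ 2 = B * A - 2 * (s * t) * D + A * B.
    rewrite -{1}tB -{2}sA /A /B /D !mulr_sumr -sumrB -big_split; apply: eq_bigr => i _.
    by rewrite /=; ring.
  have zero (x y : 'I_n -> R) : \sum_i x i ^+ 2 = 0 -> \sum_i x i * y i = 0.
    move=> /eqP; rewrite psumr_eq0 => [/allP hx|i _]; last exact: sqr_ge0.
    apply: big1 => i _; have := hx i (mem_index_enum i).
    by rewrite sqrf_eq0 => /eqP ->; rewrite mul0r.
  have [s00|s00] := eqVneq s 0.
    have -> : D = 0 by apply: zero; rewrite -/A -sA s00 expr0n.
    exact: mulr_ge0.
  have [t00|t00] := eqVneq t 0.
    have -> : D = 0.
      rewrite /D; under eq_bigr do rewrite mulrC.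
      by apply: zero; rewrite -/B -tB t00 expr0n.
    exact: mulr_ge0.
  have st : 0 < s * t by rewrite mulr_gt0// lt_neqAle eq_sym ?s00 ?t00.
  rewrite -(ler_pM2l st); rewrite hE -sA -tB in h.
  by lra.
rewrite -(@ler_pXn2r _ 2)// ?nnegrE ?sqrtr_ge0 ?addr_ge0//.
rewrite sqr_sqrtr; last by apply: sumr_ge0 => i _; exact: sqr_ge0.
apply: (@le_trans _ _ (\sum_i (a i + b i) ^+ 2)).
  apply: ler_sum => i _; have /andP[c0 ci] := cab i.
  by rewrite ler_pXn2r ?nnegrE ?addr_ge0.
have -> : \sum_i (a i + b i) ^+ 2 = A + B + 2 * D.
  rewrite /A /B /D mulr_sumr -!big_split; apply: eq_bigr => i _.
  by rewrite /= sqrrD mulr_natl; ring.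
by rewrite sqrrD sA tB mulr2n; lra.
Qed.

End L2Sum.

(** * Spaces modelled on a finite power *)

Section PowerOf.
Variables (R : realType) (k : scalar_kind).
Local Notation K := (scalars R k).

(** The coordinate maps [P] embed [(E, N)] in a power of [Y], with the sum of the
    maps [I] as a left inverse, and [(E, N)] in turn contains [Y] as a
    complemented subspace.  A finite power of [Y] is such a space. *)
Definition power_of (E : lmodType K) (N : E -> R) (Y : normedModType K) : Prop :=
  exists n (I : 'I_n.+1 -> Y -> E) (P : 'I_n.+1 -> E -> Y) (C : R),
  [/\ 0 < C /\ (forall l, linear_map (I l) /\ linear_map (P l)),
      forall l y, N (I l y) <= C * rnorm y,
      forall l z, rnorm (P l z) <= C * N z,
      forall z, z = \sum_l I l (P l z) &
      forall y, P ord0 (I ord0 y) = y].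

(** The [l^2]-sum of the norms of the components inherits the parallelogram
    inequality with the constant of [N], because that inequality adds up. *)
Lemma CNJ_envelope_power_le (Z Y : normedModType K) (y0 : Y) : y0 != 0 ->
  power_of (@rnorm R k Z) Y -> CNJ_envelope Z <= CNJ_envelope Y.
Proof.
move=> y00 [n [I [P [C [[C0 IPl] IC PC IP PI]]]]].
have z00 : I ord0 y0 != 0.
  apply/eqP => h; have := PI y0; rewrite h (linear_map0 (IPl _).2) => /eqP.
  by rewrite eq_sym (negbTE y00).
apply: CNJ_envelope_ge => N hN; have [[hNs N00] [c [d [c0 d0 hcd]]]] := hN.
have Nge0 y : 0 <= N y := seminorm_ge0 (Seminorm hNs) y.
pose N' z := Num.sqrt (\sum_l N (P l z) ^+ 2).
have sum0 z : 0 <= \sum_l N (P l z) ^+ 2 by apply: sumr_ge0 => l _; exact: sqr_ge0.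
have N'2 z : N' z ^+ 2 = \sum_l N (P l z) ^+ 2 by rewrite sqr_sqrtr.
have NleN' l z : N (P l z) <= N' z.
  rewrite -(@ler_pXn2r _ 2)// ?nnegrE ?sqrtr_ge0// N'2 (bigD1 l)//= lerDl.
  by apply: sumr_ge0 => i _; exact: sqr_ge0.
have upper z : N' z <= n.+1%:R * d * C * rnorm z.
  have M0 : 0 <= d * C * rnorm z by rewrite mulr_ge0 ?rnorm_ge0// mulr_ge0// ltW.
  rewrite -(@ler_pXn2r _ 2)// ?nnegrE ?sqrtr_ge0 ?N'2//; last first.
    by rewrite -2!mulrA mulr_ge0// mulrA.
  apply: (@le_trans _ _ (\sum_(l < n.+1) (d * C * rnorm z) ^+ 2)).
    apply: ler_sum => l _; rewrite ler_pXn2r ?nnegrE// (le_trans (hcd _).2)//.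
    by rewrite -mulrA ler_pM2l.
  have -> : n.+1%:R * d * C * rnorm z = n.+1%:R * (d * C * rnorm z) by ring.
  rewrite sumr_const card_ord -[leLHS]mulr_natl [leRHS]exprMn ler_wpM2r ?sqr_ge0//.
  by rewrite expr2 ler_peMr ?ler0n// ler1n.
have lower z : c / (n.+1%:R * C) * rnorm z <= N' z.
  have nC : 0 < n.+1%:R * C by rewrite mulr_gt0// ltr0Sn.
  rewrite mulrAC ler_pdivrMr//.
  have : rnorm z <= \sum_(l < n.+1) C * rnorm (P l z).
    rewrite {1}(IP z); apply: (le_trans (ler_rnorm_sum _ _ _)).
    by apply: ler_sum => l _; exact: IC.
  move=> h; apply: (le_trans (ler_wpM2l (ltW c0) h)).
  have -> : N' z * (n.+1%:R * C) = \sum_(l < n.+1) C * N' z.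
    by rewrite sumr_const card_ord -[RHS]mulr_natr; ring.
  rewrite mulr_sumr; apply: ler_sum => l _; rewrite mulrCA ler_pM2l//.
  exact: le_trans (hcd _).1 (NleN' _ _).
have hN' : equivalent_norm N'.
  split; last first.
    exists (c / (n.+1%:R * C)), (n.+1%:R * d * C); split.
    - by rewrite divr_gt0// mulr_gt0// ltr0Sn.
    - by rewrite !mulr_gt0// ltr0Sn.
    - by move=> z; split; [exact: lower|exact: upper].
  split; last first.
    move=> z z0; rewrite (IP z) big1// => l _.
    have -> : P l z = 0.
      by apply: N00; apply/eqP; rewrite eq_le Nge0 andbT -z0.
    exact: (linear_map0 (IPl l).1).
  split=> [x y|a x].
    apply: sqrt_sum_sqr_le => l //; rewrite Nge0 /= (linear_mapD (IPl l).2).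
    exact: hNs.1.
  rewrite /N'; under eq_bigr do rewrite (linear_mapZ (IPl _).2) hNs.2 exprMn.
  by rewrite -mulr_sumr sqrtrM ?sqr_ge0// sqrtr_sqr ger0_norm ?rnorm_ge0.
apply: (le_trans (CNJ_envelope_le z00 hN')).
apply: (CNJ_le hN'.1 z00) => x y.
rewrite !N'2 -!big_split !mulr_sumr; apply: ler_sum => l _ /=.
rewrite (linear_mapD (IPl l).2) (linear_mapB (IPl l).2).
exact: CNJ_spec.
Qed.

(** A norm of [Z] is restricted to the first copy of [Y]. *)
Lemma CNJ_envelope_power_ge (Z Y : normedModType K) (y0 : Y) : y0 != 0 ->
  power_of (@rnorm R k Z) Y -> CNJ_envelope Y <= CNJ_envelope Z.
Proof.
move=> y00 [n [I [P [C [[C0 IPl] IC PC IP PI]]]]].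
apply: CNJ_envelope_ge => N hN; have [[hNs N00] [c [d [c0 d0 hcd]]]] := hN.
have Il := (IPl ord0).1.
pose N' y := N (I ord0 y).
have hN' : equivalent_norm N'.
  split; first split.
  - split=> [x y|a x]; first by rewrite /N' (linear_mapD Il); exact: hNs.1.
    by rewrite /N' (linear_mapZ Il); exact: hNs.2.
  - move=> y /N00 h; rewrite -(PI y) h; exact: (linear_map0 (IPl _).2).
  - exists (c / C), (d * C); split; [exact: divr_gt0|exact: mulr_gt0|].
    move=> y; split; last by rewrite (le_trans (hcd _).2)// -mulrA ler_pM2l.
    apply: le_trans (hcd _).1; rewrite -mulrA ler_pM2l// ler_pdivrMl//.
    by rewrite -{1}(PI y).
apply: (le_trans (CNJ_envelope_le y00 hN')).
apply: (CNJ_le hN'.1 y00) => x y.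
rewrite /N' (linear_mapD Il) (linear_mapB Il).
exact: CNJ_spec.
Qed.

Theorem CNJ_envelope_power (Z Y : normedModType K) (y0 : Y) : y0 != 0 ->
  power_of (@rnorm R k Z) Y -> CNJ_envelope Z = CNJ_envelope Y.
Proof.
move=> y00 h; apply/eqP.
by rewrite eq_le (CNJ_envelope_power_le y00 h) (CNJ_envelope_power_ge y00 h).
Qed.

Lemma superreflexive_power (Z Y : normedModType K) :
  power_of (@rnorm R k Z) Y -> superreflexive Y -> superreflexive Z.
Proof.
move=> [n [I [P [C [[C0 IPl] IC PC IP PI]]]]].
apply: (@superreflexive_embedding R k Z Y n.+1 P C (ltW C0)) => [l|l v|v].
- exact: (IPl l).2.
- exact: PC.
- rewrite {1}(IP v) mulr_sumr; apply: (le_trans (ler_rnorm_sum _ _ _)).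
  by apply: ler_sum => l _; exact: IC.
Qed.

Lemma superreflexive_of_power (Z Y : normedModType K) :
  power_of (@rnorm R k Z) Y -> superreflexive Z -> superreflexive Y.
Proof.
move=> [n [I [P [C [[C0 IPl] IC PC IP PI]]]]].
apply: (@superreflexive_embedding R k Y Z 1 (fun=> I ord0) C (ltW C0)) => [l|l v|v].
- exact: (IPl _).1.
- exact: IC.
- by rewrite big_ord1 -{1}(PI v).
Qed.

(** A nonzero vector [y0] embeds the scalar field in [Y], hence [X] in a finite
    power of [Y]. *)
Lemma superreflexive_finite (X Y : normedModType K) (y0 : Y) : y0 != 0 ->
  power_of (@rnorm R k X) (K^o : normedModType K) ->
  superreflexive Y -> superreflexive X.
Proof.
move=> y00 [n [I [P [C [[C0 IPl] IC PC IP PI]]]]].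
have r0 : 0 < rnorm y0 by rewrite rnorm_gt0.
pose M := C * rnorm y0 + C / rnorm y0.
have M0 : 0 <= M by rewrite addr_ge0// ltW ?mulr_gt0// invr_gt0.
apply: (@superreflexive_embedding R k X Y n.+1 (fun l x => (P l x : K) *: y0) M) => // [l|l v|v].
- by move=> a x y; rewrite (IPl l).2 scalerDl -scalerA.
- rewrite rnormZ; apply: (@le_trans _ _ (C * rnorm y0 * rnorm v)).
    by rewrite mulrAC ler_wpM2r ?rnorm_ge0.
  by rewrite ler_wpM2r ?rnorm_ge0// lerDl ltW// divr_gt0.
- apply: (@le_trans _ _ (C / rnorm y0 * \sum_l rnorm ((P l v : K) *: y0))).
    rewrite {1}(IP v) mulr_sumr; apply: (le_trans (ler_rnorm_sum _ _ _)).
    apply: ler_sum => l _; rewrite rnormZ [leRHS](_ : _ = C * rnorm (P l v)) ?IC//.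
    by field; rewrite gt_eqF.
  apply: ler_wpM2r; last by rewrite lerDr ltW// mulr_gt0.
  by apply: sumr_ge0 => l _; exact: rnorm_ge0.
Qed.

(** The value at [z] is characterised by the inequalities
    [rnorm (y - p e) <= C * rnorm (z - j e)]; completeness of [Y] provides it, and
    linearity follows from the inequalities alone. *)
Lemma extend_operator (E : lmodType K) (N : seminorm E) (Y : completeNormedModType K)
    (p : E -> Y) (C : R) : 0 <= C -> linear_map p -> (forall e, rnorm (p e) <= C * N e) ->
  exists P : completion N -> Y, [/\ linear_map P, forall z, rnorm (P z) <= C * rnorm z &
    forall e, P (completion_inj N e) = p e].
Proof.
move=> C0 pl pC; pose j := completion_inj N.
have jl : linear_map j by exact: completion_inj_linear_map.
have C1 : 0 < 2 * (C + 1) by rewrite mulr_gt0// ltr_wpDl.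
have C1' : 0 < C + 1 by rewrite ltr_wpDl.
have Nj x y z : N (x - y) <= rnorm (z - j x) + rnorm (z - j y).
  rewrite -(completion_inj_norm N) -/j (linear_mapB jl) (rnorm_distC z (j x)).
  by apply: le_trans (rnormD _ _); rewrite addrA subrK.
have /choice[P hP] z : exists y, forall e, rnorm (y - p e) <= C * rnorm (z - j e).
  have /choice[u hu] (m : nat) : exists e, rnorm (z - j e) <= m.+1%:R^-1.
    by apply: completion_inj_dense; rewrite invr_gt0.
  have [y hy] : exists y, forall e : R, 0 < e -> exists n0 : nat, forall m, (n0 <= m)%N ->
      rnorm (y - p (u m)) < e.
    apply: (@complete_rnorm R k Y (fun m => p (u m))) => e e0.
    have [n0 hn0] := harmonic_lt (divr_gt0 e0 C1); exists n0 => m m' hm hm'.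
    rewrite -(linear_mapB pl); apply: (le_lt_trans (pC _)).
    have h1 := le_lt_trans (hu m) (hn0 _ hm); have h2 := le_lt_trans (hu m') (hn0 _ hm').
    apply: (@le_lt_trans _ _ (C * (2 * (e / (2 * (C + 1)))))).
      by apply: ler_wpM2l => //; have := Nj (u m) (u m') z; lra.
    rewrite (_ : C * _ = e * (C / (C + 1))); last by field; rewrite gt_eqF.
    by rewrite gtr_pMr// ltr_pdivrMr// mul1r ltrDl.
  exists y => e; suff h (d : R) : 0 < d -> rnorm (y - p e) <= C * rnorm (z - j e) + d.
    by apply/ler_addgt0Pr.
  move=> d0; have d2 : 0 < d / 2 by rewrite divr_gt0.
  have [n0 hn0] := hy _ d2; have [n1 hn1] := harmonic_lt (divr_gt0 d2 C1').
  set m := maxn n0 n1.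
  have h1 := hn0 m (leq_maxl _ _).
  have h2 : C * rnorm (z - j (u m)) <= d / 2.
    apply: (le_trans (ler_wpM2l C0 (ltW (le_lt_trans (hu m) (hn1 m (leq_maxr _ _)))))).
    by rewrite mulrCA ger_pMr// ler_pdivrMr// mul1r lerDl.
  have h3 := ler_wpM2l C0 (Nj (u m) e z).
  have h4 := pC (u m - e); rewrite (linear_mapB pl) in h4.
  have := rnormD (y - p (u m)) (p (u m) - p e); rewrite addrA subrK; lra.
have Pj e : P (j e) = p e.
  apply/eqP; rewrite -subr_eq0; apply/eqP; apply: rnorm0_eq0; apply/eqP.
  by rewrite eq_le rnorm_ge0 andbT (le_trans (hP _ e))// subrr rnorm0 mulr0.
exists P; split; [|move=> z|exact: Pj]; last first.
  by have := hP z 0; rewrite (linear_map0 pl) (linear_map0 jl) !subr0.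
move=> l x y; apply/eqP; rewrite -subr_eq0; apply/eqP; apply: rnorm0_eq0; apply/eqP.
rewrite eq_le rnorm_ge0 andbT; set r := rnorm _.
suff h (d : R) : 0 < d -> r <= d by apply/ler_addgt0Pr => d d0; rewrite add0r h.
move=> d0; set a := rnorm (l : K^o); have a0 : 0 <= a by exact: rnorm_ge0.
have q0 : 0 < 2 * ((C + 1) * (a + 1)) by rewrite mulr_gt0// mulr_gt0// ltr_wpDl.
pose q := d / (2 * ((C + 1) * (a + 1))).
have qq : 0 < q by rewrite divr_gt0.
have [e he] := completion_inj_dense x qq; have [e' he'] := completion_inj_dense y qq.
rewrite -/j in he he'.
have h1 := hP (l *: x + y) (l *: e + e'); have h2 := hP x e; have h3 := hP y e'.
have -> : r = rnorm ((P (l *: x + y) - p (l *: e + e')) - (l *: (P x - p e) + (P y - p e'))).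
  by rewrite /r pl scalerBr addrACA -opprD opprB addrA subrK.
apply: (le_trans (rnormD _ _)); rewrite rnormN.
have h4 := rnormD (l *: (P x - p e)) (P y - p e'); rewrite rnormZ -/a in h4.
have h5 : rnorm (l *: x + y - j (l *: e + e')) <= a * q + q.
  by rewrite jl opprD addrACA -scalerBr (le_trans (rnormD _ _))// rnormZ lerD// ler_wpM2l.
have h6 := ler_wpM2l C0 h5; have h7 := ler_wpM2l C0 he; have h8 := ler_wpM2l C0 he'.
have h9 := ler_wpM2l a0 (le_trans h2 h7).
have qE : 2 * (C * (a + 1)) * q <= d.
  by rewrite /q mulrA ler_pdivrMr// [leRHS]mulrC ler_pM2r//; lra.
by lra.
Qed.

Lemma power_of_completion (E : lmodType K) (N : seminorm E) (Y : completeNormedModType K) :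
  power_of N Y -> power_of (@rnorm R k (completion N)) Y.
Proof.
move=> [n [i [p [C [[C0 ipl] iC pC ip pi]]]]].
pose j := completion_inj N; have jl : linear_map j by exact: completion_inj_linear_map.
have /choice[P hP] l : exists P : completion N -> Y,
    [/\ linear_map P, forall z, rnorm (P z) <= C * rnorm z & forall e, P (j e) = p l e].
  by apply: extend_operator; [exact: ltW|exact: (ipl l).2|exact: pC].
have Pl l : linear_map (P l) by have [] := hP l.
have PC l z : rnorm (P l z) <= C * rnorm z by have [] := hP l.
have Pj l e : P l (j e) = p l e by have [] := hP l.
have Il l : linear_map (fun y => j (i l y)) by move=> a x y; rewrite (ipl l).1 jl.
have IC l y : rnorm (j (i l y)) <= C * rnorm y by rewrite completion_inj_norm.
exists n, (fun l y => j (i l y)), P, C; split => //; last by move=> y; rewrite Pj pi.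
move=> z; apply/eqP; rewrite -subr_eq0; apply/eqP; apply: rnorm0_eq0; apply/eqP.
rewrite eq_le rnorm_ge0 andbT; set r := rnorm _.
suff h (d : R) : 0 < d -> r <= d by apply/ler_addgt0Pr => d d0; rewrite add0r h.
move=> d0; pose M := 1 + n.+1%:R * (C * C).
have M0 : 0 < M by rewrite ltr_pwDl// mulr_ge0// mulr_ge0 ?(ltW C0).
have [e he] := completion_inj_dense z (divr_gt0 d0 M0); rewrite -/j in he.
have -> : r = rnorm ((z - j e) - \sum_l j (i l (P l (z - j e)))).
  rewrite /r; congr rnorm.
  under [in RHS]eq_bigr do rewrite (linear_mapB (Pl _)) (linear_mapB (Il _)) Pj.
  have jip : \sum_l j (i l (p l e)) = j e by rewrite -(linear_map_sum jl) -ip.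
  by rewrite sumrB jip opprB addrA subrK.
apply: (le_trans (rnormD _ _)); rewrite rnormN.
apply: (@le_trans _ _ (M * rnorm (z - j e))); last by rewrite mulrC -ler_pdivlMr.
rewrite /M mulrDl mul1r lerD2l; apply: (le_trans (ler_rnorm_sum _ _ _)).
have -> : n.+1%:R * (C * C) * rnorm (z - j e) = \sum_(l < n.+1) C * (C * rnorm (z - j e)).
  by rewrite sumr_const card_ord -[RHS]mulr_natr; ring.
by apply: ler_sum => l _; apply: (le_trans (IC _ _)); rewrite ler_pM2l.
Qed.

Lemma finite_dual_basis (X : normedModType K) (x0 : X) : x0 != 0 -> (dimension X < +oo)%E ->
  exists n (e : 'I_n.+1 -> X) (f : 'I_n.+1 -> dual X),
    (forall x, x = \sum_l f l x *: e l) /\ forall l m, f l (e m) = (l == m)%:R.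
Proof.
move=> x00 /dimension_finP[[|n] [e [he spane]]].
  by have [c] := spane x0; rewrite big_ord0 => x0E; rewrite x0E eqxx in x00.
have /choice[c hc] x : exists c : 'I_n.+1 -> K, x = \sum_l c l *: e l by exact: spane.
have [q q0 hq] := lin_indep_lower he.
have uniq_c (a b : 'I_n.+1 -> K) : \sum_l a l *: e l = \sum_l b l *: e l -> forall l, a l = b l.
  move=> h l; apply/eqP; rewrite -subr_eq0; apply/eqP.
  apply: (he (fun l => a l - b l)); under eq_bigr do rewrite scalerBl.
  by rewrite sumrB h subrr.
have /choice[f hf] l : exists f : dual X, forall x, f x = c x l.
  have qi : 0 <= q^-1 by rewrite invr_ge0 ltW.
  have cl : linear_form (fun x => c x l).
    move=> a x y; apply: (uniq_c _ (fun l => a * c x l + c y l)); rewrite -hc.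
    under eq_bigr do rewrite scalerDl -scalerA.
    by rewrite big_split /= -scaler_sumr -!hc.
  have [|f [hf _]] := dual_of_linear_form cl qi; last by exists f.
  move=> x; rewrite ler_pdivlMl// {2}(hc x); apply: le_trans (hq _).
  rewrite ler_pM2l// (bigD1 l)//= lerDl.
  by apply: sumr_ge0 => i _; exact: rnorm_ge0.
exists n, e, f; split.
  by move=> x; rewrite {1}(hc x); apply: eq_bigr => l _; rewrite hf.
move=> l m; rewrite hf; apply: (uniq_c _ (fun l => (l == m)%:R)).
rewrite -hc (bigD1 m)//= eqxx scale1r big1 ?addr0// => i /negbTE ->.
by rewrite scale0r.
Qed.

Lemma power_of_scalars (X : normedModType K) (x0 : X) : x0 != 0 -> (dimension X < +oo)%E ->
  power_of (@rnorm R k X) (K^o : normedModType K).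
Proof.
move=> x00 hX; have [n [e [f [fe ef]]]] := finite_dual_basis x00 hX.
pose C := 1 + \sum_l (rnorm (e l) + rnorm (f l)).
have C0 l : 0 < C /\ rnorm (e l) <= C /\ rnorm (f l) <= C.
  have h : 0 <= \sum_(i | i != l) (rnorm (e i) + rnorm (f i)).
    by apply: sumr_ge0 => i _; rewrite addr_ge0 ?rnorm_ge0.
  rewrite /C (bigD1 l)//=; have := rnorm_ge0 (e l); have := rnorm_ge0 (f l).
  by move=> ? ?; split; [|split]; lra.
exists n, (fun l (a : K^o) => (a : K) *: e l), (fun l x => f l x), C; split.
- split; first by have [] := C0 ord0.
  move=> l; split; first by move=> a x y; rewrite scalerDl -scalerA.
  exact: dual_linear.
- by move=> l y; rewrite rnormZ mulrC ler_wpM2r ?rnorm_ge0//; have [_ []] := C0 l.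
- move=> l x; apply: (le_trans (dual_bound _ _)).
  by rewrite ler_wpM2r ?rnorm_ge0//; have [_ []] := C0 l.
- exact: fe.
- by move=> y; rewrite dualZ ef eqxx; exact: mulr1.
Qed.

End PowerOf.

(** * Tensor products with a finite-dimensional factor *)

Section FiniteTensors.
Variables (R : realType) (k : scalar_kind).
Local Notation K := (scalars R k).

Lemma tensor_ext (X Y : lmodType K) (v w : tensor X Y) : (forall b, v b = w b) -> v = w.
Proof. by move=> h; apply: val_inj; apply/funext. Qed.

(** [x * y |-> f x *: y].  Functionals on [Y] separate points and composing with
    [g] gives the form [f * g], so the value depends on the tensor only; its norm
    is bounded because product forms are bounded for either cross norm. *)
Lemma contraction (X Y : normedModType K) (f : dual X) :
  exists q : tensor X Y -> Y, [/\ linear_map q,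
    forall s, q (tsum s) = \sum_(p <- s) f p.1 *: p.2 &
    forall alpha w, rnorm (q w) <= (1 + rnorm f) * tensor_norm alpha X Y w].
Proof.
have /choice[sq hsq] (w : tensor X Y) : exists s, w = tsum s by exact: tsum_surj.
pose q w := \sum_(p <- sq w) f p.1 *: p.2.
have qg (g : dual Y) w : g (q w) = w (BilinearForm (dual_bilinear f g)).
  rewrite {2}(hsq w) /q (linear_form_sum _ _ _ (dual_linear_form g)) -tensor_dualE.
  by apply: eq_bigr => p _; rewrite dualZ.
exists q; split.
- move=> l v w; apply: dual_separates => g.
  by rewrite dual_linear !qg.
- move=> s; apply: dual_separates => g; rewrite qg -tensor_dualE.
  rewrite (linear_form_sum _ _ _ (dual_linear_form g)).
  by apply: eq_bigr => p _; rewrite dualZ.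
move=> alpha w; have [g [g1 gq]] := norming_functional (q w).
have -> : rnorm (q w) = rnorm (g (q w)) by rewrite gq rnorm_ofR// rnorm_ge0.
have r0 : 0 < 1 + rnorm f by have := rnorm_ge0 f; lra.
pose f' : dual X := ofR k (1 + rnorm f)^-1 *: f.
have f'1 : rnorm f' <= 1.
  rewrite rnormZ rnorm_ofR ?invr_ge0 ?(ltW r0)// ler_pdivrMl// mulr1 lerDr//.
have := functional_le_tensor_norm alpha w f'1 g1.
have -> : w (BilinearForm (dual_bilinear f' g)) = ofR k (1 + rnorm f)^-1 * g (q w) :> K.
  rewrite qg (hsq w) -!tensor_dualE mulr_sumr; apply: eq_bigr => p _.
  by rewrite mulrA.
by rewrite rnormM rnorm_ofR ?invr_ge0 ?(ltW r0)// ler_pdivrMl.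
Qed.

Lemma bilinear_suml (X Y : lmodType K) (b : bilinear_form X Y) (I : Type) (r : seq I)
    (a : I -> K) (x : I -> X) y :
  b (\sum_(i <- r) a i *: x i) y = \sum_(i <- r) a i * b (x i) y.
Proof.
have bl : linear_map (fun x => b x y : K^o) by move=> l u v; exact: (bilinP b).1.
exact: (linear_map_comb bl).
Qed.

Lemma bilinear_sumr (X Y : lmodType K) (b : bilinear_form X Y) (I : Type) (r : seq I)
    (a : I -> K) x (y : I -> Y) :
  b x (\sum_(i <- r) a i *: y i) = \sum_(i <- r) a i * b x (y i).
Proof.
have bl : linear_map (fun y => b x y : K^o) by move=> l u v; exact: (bilinP b).2.
exact: (linear_map_comb bl).
Qed.

(** The components of [w] are its contractions with a dual basis of [X], and the
    embeddings are [y |-> e l * y]. *)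
Lemma tensor_power_of (X Y : normedModType K) (x0 : X) alpha : x0 != 0 ->
  (dimension X < +oo)%E -> power_of (tensor_norm alpha X Y) Y.
Proof.
move=> x00 hX; have [n [e [f [fe ef]]]] := finite_dual_basis x00 hX.
have /choice[q hq] l : exists q : tensor X Y -> Y, [/\ linear_map q,
    forall s, q (tsum s) = \sum_(p <- s) f l p.1 *: p.2 &
    forall w, rnorm (q w) <= (1 + rnorm (f l)) * tensor_norm alpha X Y w].
  by have [q [q1 q2 q3]] := contraction Y (f l); exists q; split.
pose C := 1 + \sum_l (rnorm (e l) + rnorm (f l)).
have C0 l : 0 < C /\ rnorm (e l) <= C /\ 1 + rnorm (f l) <= C.
  have h : 0 <= \sum_(i | i != l) (rnorm (e i) + rnorm (f i)).
    by apply: sumr_ge0 => i _; rewrite addr_ge0 ?rnorm_ge0.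
  rewrite /C (bigD1 l)//=; have := rnorm_ge0 (e l); have := rnorm_ge0 (f l).
  by move=> ? ?; split; [|split]; lra.
exists n, (fun l y => etensor (e l) y), q, C; split.
- split; first by have [] := C0 ord0.
  move=> l; split; last by have [] := hq l.
  move=> a x y; apply: tensor_ext => b.
  have -> : (a *: etensor (e l) x + etensor (e l) y) b =
      a * etensor (e l) x b + etensor (e l) y b :> K by [].
  by rewrite !etensorE (bilinP b).2.
- move=> l y; apply: (le_trans (tensor_norm_etensor _ _ _)).
  by rewrite ler_wpM2r ?rnorm_ge0//; have [_ []] := C0 l.
- move=> l w; have [_ _ h] := hq l; apply: (le_trans (h w)).
  by rewrite ler_wpM2r ?seminorm_ge0//; have [_ []] := C0 l.
- move=> w; have [s ->] := tsum_surj w; apply: tensor_ext => b.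
  rewrite tensor_sumE /= /tsum_fun.
  under [RHS]eq_bigr => l _ do rewrite big_seq1 /=.
  have qs l : q l (tsum s) = \sum_(p <- s) f l p.1 *: p.2 by have [] := hq l.
  under [RHS]eq_bigr => l _ do rewrite qs bilinear_sumr.
  rewrite exchange_big /=; apply: eq_bigr => p _.
  by rewrite {1}(fe p.1) bilinear_suml.
- move=> y; have [_ qs _] := hq ord0.
  by rewrite /etensor qs big_seq1 ef eqxx scale1r.
Qed.

Section Flip.
Variables X Y : normedModType K.

Lemma flip_bilinear (b : bilinear_form Y X) : is_bilinear (fun x y => b y x).
Proof. by split=> [l x x' y|l x y y']; [exact: (bilinP b).2|exact: (bilinP b).1]. Qed.

Definition flip_fun (w : tensor X Y) : bilinear_form Y X -> K^o :=
  fun b => w (BilinearForm (flip_bilinear b)).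

Definition swap_seq (s : seq (X * Y)) := [seq (p.2, p.1) | p <- s].

Lemma flip_fun_tsum s : flip_fun (tsum s) = tsum_fun (swap_seq s).
Proof. by apply/funext => b; rewrite /tsum_fun big_map. Qed.

Lemma flip_proof w : tensor_pred (flip_fun w).
Proof.
by apply/asboolP; have [s ->] := tsum_surj w; exists (swap_seq s); exact: flip_fun_tsum.
Qed.

Definition flip (w : tensor X Y) : tensor Y X := Tensor (flip_proof w).

Lemma flip_tsum s : flip (tsum s) = tsum (swap_seq s).
Proof. by apply: val_inj; exact: flip_fun_tsum. Qed.

Lemma flip_linear : linear_map flip.
Proof. by move=> l v w; apply: val_inj; apply/funext. Qed.

Lemma tensor_norm_flip alpha w : tensor_norm alpha Y X (flip w) <= tensor_norm alpha X Y w.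
Proof.
case: alpha => /=.
  apply: inj_norm_le => g f g1 f1.
  suff -> : flip w (BilinearForm (dual_bilinear g f)) =
      w (BilinearForm (dual_bilinear f g)) by exact: inj_norm_ub.
  have [s ->] := tsum_surj w; rewrite flip_tsum -!tensor_dualE big_map.
  by apply: eq_bigr => p _; rewrite mulrC.
apply/ler_addgt0Pr => e e0; have [s ws hs] := proj_norm_adherent w e0.
rewrite {1}ws flip_tsum; apply: (le_trans (proj_norm_lb _)); rewrite big_map /=.
by apply: le_trans (ltW hs); apply: ler_sum => p _; rewrite mulrC.
Qed.

End Flip.

Lemma flipK (X Y : normedModType K) : cancel (@flip X Y) (@flip Y X).
Proof.
move=> w; have [s ->] := tsum_surj w; rewrite !flip_tsum /swap_seq -map_comp.
by congr tsum; rewrite -[RHS]map_id; apply: eq_map => -[].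
Qed.

(** The symmetric statement, transported along the isometric flip. *)
Lemma tensor_power_of_flip (X Y : normedModType K) (y0 : Y) alpha : y0 != 0 ->
  (dimension Y < +oo)%E -> power_of (tensor_norm alpha X Y) X.
Proof.
move=> y00 hY.
have [n [i [p [C [[C0 ipl] iC pC ip pi]]]]] := tensor_power_of X alpha y00 hY.
exists n, (fun l x => flip (i l x)), (fun l w => p l (flip w)), C; split.
- split => // l; split; first by move=> a x y; rewrite (ipl l).1 flip_linear.
  by move=> a v w; rewrite flip_linear (ipl l).2.
- by move=> l x; exact: le_trans (tensor_norm_flip _ _) (iC _ _).
- move=> l w; apply: (le_trans (pC _ _)); rewrite ler_pM2l//; exact: tensor_norm_flip.
- by move=> w; rewrite -(linear_map_sum (@flip_linear Y X)) -ip flipK.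
- by move=> x; rewrite flipK pi.
Qed.

End FiniteTensors.

Theorem theorem5p8 (R : realType) (k : scalar_kind)
  (X Y : completeNormedModType (scalars R k)) (alpha : cross_norm)
  (hX : exists x : X, x <> 0) (hY : exists y : Y, y <> 0) :
  (dimension X = +oo%E -> dimension Y = +oo%E ->
     CNJ_envelope (completed_tensor alpha X Y) = 2) /\
  ((dimension X < +oo)%E ->
     CNJ_envelope (completed_tensor alpha X Y) = CNJ_envelope Y) /\
  ((dimension Y < +oo)%E ->
     CNJ_envelope (completed_tensor alpha X Y) = CNJ_envelope X) /\
  ((dimension X < +oo)%E -> (dimension Y < +oo)%E ->
     CNJ_envelope X = 1 /\ CNJ_envelope Y = 1 /\
     CNJ_envelope (completed_tensor alpha X Y) = 1) /\
  (CNJ_envelope (completed_tensor alpha X Y) < 2 <->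
     CNJ_envelope X < 2 /\ CNJ_envelope Y < 2 /\
     (Order.min (dimension X) (dimension Y) < +oo)%E) /\
  (superreflexive (completed_tensor alpha X Y) <->
     (superreflexive X /\ superreflexive Y) /\
     ((dimension X < +oo)%E \/ (dimension Y < +oo)%E)).
Proof.
have [x0 /eqP x00] := hX; have [y0 /eqP y00] := hY.
pose Z := completed_tensor alpha X Y.
have powY : (dimension X < +oo)%E -> power_of (@rnorm R k Z) Y.
  by move=> h; exact: power_of_completion (tensor_power_of Y alpha x00 h).
have powX : (dimension Y < +oo)%E -> power_of (@rnorm R k Z) X.
  by move=> h; exact: power_of_completion (tensor_power_of_flip X alpha y00 h).
have l1Z : dimension X = +oo%E -> dimension Y = +oo%E ->
    contains_l1 (@rnorm R k Z) (1 / 512).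
  by move=> hX' hY'; exact: completed_tensor_contains_l1.
have c0 : (0 : R) < 1 / 512 by lra.
have env2 hX' hY' : CNJ_envelope Z = 2 := CNJ_envelope_contains_l1 c0 (l1Z hX' hY').
have envY h : CNJ_envelope Z = CNJ_envelope Y := CNJ_envelope_power y00 (powY h).
have envX h : CNJ_envelope Z = CNJ_envelope X := CNJ_envelope_power x00 (powX h).
have one (V : normedModType (scalars R k)) (v : V) : v != 0 -> (dimension V < +oo)%E ->
    CNJ_envelope V = 1.
  move=> v0 h; rewrite -(CNJ_envelope_scalars R k).
  apply: (@CNJ_envelope_power _ _ _ _ (1 : (scalars R k)^o)); first exact: oner_neq0.
  exact: power_of_scalars v0 h.
have fin_or_oo (V : normedModType (scalars R k)) :
    (dimension V < +oo)%E \/ dimension V = +oo%E.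
  by have [->|h] := eqVneq (dimension V) +oo%E; [right|left; rewrite ltey].
do 4!split => //.
  by move=> h h'; rewrite -/Z (envY h) (one X x0)// (one Y y0).
split; split.
- rewrite -/Z => Z2.
  have [dX|dX] := fin_or_oo X; have [dY|dY] := fin_or_oo Y.
  + by rewrite (one X x0)// (one Y y0)// gt_min dX; do !split => //; lra.
  + by rewrite (one X x0)// -(envY dX) gt_min dX; do !split => //; lra.
  + by rewrite (one Y y0)// -(envX dY) gt_min dY orbT; do !split => //; lra.
  + by move: Z2; rewrite env2// ltxx.
- move=> [X2 [Y2]]; rewrite gt_min => /orP[h|h]; first by rewrite -/Z (envY h).
  by rewrite -/Z (envX h).
- move=> sZ; have [dX|dX] := fin_or_oo X.
    have sY := superreflexive_of_power (powY dX) sZ.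
    split; last by left.
    by split => //; exact: (superreflexive_finite y00 (power_of_scalars x00 dX) sY).
  have [dY|dY] := fin_or_oo Y; last by case: (superreflexive_no_l1 c0 (l1Z dX dY) sZ).
  have sX := superreflexive_of_power (powX dY) sZ.
  split; last by right.
  by split => //; exact: (superreflexive_finite x00 (power_of_scalars y00 dY) sX).
- move=> [[sX sY] [h|h]]; first exact: superreflexive_power (powY h) sY.
  exact: superreflexive_power (powX h) sX.
Qed.
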